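(* Let $m$ be a positive integer and $0<x<2\pi$. Then $$\sum_{n=1}^\infty\frac{\cos nx}{n^{2m-1}}=\frac{(-1)^{m-1}(2\pi)^{2m-2}}{(2m-2)!}\Big(\zeta'\Big(2-2m,1-\frac x{2\pi}\Big)+\zeta'\Big(2-2m,\frac x{2\pi}\Big)\Big).$$
   Context: For $0<a\le 1$, $\zeta(s,a)$ denotes the Hurwitz zeta function, defined for $\Re s>1$ by $\zeta(s,a)=\sum_{k=0}^\infty (k+a)^{-s}$ and extended by analytic continuation to all complex $s\neq 1$. Throughout, $\zeta'(s,a)$ denotes the partial derivative $\frac{\partial}{\partial s}\zeta(s,a)$ with respect to the first variable $s$. *)

(* Defs.v *)
From Stdlib Require Import Reals.
From Coquelicot Require Import Coquelicot.

Definition cpow_pos (t : R) (s : C) : C :=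
  (exp (Re s * ln t) * cos (Im s * ln t), exp (Re s * ln t) * sin (Im s * ln t)).

(* F is the Hurwitz zeta function zeta(., a): F is holomorphic (complex
   differentiable) on C \ {1} and, for Re s > 1, F s = sum_{k>=0} (k+a)^(-s).
   By the identity theorem such an F is unique (it is the analytic
   continuation of the series). *)
Definition is_hurwitz_zeta (a : R) (F : C -> C) : Prop :=
  (forall z : C, z <> RtoC 1 -> ex_derive (K := C_AbsRing) F z) /\
  (forall s : C, 1 < Re s ->
     is_series (fun k : nat => cpow_pos (INR k + a) (Copp s)) (F s)).

(* Main.v *)
Require Import Defs.
From Stdlib Require Import Reals Lra Lia Psatz.
From Coquelicot Require Import Coquelicot.
Open Scope R_scope.

(** Write a = x / (2 pi) and S = F1 + F2, so that S(s) is the sum of |k + a|^(-s) over all integers k.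
    Let kappa(u) be the sum of u / (u^2 + (k + a)^2) over the integers k. Integrating termwise, for 1 < Re s < 2,
    S(s) B(s) = K(s), where B and K are the integrals over u > 0 of u^(1-s) / (u^2 + 1) and of u^(-s) kappa(u).
    Substituting u = exp y, both integrals continue meromorphically to the left; near s = -2j, B has a simple pole with
    residue (-1)^j and K is holomorphic. Hence S(-2j) = 0 and S'(-2j) = (-1)^j K(-2j). On the other hand
    kappa(u) = pi sinh(2 pi u) / (cosh(2 pi u) - cos x) = pi + 2 pi sum_(l >= 1) cos(l x) exp(-2 pi l u),
    so that K(-2j) is the integral of u^(2j) (kappa(u) - pi), that is (2j)! (2 pi)^(-2j) sum_l cos(l x) / l^(2j+1).

    The identity S B = K is known on the line Re s = 7/4 and must be carried to s = -2j + i e, for an arbitrary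
    holomorphic S on C \ {1}. This uses Goursat's theorem and Cauchy's formula on rectangles, applied to
    (S B_T - K_T) exp(N q), where B_T and K_T are truncated integrals and Re q vanishes on three sides of the rectangle. *)

(** * Complex-valued integrals, complex differentiability and the exponential *)

(** All integrals are truncated to |y| <= T, hence entire in s. Passing to the limit then costs only
    bounds uniform in T and the smallness of S B_T - K_T on one vertical line.

    The abscissa 7/4 leaves room on both sides: the series for S needs Re s > 1, and the integrals
    need Re s < 2 at u = 0. The weights exp(2 y) and exp(3 y / 2), with exponents on the two sides
    of 7/4, control the tails of the kernel series at -oo and +oo.

    The singularities of S and of the continued integrals are real. The rectangle is therefore
    placed in the upper half-plane, and the point -2j is reached by letting e tend to 0 after T has
    gone to infinity: B is of size 1 / e and K is bounded, which forces S(-2j) = 0, and the next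
    order in e gives the derivative.

    For m = 1 the cosine series need not converge absolutely, so the expansion of kappa is not
    integrated as an infinite series. It is cut after finitely many terms with an explicit
    remainder, which costs a factor 1 / (1 - cos x) and decays at least like 1 / N. *)

Lemma Cmod_le_Rabs_sum (z : C) : Cmod z <= Rabs (Re z) + Rabs (Im z).
Proof.
  unfold Cmod. change (fst z) with (Re z). change (snd z) with (Im z).
  rewrite <- (sqrt_pow2 (Rabs (Re z) + Rabs (Im z))).
  2: generalize (Rabs_pos (Re z)) (Rabs_pos (Im z)); lra.
  apply sqrt_le_1_alt.
  rewrite <- (pow2_abs (Re z)), <- (pow2_abs (Im z)).
  generalize (Rabs_pos (Re z)) (Rabs_pos (Im z)); nra.
Qed.

Lemma Im_le_Cmod (z : C) : Rabs (Im z) <= Cmod z.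
Proof.
  apply Rle_trans with (2 := Rmax_Cmod z). apply Rmax_r.
Qed.

Definition Ccont (f : R -> C) (x : R) : Prop :=
  continuous (fun t => Re (f t)) x /\ continuous (fun t => Im (f t)) x.

(** Taken componentwise, so that existence, linearity and explicit values come from real
    integration. *)
Definition CInt (f : R -> C) (a b : R) : C :=
  (RInt (fun t => Re (f t)) a b, RInt (fun t => Im (f t)) a b).

Lemma Ccont_const (c : C) x : Ccont (fun _ => c) x.
Proof. split; apply continuous_const. Qed.

Lemma Ccont_RtoC (f : R -> R) x : continuous f x -> Ccont (fun t => RtoC (f t)) x.
Proof. intros H; split; [exact H | apply continuous_const]. Qed.

Lemma Ccont_plus f g x : Ccont f x -> Ccont g x -> Ccont (fun t => f t + g t)%C x.
Proof.
  intros [H1 H2] [H3 H4]; split; simpl; apply @continuous_plus; assumption.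
Qed.

Lemma Ccont_opp f x : Ccont f x -> Ccont (fun t => - f t)%C x.
Proof. intros [H1 H2]; split; simpl; apply @continuous_opp; assumption. Qed.

Lemma Ccont_minus f g x : Ccont f x -> Ccont g x -> Ccont (fun t => f t - g t)%C x.
Proof. intros H1 H2; apply Ccont_plus; [|apply Ccont_opp]; assumption. Qed.

Lemma Ccont_mult f g x : Ccont f x -> Ccont g x -> Ccont (fun t => f t * g t)%C x.
Proof.
  intros [H1 H2] [H3 H4]; split; simpl.
  - apply (continuous_minus (fun t => fst (f t) * fst (g t)) (fun t => snd (f t) * snd (g t)));
    apply (continuous_mult (K := R_AbsRing)); assumption.
  - apply (continuous_plus (fun t => fst (f t) * snd (g t)) (fun t => snd (f t) * fst (g t)));
    apply (continuous_mult (K := R_AbsRing)); assumption.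
Qed.

Definition Ccont_on (f : R -> C) (a b : R) := forall x, a <= x <= b -> Ccont f x.

Lemma Ccont_on_ex_RInt f a b : a <= b -> Ccont_on f a b ->
  ex_RInt (fun t => Re (f t)) a b /\ ex_RInt (fun t => Im (f t)) a b.
Proof.
  intros Hab H.
  split; apply (ex_RInt_continuous (V := R_CompleteNormedModule));
  rewrite Rmin_left, Rmax_right by lra; intros z Hz; apply (H z Hz).
Qed.

Lemma CInt_ext f g a b : a <= b -> (forall x, a <= x <= b -> f x = g x) -> CInt f a b = CInt g a b.
Proof.
  intros Hab H. unfold CInt. f_equal; apply RInt_ext;
  rewrite Rmin_left, Rmax_right by lra; intros x Hx; rewrite H by lra; reflexivity.
Qed.

Lemma CInt_plus f g a b : a <= b -> Ccont_on f a b -> Ccont_on g a b ->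
  CInt (fun t => f t + g t)%C a b = (CInt f a b + CInt g a b)%C.
Proof.
  intros Hab Hf Hg.
  destruct (Ccont_on_ex_RInt f a b Hab Hf), (Ccont_on_ex_RInt g a b Hab Hg).
  unfold CInt, Cplus; simpl. f_equal.
  - apply (RInt_plus (V := R_CompleteNormedModule)); assumption.
  - apply (RInt_plus (V := R_CompleteNormedModule)); assumption.
Qed.

Lemma CInt_scal (c : C) f a b : a <= b -> Ccont_on f a b ->
  CInt (fun t => c * f t)%C a b = (c * CInt f a b)%C.
Proof.
  intros Hab Hf.
  destruct (Ccont_on_ex_RInt f a b Hab Hf) as [H1 H2].
  unfold CInt, Cmult; simpl. f_equal; apply is_RInt_unique.
  - apply (is_RInt_minus (V := R_CompleteNormedModule));
    apply (is_RInt_scal (V := R_CompleteNormedModule)); apply (RInt_correct (V := R_CompleteNormedModule)); assumption.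
  - apply (is_RInt_plus (V := R_CompleteNormedModule));
    apply (is_RInt_scal (V := R_CompleteNormedModule)); apply (RInt_correct (V := R_CompleteNormedModule)); assumption.
Qed.

Lemma CInt_minus f g a b : a <= b -> Ccont_on f a b -> Ccont_on g a b ->
  CInt (fun t => f t - g t)%C a b = (CInt f a b - CInt g a b)%C.
Proof.
  intros Hab Hf Hg.
  destruct (Ccont_on_ex_RInt f a b Hab Hf), (Ccont_on_ex_RInt g a b Hab Hg).
  unfold CInt, Cminus, Cplus, Copp; simpl. f_equal.
  - apply (RInt_minus (V := R_CompleteNormedModule)); assumption.
  - apply (RInt_minus (V := R_CompleteNormedModule)); assumption.
Qed.

Lemma CInt_Chasles f a b c : a <= b <= c -> Ccont_on f a c ->
  (CInt f a b + CInt f b c)%C = CInt f a c.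
Proof.
  intros Hab Hf.
  destruct (Ccont_on_ex_RInt f a b) as [H1 H2]; try lra.
  { intros x Hx; apply Hf; lra. }
  destruct (Ccont_on_ex_RInt f b c) as [H3 H4]; try lra.
  { intros x Hx; apply Hf; lra. }
  unfold CInt, Cplus; simpl. f_equal;
  apply (RInt_Chasles (V := R_CompleteNormedModule)); assumption.
Qed.

(** The pair of real integrals is also the integral of a function with values in [C_R_NormedModule],
    whose norm is [Cmod]. The estimate thus avoids the constant that bounding the components
    separately would lose. *)
Lemma Cmod_CInt_le f g a b : a <= b -> Ccont_on f a b -> ex_RInt g a b ->
  (forall x, a <= x <= b -> Cmod (f x) <= g x) -> Cmod (CInt f a b) <= RInt g a b.
Proof.
  intros Hab Hf Hg H.
  destruct (Ccont_on_ex_RInt f a b Hab Hf) as [H1 H2].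
  rewrite Cmod_norm.
  apply (norm_RInt_le (V := C_R_NormedModule) f g a b); trivial.
  - intros x Hx. rewrite <- Cmod_norm. apply H, Hx.
  - apply (is_RInt_fct_extend_pair (U := R_NormedModule) (V := R_NormedModule));
    apply (RInt_correct (V := R_CompleteNormedModule)); assumption.
  - apply (RInt_correct (V := R_CompleteNormedModule)); assumption.
Qed.

Lemma Cmod_CInt_le_const f a b M : a <= b -> Ccont_on f a b ->
  (forall x, a <= x <= b -> Cmod (f x) <= M) -> Cmod (CInt f a b) <= (b - a) * M.
Proof.
  intros Hab Hf H.
  replace ((b - a) * M) with (RInt (fun _ => M) a b).
  - apply Cmod_CInt_le; trivial. apply ex_RInt_const.
  - rewrite RInt_const. reflexivity.
Qed.

(** * Complex derivatives and their algebra *)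

Notation is_Cderive f z l := (is_derive (K := C_AbsRing) (V := C_NormedModule) f z l) (only parsing).
Notation Cdiff f z := (ex_derive (K := C_AbsRing) (V := C_NormedModule) f z) (only parsing).

Lemma is_Cderive_eps (f : C -> C) (z l : C) :
  is_Cderive f z l <->
  forall eps, 0 < eps -> exists delta, 0 < delta /\
    forall w, Cmod (w - z) < delta -> Cmod (f w - f z - (w - z) * l) <= eps * Cmod (w - z).
Proof.
  split.
  - intros [_ H] eps Heps.
    specialize (H z (fun P HP => HP) (mkposreal eps Heps)).
    destruct H as [d Hd].
    exists d; split; [apply cond_pos|].
    intros w Hw. apply (Hd w). exact Hw.
  - intros H; split.
    + apply (is_linear_scal_l (K := C_AbsRing) (V := C_NormedModule)).
    + intros x Hx eps.
      apply (is_filter_lim_locally_unique (V := AbsRing_NormedModule C_AbsRing)) in Hx. subst x.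
      destruct (H eps (cond_pos eps)) as [d [Hd H']].
      exists (mkposreal d Hd). intros w Hw. apply H'. exact Hw.
Qed.

(** Continuity is wanted only along horizontal and vertical segments, hence an affine path [g] of
    direction [c]. *)
Lemma is_Cderive_path (f : C -> C) (z l : C) (g : R -> C) (x : R) (c : C) :
  is_Cderive f z l -> g x = z -> (forall t, g t - g x = (t - x)%R * c)%C ->
  forall eps, 0 < eps -> exists delta, 0 < delta /\
    forall t, Rabs (t - x) < delta -> Cmod (f (g t) - f z) <= eps.
Proof.
  intros H Hg Hl eps Heps.
  rewrite is_Cderive_eps in H.
  (* Tolerance 1 in the derivative already gives the local Lipschitz constant 1 + |l|. *)
  destruct (H 1 Rlt_0_1) as [d [Hd H1]].
  assert (Hc := Cmod_ge_0 c). assert (Hl' := Cmod_ge_0 l).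
  exists (Rmin (d / (Cmod c + 1)) (eps / ((Cmod c + 1) * (1 + Cmod l)))).
  assert (0 < d / (Cmod c + 1)) by (apply Rdiv_lt_0_compat; lra).
  assert (0 < eps / ((Cmod c + 1) * (1 + Cmod l))) by (apply Rdiv_lt_0_compat; nra).
  split. { apply Rmin_glb_lt; assumption. }
  intros t Ht.
  assert (Hw : Cmod (g t - z) = Rabs (t - x) * Cmod c).
  { rewrite <- Hg, Hl, Cmod_mult, Cmod_R. reflexivity. }
  assert (H3 : Rabs (t - x) * (Cmod c + 1) < d).
  { apply (Rmult_lt_reg_r (/ (Cmod c + 1))). apply Rinv_0_lt_compat; lra.
    rewrite Rmult_assoc, Rinv_r, Rmult_1_r by lra.
    apply Rlt_le_trans with (1 := Ht), Rmin_l. }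
  assert (H4 : Rabs (t - x) * ((Cmod c + 1) * (1 + Cmod l)) < eps).
  { apply (Rmult_lt_reg_r (/ ((Cmod c + 1) * (1 + Cmod l)))). apply Rinv_0_lt_compat; nra.
    rewrite Rmult_assoc, Rinv_r, Rmult_1_r by nra.
    apply Rlt_le_trans with (1 := Ht), Rmin_r. }
  assert (Ha := Rabs_pos (t - x)).
  assert (Hd2 : Cmod (g t - z) < d) by nra.
  apply H1 in Hd2.
  replace (f (g t) - f z)%C with ((f (g t) - f z - (g t - z) * l) + (g t - z) * l)%C by ring.
  apply Rle_trans with (1 := Cmod_triangle _ _).
  rewrite Cmod_mult, Hw in *.
  assert (0 <= Rabs (t - x) * Cmod c) by nra.
  assert (0 <= Rabs (t - x) * Cmod l) by nra.
  nra.
Qed.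

Lemma Cdiff_Ccont (f : C -> C) (g : R -> C) (x : R) (c : C) :
  Cdiff f (g x) -> (forall t, g t - g x = (t - x)%R * c)%C -> Ccont (fun t => f (g t)) x.
Proof.
  intros [l Hl] Hg.
  split; apply filterlim_locally; intros eps;
  destruct (is_Cderive_path f (g x) l g x c Hl eq_refl Hg (eps / 2)) as [d [Hd H]];
  try (generalize (cond_pos eps); lra); exists (mkposreal d Hd); intros t Ht;
  specialize (H t Ht); change (Rabs (Re (f (g t)) - Re (f (g x))) < eps) || change (Rabs (Im (f (g t)) - Im (f (g x))) < eps);
  apply Rle_lt_trans with (Cmod (f (g t) - f (g x))); try (generalize (cond_pos eps); lra).
  - apply (re_le_Cmod (f (g t) - f (g x))).
  - apply (Im_le_Cmod (f (g t) - f (g x))).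
Qed.

Lemma Cdiff_h (f : C -> C) (x y : R) : Cdiff f (x, y) -> Ccont (fun t => f (t, y)) x.
Proof.
  intros H. apply (Cdiff_Ccont f (fun t => (t, y)) x 1); trivial.
  intros t. unfold Cminus, Cplus, Copp, Cmult, RtoC; simpl. f_equal; ring.
Qed.

Lemma Cdiff_v (f : C -> C) (x y : R) : Cdiff f (x, y) -> Ccont (fun t => f (x, t)) y.
Proof.
  intros H. apply (Cdiff_Ccont f (fun t => (x, t)) y Ci); trivial.
  intros t. unfold Cminus, Cplus, Copp, Cmult, RtoC, Ci; simpl. f_equal; ring.
Qed.

Lemma Cdiff_const (c : C) z : Cdiff (fun _ => c) z.
Proof. exists zero. apply is_derive_const. Qed.

Lemma Cdiff_id z : Cdiff (fun w => w) z.
Proof.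
  exists (RtoC 1). apply is_Cderive_eps. intros eps Heps. exists 1. split; [lra|]. intros w _.
  replace (w - z - (w - z) * 1)%C with (RtoC 0) by ring. rewrite Cmod_0.
  apply Rmult_le_pos; [lra | apply Cmod_ge_0].
Qed.

Lemma Cdiff_plus f g z : Cdiff f z -> Cdiff g z -> Cdiff (fun w => f w + g w)%C z.
Proof.
  intros [a Ha] [b Hb]. exists (plus a b).
  apply (is_derive_plus (K := C_AbsRing) (V := C_NormedModule)); assumption.
Qed.

Lemma Cdiff_opp f z : Cdiff f z -> Cdiff (fun w => - f w)%C z.
Proof.
  intros [a Ha]. exists (opp a).
  apply (is_derive_opp (K := C_AbsRing) (V := C_NormedModule)); assumption.
Qed.

Lemma Cdiff_minus f g z : Cdiff f z -> Cdiff g z -> Cdiff (fun w => f w - g w)%C z.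
Proof. intros; apply Cdiff_plus; [|apply Cdiff_opp]; assumption. Qed.


Lemma is_Cderive_mult f g z a b : is_Cderive f z a -> is_Cderive g z b ->
  is_Cderive (fun w => f w * g w)%C z (a * g z + f z * b)%C.
Proof.
  intros Hf Hg.
  assert (H := is_derive_mult (K := C_AbsRing) f g z a b).
  (* [is_derive_mult] speaks of another module structure on C. The approximation half of the
     derivative carries over by conversion; only the linearity half is proved again. *)
  destruct H as [H1 H2].
  - destruct Hf as [_ H2]; split; [apply (is_linear_scal_l (K := C_AbsRing)) | exact H2].
  - destruct Hg as [_ H2]; split; [apply (is_linear_scal_l (K := C_AbsRing)) | exact H2].
  - apply Cmult_comm.
  - split; [apply (is_linear_scal_l (K := C_AbsRing)) | exact H2].
Qed.

Lemma Cdiff_mult f g z : Cdiff f z -> Cdiff g z -> Cdiff (fun w => f w * g w)%C z.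
Proof. intros [a Ha] [b Hb]. exists (a * g z + f z * b)%C. apply is_Cderive_mult; assumption. Qed.

Lemma Cdiff_comp (f g : C -> C) z : Cdiff f (g z) -> Cdiff g z -> Cdiff (fun w => f (g w)) z.
Proof.
  intros [a Ha] [b Hb]. exists (b * a)%C.
  apply (is_derive_comp (K := C_AbsRing) (V := C_NormedModule) f g z a b); trivial.
  destruct Hb as [_ H2]; split; [apply (is_linear_scal_l (K := C_AbsRing)) | exact H2].
Qed.

Lemma is_Cderive_inv (z : C) : z <> 0%C -> is_Cderive Cinv z (- / (z * z))%C.
Proof.
  intros Hz. apply is_Cderive_eps. intros eps Heps.
  apply Cmod_gt_0 in Hz as Hz'. set (m := Cmod z) in *.
  (* The first bound keeps |w| >= m / 2. The remainder is (w - z)^2 / (w z^2) with |w z^2| >= m^3 /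
     2, which explains the second. *)
  exists (Rmin (m / 2) (eps * (m ^ 3 / 2))). split.
  { apply Rmin_glb_lt; try lra. apply Rmult_lt_0_compat; trivial. generalize (pow_lt m 3 Hz'); lra. }
  intros w Hw.
  assert (Hw1 : Cmod (w - z) < m / 2) by (eapply Rlt_le_trans; [exact Hw | apply Rmin_l]).
  assert (Hw2 : Cmod (w - z) < eps * (m ^ 3 / 2)) by (eapply Rlt_le_trans; [exact Hw | apply Rmin_r]).
  assert (Hwm : m / 2 <= Cmod w).
  { assert (m <= Cmod w + Cmod (w - z)); [|lra].
    unfold m. replace z with (w + - (w - z))%C at 1 by ring.
    eapply Rle_trans; [apply Cmod_triangle|]. rewrite Cmod_opp. lra. }
  assert (Hw0 : w <> 0%C). { apply Cmod_gt_0. lra. }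
  replace (/ w - / z - (w - z) * - / (z * z))%C with ((w - z) * ((w - z) * / (w * z * z)))%C by (field; auto).
  rewrite !Cmod_mult, Cmod_inv by (repeat apply Cmult_neq_0; trivial).
  rewrite !Cmod_mult. fold m.
  rewrite Rmult_comm. apply Rmult_le_compat_r. apply Cmod_ge_0.
  apply (Rmult_le_reg_r (Cmod w * m * m)). { repeat apply Rmult_lt_0_compat; lra. }
  rewrite Rmult_assoc, Rinv_l, Rmult_1_r. 2: apply Rgt_not_eq; repeat apply Rmult_lt_0_compat; lra.
  apply Rle_trans with (eps * (m ^ 3 / 2)); [lra|].
  apply Rmult_le_compat_l; [lra|]. simpl. assert (0 < m * m) by nra. nra.
Qed.

Lemma Cdiff_inv (f : C -> C) (z : C) : Cdiff f z -> f z <> 0%C -> Cdiff (fun w => / f w)%C z.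
Proof.
  intros Hf Hz. apply (Cdiff_comp Cinv f); trivial. eexists. apply is_Cderive_inv, Hz.
Qed.

Lemma Cdiff_ext (f g : C -> C) z : (forall w, f w = g w) -> Cdiff f z -> Cdiff g z.
Proof. intros H [l Hl]. exists l. apply (is_derive_ext f g); assumption. Qed.

(** * The complex exponential *)

Definition cexp (z : C) : C := (exp (Re z) * cos (Im z), exp (Re z) * sin (Im z)).

Lemma cexp_plus (z w : C) : cexp (z + w)%C = (cexp z * cexp w)%C.
Proof.
  unfold cexp, Cmult, Re, Im; simpl. rewrite exp_plus, cos_plus, sin_plus. apply f_equal2; ring.
Qed.

Lemma Cmod_cexp (z : C) : Cmod (cexp z) = exp (Re z).
Proof.
  unfold cexp, Cmod; simpl.
  replace (_ + _) with (exp (Re z) ^ 2 * (Rsqr (sin (Im z)) + Rsqr (cos (Im z)))) by (unfold Rsqr; simpl; ring).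
  rewrite sin2_cos2, Rmult_1_r. apply sqrt_pow2. left; apply exp_pos.
Qed.

Lemma cpow_pos_cexp (t : R) (s : C) : cpow_pos t s = cexp (ln t * s)%C.
Proof.
  unfold cpow_pos, cexp. simpl. f_equal; f_equal; f_equal; unfold Re, Im; ring.
Qed.

Lemma Rabs_sin_le x : Rabs (sin x) <= Rabs x.
Proof.
  assert (H := bounded_variation sin cos 1 0 x).
  rewrite sin_0, !Rminus_0_r, Rmult_1_l in H. apply H.
  intros t _. split. { auto_derive; trivial; ring. }
  apply Rabs_le. generalize (COS_bound t); lra.
Qed.

(** Mean value inequality on the segment from 0 to x, the derivative being bounded by the previous
    lemma. The constants here and below are not sharp. *)
Lemma Rabs_cos_sub_1_le x : Rabs (cos x - 1) <= x ^ 2.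
Proof.
  replace (x ^ 2) with (Rabs x * Rabs (x - 0)).
  2: { rewrite Rminus_0_r, <- Rabs_mult, Rabs_pos_eq; [ring|]. generalize (pow2_ge_0 x); simpl; lra. }
  rewrite <- cos_0 at 1. apply (bounded_variation cos (fun t => - sin t)).
  intros t Ht. rewrite !Rminus_0_r in Ht. split. { auto_derive; trivial; ring. }
  rewrite Rabs_Ropp. apply Rle_trans with (2 := Ht), Rabs_sin_le.
Qed.

Lemma Rabs_sin_sub_le x : Rabs (sin x - x) <= Rabs x ^ 3.
Proof.
  assert (H := bounded_variation (fun t => sin t - t) (fun t => cos t - 1) (x ^ 2) 0 x).
  cbv beta in H. rewrite sin_0, !Rminus_0_r in H.
  replace (Rabs x ^ 3) with (x ^ 2 * Rabs x) by (rewrite <- pow2_abs; ring). apply H.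
  intros t Ht. rewrite !Rminus_0_r in Ht. split. { auto_derive; trivial; ring. }
  eapply Rle_trans; [apply Rabs_cos_sub_1_le|]. rewrite <- (pow2_abs t), <- (pow2_abs x).
  apply pow_incr. split; [apply Rabs_pos | exact Ht].
Qed.

Lemma exp_sub_1_sub_bound a : Rabs a <= 1 / 2 -> 0 <= exp a - 1 - a <= 2 * a ^ 2.
Proof.
  intros Ha. apply Rabs_le_between in Ha.
  assert (H1 := exp_ineq1_le a). assert (H2 := exp_ineq1_le (- a)).
  assert (H3 : exp a * exp (- a) = 1) by (rewrite <- exp_plus, Rplus_opp_r; apply exp_0).
  assert (H4 := exp_pos a). split; [lra|].
  assert (exp a * (1 - a) <= 1) by nra.
  (* The product is 1 + a^2 (1 - 2 a), and a <= 1/2. Dividing by 1 - a turns exp(-a) >= 1 - a into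
     the upper bound. *)
  assert (H5 : 1 <= (1 + a + 2 * a ^ 2) * (1 - a)) by nra.
  assert (exp a * (1 - a) <= (1 + a + 2 * a ^ 2) * (1 - a)) by lra.
  apply Rmult_le_reg_r in H0; lra.
Qed.

Lemma cexp_taylor (w : C) : Cmod w <= 1 / 2 -> Cmod (cexp w - 1 - w) <= 8 * Cmod w ^ 2.
Proof.
  intros Hw.
  assert (Ha : Rabs (Re w) <= 1 / 2) by (eapply Rle_trans; [apply re_le_Cmod | exact Hw]).
  assert (Hb : Rabs (Im w) <= 1 / 2) by (eapply Rle_trans; [apply Im_le_Cmod | exact Hw]).
  rewrite Cmod2_alt. eapply Rle_trans; [apply Cmod_le_Rabs_sum|].
  destruct w as [a b]; unfold cexp, Re, Im in *; simpl in *.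
  assert (Ea := exp_sub_1_sub_bound a Ha).
  assert (Cb := Rabs_cos_sub_1_le b). assert (Sb := Rabs_sin_sub_le b).
  assert (C1 := COS_bound b). assert (Sb' := Rabs_sin_le b).
  replace (exp a * cos b + - (1) + - a) with ((exp a - 1 - a) * cos b + (1 + a) * (cos b - 1)) by ring.
  replace (exp a * sin b + - 0 + - b) with ((exp a - 1 - a + a) * sin b + (sin b - b)) by ring.
  assert (Hb0 := Rabs_pos b). assert (Ha0 := Rabs_pos a).
  assert (A2 : a ^ 2 = Rabs a ^ 2) by (rewrite pow2_abs; ring).
  assert (B2 : b ^ 2 = Rabs b ^ 2) by (rewrite pow2_abs; ring).
  assert (Rabs ((exp a - 1 - a) * cos b) <= 2 * a ^ 2).
  { rewrite Rabs_mult, (Rabs_pos_eq (exp a - 1 - a)) by lra.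
    assert (Rabs (cos b) <= 1) by (apply Rabs_le; lra). assert (Hc := Rabs_pos (cos b)). nra. }
  assert (Rabs ((1 + a) * (cos b - 1)) <= 2 * b ^ 2).
  { rewrite Rabs_mult. apply Rmult_le_compat; try apply Rabs_pos; trivial.
    eapply Rle_trans; [apply Rabs_triang|]. rewrite Rabs_R1; lra. }
  assert (Rabs ((exp a - 1 - a + a) * sin b) <= 2 * Rabs a * Rabs b).
  { rewrite Rabs_mult. apply Rmult_le_compat; try apply Rabs_pos; trivial.
    eapply Rle_trans; [apply Rabs_triang|]. rewrite (Rabs_pos_eq (exp a - 1 - a)) by lra. nra. }
  assert (Rabs (sin b - b) <= b ^ 2). { rewrite B2. apply Rle_trans with (1 := Sb). nra. }
  eapply Rle_trans; [apply Rplus_le_compat; apply Rabs_triang|].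
  change (a * (a * 1)) with (a ^ 2). change (b * (b * 1)) with (b ^ 2). nra.
Qed.

Lemma is_Cderive_cexp z : is_Cderive cexp z (cexp z).
Proof.
  apply is_Cderive_eps. intros eps Heps.
  assert (Hp := exp_pos (Re z)).
  set (e := eps / (8 * exp (Re z))).
  assert (He : 0 < e) by (apply Rdiv_lt_0_compat; lra).
  exists (Rmin (1 / 2) e). split. { apply Rmin_glb_lt; lra. }
  intros w Hw.
  assert (H1 : Cmod (w - z) <= 1 / 2) by (left; eapply Rlt_le_trans; [exact Hw | apply Rmin_l]).
  assert (H2 : Cmod (w - z) <= e) by (left; eapply Rlt_le_trans; [exact Hw | apply Rmin_r]).
  replace (cexp w - cexp z - (w - z) * cexp z)%C with (cexp z * (cexp (w - z) - 1 - (w - z)))%C.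
  2: { replace (cexp w) with (cexp z * cexp (w - z))%C by (rewrite <- cexp_plus; f_equal; ring). ring. }
  rewrite Cmod_mult, Cmod_cexp.
  apply cexp_taylor in H1. assert (H3 := Cmod_ge_0 (w - z)).
  assert (E : eps = 8 * exp (Re z) * e) by (unfold e; field; lra).
  apply Rle_trans with (exp (Re z) * (8 * Cmod (w - z) ^ 2)). { apply Rmult_le_compat_l; lra. }
  rewrite E.
  assert (Cmod (w - z) * Cmod (w - z) <= e * Cmod (w - z)) by (apply Rmult_le_compat_r; lra). simpl. nra.
Qed.

Lemma Cdiff_cexp f z : Cdiff f z -> Cdiff (fun w => cexp (f w)) z.
Proof.
  intros H. apply (Cdiff_comp cexp f); trivial. eexists; apply is_Cderive_cexp.
Qed.

Lemma exp_le_mono x y : x <= y -> exp x <= exp y.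
Proof. intros [H | ->]; [left; apply exp_increasing; trivial | lra]. Qed.

Lemma sum_SnR (f : nat -> R) n : sum_n f (S n) = sum_n f n + f (S n).
Proof. exact (sum_Sn f n). Qed.

(** * Goursat's theorem on rectangles *)

(** The contour integral along the boundary of [a, b] x [c, d], counterclockwise. *)
Definition rint (f : C -> C) (a b c d : R) : C :=
  (CInt (fun x => f (x, c)) a b - CInt (fun x => f (x, d)) a b
   + Ci * (CInt (fun y => f (b, y)) c d - CInt (fun y => f (a, y)) c d))%C.

Definition on_edges (P : C -> Prop) (a b c d : R) : Prop :=
  (forall x, a <= x <= b -> P (x, c) /\ P (x, d)) /\
  (forall y, c <= y <= d -> P (a, y) /\ P (b, y)).

Definition edge_cont (f : C -> C) (a b c d : R) : Prop :=
  (Ccont_on (fun x => f (x, c)) a b /\ Ccont_on (fun x => f (x, d)) a b) /\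
  (Ccont_on (fun y => f (a, y)) c d /\ Ccont_on (fun y => f (b, y)) c d).

Definition hol_on (f : C -> C) (a b c d : R) : Prop :=
  forall x y, a <= x <= b -> c <= y <= d -> Cdiff f (x, y).

Lemma on_edges_diff_cont f a b c d : on_edges (fun z => Cdiff f z) a b c d -> edge_cont f a b c d.
Proof.
  intros [H1 H2]; split; split; intros t Ht;
  first [ apply Cdiff_h; apply (H1 t Ht) | apply Cdiff_v; apply (H2 t Ht) ].
Qed.

Lemma on_edges_intro (P : C -> Prop) a b c d : a <= b -> c <= d ->
  (forall x y, a <= x <= b -> c <= y <= d -> P (x, y)) -> on_edges P a b c d.
Proof. intros Hab Hcd H; split; intros t Ht; split; apply H; lra. Qed.

Lemma hol_on_edge_cont f a b c d : a <= b -> c <= d -> hol_on f a b c d -> edge_cont f a b c d.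
Proof. intros Hab Hcd H. apply on_edges_diff_cont, on_edges_intro; trivial. Qed.

Lemma rint_ext f g a b c d : a <= b -> c <= d ->
  on_edges (fun z => f z = g z) a b c d -> rint f a b c d = rint g a b c d.
Proof.
  intros Hab Hcd [H1 H2]. unfold rint.
  rewrite (CInt_ext (fun x => f (x, c)) (fun x => g (x, c))), (CInt_ext (fun x => f (x, d)) (fun x => g (x, d))),
    (CInt_ext (fun y => f (a, y)) (fun y => g (a, y))), (CInt_ext (fun y => f (b, y)) (fun y => g (b, y)));
  trivial; intros; first [apply H1 | apply H2]; trivial.
Qed.

Lemma rint_minus f g a b c d : a <= b -> c <= d -> edge_cont f a b c d -> edge_cont g a b c d ->
  rint (fun z => f z - g z)%C a b c d = (rint f a b c d - rint g a b c d)%C.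
Proof.
  intros Hab Hcd [[F1 F2] [F3 F4]] [[G1 G2] [G3 G4]]. unfold rint.
  rewrite !CInt_minus by assumption. ring.
Qed.

Lemma rint_scal (k : C) f a b c d : a <= b -> c <= d -> edge_cont f a b c d ->
  rint (fun z => k * f z)%C a b c d = (k * rint f a b c d)%C.
Proof.
  intros Hab Hcd [[F1 F2] [F3 F4]]. unfold rint.
  rewrite !CInt_scal by assumption. ring.
Qed.

Lemma Cmod_rint_le f a b c d M : a <= b -> c <= d -> edge_cont f a b c d ->
  on_edges (fun z => Cmod (f z) <= M) a b c d ->
  Cmod (rint f a b c d) <= 2 * ((b - a) + (d - c)) * M.
Proof.
  intros Hab Hcd [[F1 F2] [F3 F4]] [H1 H2]. unfold rint.
  assert (B1 : Cmod (CInt (fun x => f (x, c)) a b) <= (b - a) * M)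
    by (apply Cmod_CInt_le_const; trivial; intros; apply H1; trivial).
  assert (B2 : Cmod (CInt (fun x => f (x, d)) a b) <= (b - a) * M)
    by (apply Cmod_CInt_le_const; trivial; intros; apply H1; trivial).
  assert (B3 : Cmod (CInt (fun y => f (a, y)) c d) <= (d - c) * M)
    by (apply Cmod_CInt_le_const; trivial; intros; apply H2; trivial).
  assert (B4 : Cmod (CInt (fun y => f (b, y)) c d) <= (d - c) * M)
    by (apply Cmod_CInt_le_const; trivial; intros; apply H2; trivial).
  eapply Rle_trans; [apply Cmod_triangle|]. rewrite Cmod_mult, Cmod_Ci, Rmult_1_l.
  unfold Cminus.
  eapply Rle_trans; [apply Rplus_le_compat; apply Cmod_triangle|]. rewrite !Cmod_opp. lra.
Qed.

Lemma rint_split_v f a m b c d : a <= m <= b ->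
  Ccont_on (fun x => f (x, c)) a b -> Ccont_on (fun x => f (x, d)) a b ->
  rint f a b c d = (rint f a m c d + rint f m b c d)%C.
Proof.
  intros Hm H1 H2. unfold rint.
  rewrite <- (CInt_Chasles (fun x => f (x, c)) a m b), <- (CInt_Chasles (fun x => f (x, d)) a m b) by trivial.
  ring.
Qed.

Lemma rint_split_h f a b c m d : c <= m <= d ->
  Ccont_on (fun y => f (a, y)) c d -> Ccont_on (fun y => f (b, y)) c d ->
  rint f a b c d = (rint f a b c m + rint f a b m d)%C.
Proof.
  intros Hm H1 H2. unfold rint.
  rewrite <- (CInt_Chasles (fun y => f (a, y)) c m d), <- (CInt_Chasles (fun y => f (b, y)) c m d) by trivial.
  ring.
Qed.

Lemma rint_quarters f a b c d : a <= b -> c <= d -> hol_on f a b c d ->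
  let m := (a + b) / 2 in let n := (c + d) / 2 in
  rint f a b c d = (rint f a m c n + rint f m b c n + rint f a m n d + rint f m b n d)%C.
Proof.
  intros Hab Hcd H m n.
  assert (Hm : a <= m <= b) by (unfold m; lra). assert (Hn : c <= n <= d) by (unfold n; lra).
  rewrite (rint_split_h f a b c n d), (rint_split_v f a m b c n), (rint_split_v f a m b n d); trivial.
  ring.
  all: intros t Ht; first [apply Cdiff_h | apply Cdiff_v]; apply H; lra.
Qed.

Lemma CInt_affine (p q : C) a b :
  CInt (fun t => p + RtoC t * q)%C a b = (RtoC (b - a) * p + RtoC ((b ^ 2 - a ^ 2) / 2) * q)%C.
Proof.
  assert (H : forall (g : R -> R) (u v l : R), (forall t, g t = u + t * v) ->
    l = (b - a) * u + (b ^ 2 - a ^ 2) / 2 * v -> RInt g a b = l).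
  { intros g u v l Hg ->. apply is_RInt_unique.
    apply (is_RInt_ext (fun t => u + t * v)). { intros t _; symmetry; apply Hg. }
    replace ((b - a) * u + (b ^ 2 - a ^ 2) / 2 * v)
      with (minus (u * b + v * b ^ 2 / 2) (u * a + v * a ^ 2 / 2)).
    2: unfold minus, plus, opp; simpl; field.
    apply (is_RInt_derive (V := R_CompleteNormedModule) (fun t => u * t + v * t ^ 2 / 2)).
    - intros t _. auto_derive; trivial. field.
    - intros t _. apply (ex_derive_continuous (K := R_AbsRing) (V := R_NormedModule)). auto_derive; trivial. }
  destruct p as [p1 p2], q as [q1 q2].
  unfold CInt, Cplus, Cmult, RtoC, Re, Im; simpl fst; simpl snd.
  apply f_equal2; [apply (H _ p1 q1) | apply (H _ p2 q2)]; intros; simpl; ring.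
Qed.

(** This is what allows the first-order Taylor polynomial to be subtracted in [goursat]; it is
    verified by explicit integration over the four edges. *)
Lemma rint_affine (p q : C) a b c d : a <= b -> c <= d -> rint (fun z => p + z * q)%C a b c d = 0%C.
Proof.
  intros Hab Hcd. unfold rint.
  rewrite (CInt_ext (fun x => p + (x, c) * q)%C (fun x => (p + Ci * c * q) + x * q)%C)
    by (trivial; intros; unfold Cplus, Cmult, Ci, RtoC; simpl; apply f_equal2; ring).
  rewrite (CInt_ext (fun x => p + (x, d) * q)%C (fun x => (p + Ci * d * q) + x * q)%C)
    by (trivial; intros; unfold Cplus, Cmult, Ci, RtoC; simpl; apply f_equal2; ring).
  rewrite (CInt_ext (fun y => p + (a, y) * q)%C (fun y => (p + a * q) + y * (Ci * q))%C)
    by (trivial; intros; unfold Cplus, Cmult, Ci, RtoC; simpl; apply f_equal2; ring).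
  rewrite (CInt_ext (fun y => p + (b, y) * q)%C (fun y => (p + b * q) + y * (Ci * q))%C)
    by (trivial; intros; unfold Cplus, Cmult, Ci, RtoC; simpl; apply f_equal2; ring).
  rewrite !CInt_affine.
  unfold Cminus, Cplus, Copp, Cmult, Ci, RtoC; simpl; apply f_equal2; field.
Qed.

Section Bisection.

Variables (f : C -> C) (eps a0 b0 c0 d0 : R).
Hypothesis Hab0 : a0 <= b0.
Hypothesis Hcd0 : c0 <= d0.
Hypothesis Hf : hol_on f a0 b0 c0 d0.

(** The threshold is quadratic in the half-perimeter, so each bisection divides it by four, which is
    also the share of the integral that some quarter must keep. *)
Definition bad (a b c d : R) : Prop := eps * ((b - a) + (d - c)) ^ 2 < Cmod (rint f a b c d).

(** The fourth quarter is a default: when the whole rectangle is [bad] and the other three quarters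
    are not, it has to be. *)
Definition bisect (r : R * R * (R * R)) : R * R * (R * R) :=
  let '(a, b, (c, d)) := r in
  let m := (a + b) / 2 in let n := (c + d) / 2 in
  let size := eps * ((m - a) + (n - c)) ^ 2 in
  if Rlt_dec size (Cmod (rint f a m c n)) then (a, m, (c, n)) else
  if Rlt_dec size (Cmod (rint f m b c n)) then (m, b, (c, n)) else
  if Rlt_dec size (Cmod (rint f a m n d)) then (a, m, (n, d)) else (m, b, (n, d)).

Local Arguments bisect : simpl never.

Lemma bisect_spec a b c d : a0 <= a <= b -> b <= b0 -> c0 <= c <= d -> d <= d0 -> bad a b c d ->
  let '(a', b', (c', d')) := bisect (a, b, (c, d)) in
  a <= a' <= b' /\ b' <= b /\ c <= c' <= d' /\ d' <= d /\ bad a' b' c' d' /\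
  b' - a' = (b - a) / 2 /\ d' - c' = (d - c) / 2.
Proof.
  intros Ha Hb Hc Hd Hbad. unfold bisect.
  set (m := (a + b) / 2). set (n := (c + d) / 2).
  assert (Em : m - a = (b - a) / 2) by (unfold m; lra).
  assert (Em' : b - m = (b - a) / 2) by (unfold m; lra).
  assert (En : n - c = (d - c) / 2) by (unfold n; lra).
  assert (En' : d - n = (d - c) / 2) by (unfold n; lra).
  unfold bad in *.
  repeat destruct Rlt_dec; repeat split; rewrite ?Em', ?En', ?Em, ?En; try lra;
  rewrite ?Em, ?En in *; try assumption.
  (* Only the default case is left: three quarters are below the threshold, and the triangle
     inequality puts the fourth above it. *)
  rewrite rint_quarters in Hbad; try lra.
  2: intros x y Hx Hy; apply Hf; lra.
  fold m n in Hbad.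
  set (size := eps * ((b - a) / 2 + (d - c) / 2) ^ 2) in *.
  replace (eps * (b - a + (d - c)) ^ 2) with (4 * size) in Hbad by (unfold size; field).
  assert (T1 := Cmod_triangle (rint f a m c n + rint f m b c n + rint f a m n d) (rint f m b n d)).
  assert (T2 := Cmod_triangle (rint f a m c n + rint f m b c n) (rint f a m n d)).
  assert (T3 := Cmod_triangle (rint f a m c n) (rint f m b c n)).
  lra.
Qed.

Fixpoint bis (n : nat) : R * R * (R * R) :=
  match n with O => (a0, b0, (c0, d0)) | S n => bisect (bis n) end.

Definition bis_left n := fst (fst (bis n)).
Definition bis_right n := snd (fst (bis n)).
Definition bis_bottom n := fst (snd (bis n)).
Definition bis_top n := snd (snd (bis n)).

Hypothesis Hbad : bad a0 b0 c0 d0.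

Lemma bis_spec n :
  (a0 <= bis_left n <= bis_right n /\ bis_right n <= b0) /\ (c0 <= bis_bottom n <= bis_top n /\ bis_top n <= d0) /\
  bad (bis_left n) (bis_right n) (bis_bottom n) (bis_top n) /\
  bis_right n - bis_left n = (b0 - a0) / 2 ^ n /\ bis_top n - bis_bottom n = (d0 - c0) / 2 ^ n.
Proof.
  induction n as [|n IH].
  - unfold bis_left, bis_right, bis_bottom, bis_top; simpl. repeat split; try lra. exact Hbad.
  - unfold bis_left, bis_right, bis_bottom, bis_top in *. simpl bis. destruct (bis n) as [[a b] [c d]]. simpl fst in *; simpl snd in *.
    destruct IH as [IH1 [IH2 [IH3 [IH4 IH5]]]].
    assert (H := bisect_spec a b c d ltac:(lra) ltac:(lra) ltac:(lra) ltac:(lra) IH3).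
    destruct (bisect (a, b, (c, d))) as [[a' b'] [c' d']]. simpl.
    assert (0 < 2 ^ n) by (apply pow_lt; lra).
    repeat split; try lra; try tauto.
    + replace ((b0 - a0) / (2 * 2 ^ n)) with ((b0 - a0) / 2 ^ n / 2) by (field; lra). lra.
    + replace ((d0 - c0) / (2 * 2 ^ n)) with ((d0 - c0) / 2 ^ n / 2) by (field; lra). lra.
Qed.

Lemma bis_mono n k : bis_left n <= bis_left (n + k) /\ bis_right (n + k) <= bis_right n /\ bis_bottom n <= bis_bottom (n + k) /\ bis_top (n + k) <= bis_top n.
Proof.
  induction k as [|k IH].
  - rewrite Nat.add_0_r. lra.
  - rewrite Nat.add_succ_r.
    destruct (bis_spec (n + k)) as [H1 [H2 [H3 _]]].
    unfold bis_left, bis_right, bis_bottom, bis_top in *. simpl bis. destruct (bis (n + k)) as [[a b] [c d]].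
    simpl fst in *; simpl snd in *.
    assert (H := bisect_spec a b c d ltac:(lra) ltac:(lra) ltac:(lra) ltac:(lra) H3).
    destruct (bisect (a, b, (c, d))) as [[a' b'] [c' d']]. simpl. lra.
Qed.

End Bisection.

(** The supremum of the left ends works, because every left end lies below every right end. *)
Lemma nested_point (l r : nat -> R) : (forall n k, l n <= l (n + k)%nat /\ r (n + k)%nat <= r n) ->
  (forall n, l n <= r n) -> exists X, forall n, l n <= X <= r n.
Proof.
  intros Hm Hlr.
  assert (Hx : forall n m, l n <= r m).
  { intros n m. apply Rle_trans with (l (n + m)%nat); [apply Hm|].
    apply Rle_trans with (r (n + m)%nat); [apply Hlr|]. rewrite Nat.add_comm. apply Hm. }
  destruct (completeness (fun x => exists n, x = l n)) as [X [HX1 HX2]].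
  - exists (r 0%nat). intros x [n ->]. apply Hx.
  - exists (l 0%nat). exists 0%nat. reflexivity.
  - exists X. intros n. split.
    + apply HX1. exists n; reflexivity.
    + apply HX2. intros x [m ->]. apply Hx.
Qed.

Lemma div_pow2_lt (x e : R) : 0 < e -> exists n, x / 2 ^ n < e.
Proof.
  intros He.
  destruct (Pow_x_infinity 2 ltac:(rewrite Rabs_pos_eq; lra) ((Rabs x + 1) / e)) as [n Hn].
  specialize (Hn n (le_n n)). exists n.
  assert (H2 : 0 < 2 ^ n) by (apply pow_lt; lra).
  rewrite Rabs_pos_eq in Hn by lra.
  apply (Rmult_lt_reg_r (2 ^ n)); trivial.
  replace (x / 2 ^ n * 2 ^ n) with x by (field; lra).
  assert (H3 : (Rabs x + 1) / e * e = Rabs x + 1) by (field; lra).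
  assert (H4 := Rle_abs x). nra.
Qed.

Theorem goursat f a b c d : a <= b -> c <= d -> hol_on f a b c d -> rint f a b c d = 0%C.
Proof.
  intros Hab Hcd Hf. apply Cmod_eq_0.
  apply Rle_antisym; [|apply Cmod_ge_0].
  apply le_epsilon. intros e He. rewrite Rplus_0_l.
  (* The added 1 keeps the divisor positive for a degenerate rectangle. *)
  set (eps := e / (((b - a) + (d - c)) ^ 2 + 1)).
  assert (Hsq := pow2_ge_0 ((b - a) + (d - c))).
  assert (Heps : 0 < eps) by (apply Rdiv_lt_0_compat; lra).
  apply Rle_trans with (eps * ((b - a) + (d - c)) ^ 2).
  2: { assert (eps * (((b - a) + (d - c)) ^ 2 + 1) = e) by (unfold eps; field; lra). lra. }
  apply Rnot_lt_le. intros Hbad. change (bad f eps a b c d) in Hbad.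
  assert (S := bis_spec f eps a b c d Hab Hcd Hf Hbad).
  assert (M := bis_mono f eps a b c d Hab Hcd Hf Hbad).
  set (l := bis_left f eps a b c d) in *. set (r := bis_right f eps a b c d) in *.
  set (u := bis_bottom f eps a b c d) in *. set (t := bis_top f eps a b c d) in *.
  destruct (nested_point l r) as [X HX]. { intros n k; specialize (M n k); lra. } { intros n; specialize (S n); lra. }
  destruct (nested_point u t) as [Y HY]. { intros n k; specialize (M n k); lra. } { intros n; specialize (S n); lra. }
  destruct (Hf X Y) as [D HD].
  { specialize (HX O); specialize (S O); lra. } { specialize (HY O); specialize (S O); lra. }
  assert (HD' := HD). rewrite is_Cderive_eps in HD.
  (* With half-perimeter L, a remainder at most (eps / 2) L over a boundary of length 2 L gives eps
     L^2, exactly the threshold of [bad]. *)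
  destruct (HD (eps / 2)) as [del [Hdel HD2]]; [lra|].
  destruct (div_pow2_lt ((b - a) + (d - c)) del Hdel) as [n Hn].
  specialize (S n). specialize (HX n). specialize (HY n).
  destruct S as [[S1 S2] [[S3 S4] [S5 [S6 S7]]]].
  unfold bad in S5.
  set (L := (r n - l n) + (t n - u n)) in *.
  assert (HL : L < del).
  { unfold L. rewrite S6, S7. unfold Rdiv in *. rewrite <- Rmult_plus_distr_r. exact Hn. }
  set (z := (X, Y) : C) in *.
  (* The Taylor remainder of f at the limit point has the same boundary integral as f. *)
  set (g := fun w => (f w - (f z - z * D + w * D))%C).
  assert (Hg : hol_on g (l n) (r n) (u n) (t n)).
  { intros x y Hx Hy. apply Cdiff_minus. apply Hf; lra.
    apply Cdiff_plus. apply Cdiff_const. apply Cdiff_mult. apply Cdiff_id. apply Cdiff_const. }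
  assert (Haff : hol_on (fun w => (f z - z * D) + w * D)%C (l n) (r n) (u n) (t n)).
  { intros x y Hx Hy.
    apply Cdiff_plus. apply Cdiff_const. apply Cdiff_mult. apply Cdiff_id. apply Cdiff_const. }
  assert (Hn1 : l n <= r n) by lra. assert (Hn2 : u n <= t n) by lra.
  assert (E : rint f (l n) (r n) (u n) (t n) = rint g (l n) (r n) (u n) (t n)).
  { unfold g. rewrite rint_minus; trivial.
    - rewrite rint_affine by trivial. ring.
    - apply hol_on_edge_cont; trivial. intros x y Hx Hy; apply Hf; lra.
    - apply hol_on_edge_cont; trivial. }
  rewrite E in S5.
  assert (B : Cmod (rint g (l n) (r n) (u n) (t n)) <= 2 * L * (eps / 2 * L)).
  { apply Cmod_rint_le; trivial. apply hol_on_edge_cont; trivial.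
    apply on_edges_intro; trivial. intros x y Hx Hy.
    assert (Hw : Cmod ((x, y) - z) <= L).
    { eapply Rle_trans; [apply Cmod_le_Rabs_sum|]. unfold L, z, Cminus, Cplus, Copp, Re, Im; simpl.
      apply Rplus_le_compat; apply Rabs_le; lra. }
    unfold g. replace (f (x, y) - (f z - z * D + (x, y) * D))%C with (f (x, y) - f z - ((x, y) - z) * D)%C by ring.
    eapply Rle_trans; [apply HD2; lra|]. apply Rmult_le_compat_l; lra. }
  assert (2 * L * (eps / 2 * L) = eps * L ^ 2) by field. lra.
Qed.

(** Four cuts leave a square of half-side e around p, and [goursat] kills the other four pieces. The
    square has perimeter 8 e, so boundedness of f near p makes its contribution arbitrarily
    small. *)
Lemma goursat_punctured f (p : C) a b c d :
  a < fst p < b -> c < snd p < d ->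
  (forall x y, a <= x <= b -> c <= y <= d -> (x, y) <> p -> Cdiff f (x, y)) ->
  (exists del M, 0 < del /\ forall w, w <> p -> Cmod (w - p) < del -> Cmod (f w) <= M) ->
  rint f a b c d = 0%C.
Proof.
  intros Ha Hc Hf [del [M [Hdel HM]]].
  destruct p as [p1 p2]; simpl in Ha, Hc.
  set (r := Rmin (Rmin (p1 - a) (b - p1)) (Rmin (p2 - c) (d - p2))).
  assert (Hr1 : r <= p1 - a) by (eapply Rle_trans; apply Rmin_l).
  assert (Hr2 : r <= b - p1) by (eapply Rle_trans; [apply Rmin_l | apply Rmin_r]).
  assert (Hr3 : r <= p2 - c) by (eapply Rle_trans; [apply Rmin_r | apply Rmin_l]).
  assert (Hr4 : r <= d - p2) by (eapply Rle_trans; [apply Rmin_r | apply Rmin_r]).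
  assert (Hr0 : 0 < r) by (repeat apply Rmin_glb_lt; lra).
  assert (Hsq : forall e, 0 < e <= r ->
    rint f a b c d = rint f (p1 - e) (p1 + e) (p2 - e) (p2 + e)).
  { intros e He.
    assert (Hd : forall x y, a <= x <= b -> c <= y <= d -> x <> p1 \/ y <> p2 -> Cdiff f (x, y)).
    { intros x y Hx Hy Hxy. apply Hf; trivial. intros [=]. tauto. }
    rewrite (rint_split_v f a (p1 - e) b c d); try lra.
    2, 3: intros t Ht; apply Cdiff_h, Hd; lra.
    rewrite (rint_split_v f (p1 - e) (p1 + e) b c d); try lra.
    2, 3: intros t Ht; apply Cdiff_h, Hd; lra.
    rewrite (rint_split_h f (p1 - e) (p1 + e) c (p2 - e) d); try lra.
    2, 3: intros t Ht; apply Cdiff_v, Hd; lra.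
    rewrite (rint_split_h f (p1 - e) (p1 + e) (p2 - e) (p2 + e) d); try lra.
    2, 3: intros t Ht; apply Cdiff_v, Hd; lra.
    rewrite (goursat f a (p1 - e) c d), (goursat f (p1 + e) b c d),
      (goursat f (p1 - e) (p1 + e) c (p2 - e)), (goursat f (p1 - e) (p1 + e) (p2 + e) d); try lra.
    ring.
    all: intros x y Hx Hy; apply Hd; lra. }
  apply Cmod_eq_0. apply Rle_antisym; [|apply Cmod_ge_0].
  apply le_epsilon. intros e0 He0. rewrite Rplus_0_l.
  set (e := Rmin r (Rmin (del / 3) (e0 / (8 * (Rabs M + 1))))).
  assert (HM1 := Rabs_pos M).
  assert (He : 0 < e).
  { repeat apply Rmin_glb_lt; try lra. apply Rdiv_lt_0_compat; lra. }
  assert (He1 : e <= r) by apply Rmin_l.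
  assert (He2 : e <= del / 3) by (eapply Rle_trans; [apply Rmin_r | apply Rmin_l]).
  assert (He3 : e <= e0 / (8 * (Rabs M + 1))) by (eapply Rle_trans; [apply Rmin_r | apply Rmin_r]).
  rewrite (Hsq e) by lra.
  eapply Rle_trans; [apply Cmod_rint_le with (M := Rabs M); try lra|].
  - apply on_edges_diff_cont. split; intros t Ht; split; apply Hf; try lra; intros [=]; lra.
  - assert (HB : forall x y, p1 - e <= x <= p1 + e -> p2 - e <= y <= p2 + e -> x <> p1 \/ y <> p2 ->
        Cmod (f (x, y)) <= Rabs M).
    { intros x y Hx Hy Hxy. apply Rle_trans with (2 := Rle_abs M). apply HM.
      - intros [=]; tauto.
      - eapply Rle_lt_trans; [apply Cmod_le_Rabs_sum|]. unfold Cminus, Cplus, Copp, Re, Im; simpl.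
        assert (Rabs (x + - p1) <= e) by (apply Rabs_le; lra).
        assert (Rabs (y + - p2) <= e) by (apply Rabs_le; lra). lra. }
    split; intros t Ht; split; apply HB; lra.
  - assert (E : e0 / (8 * (Rabs M + 1)) * (8 * (Rabs M + 1)) = e0) by (field; lra).
    apply Rmult_le_compat_r with (r := 8 * (Rabs M + 1)) in He3; [|lra]. nra.
Qed.

(** * Cauchy's formula and propagation of smallness *)

Lemma Cdiff_inv_sub (p w : C) : w <> p -> Cdiff (fun z => / (z - p))%C w.
Proof.
  intros H. apply Cdiff_inv.
  - apply Cdiff_minus; [apply Cdiff_id | apply Cdiff_const].
  - intros E. apply H. replace w with ((w - p) + p)%C by ring. rewrite E. ring.
Qed.

(** Along each oriented edge, dz / (z - p) has positive imaginary part, since the argument seen from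
    p increases; the four contributions are positive separately. *)
Lemma Im_rint_inv_sub_pos (p : C) a b c d : a < fst p < b -> c < snd p < d ->
  0 < Im (rint (fun z => / (z - p))%C a b c d).
Proof.
  destruct p as [p1 p2]; simpl; intros Ha Hc.
  assert (ER : forall x y, Re (/ ((x, y) - (p1, p2)))%C = (x - p1) / ((x - p1) ^ 2 + (y - p2) ^ 2)) by reflexivity.
  assert (EI : forall x y, Im (/ ((x, y) - (p1, p2)))%C = - (y - p2) / ((x - p1) ^ 2 + (y - p2) ^ 2)) by reflexivity.
  assert (Hq : forall u v, v <> 0 -> 0 < u ^ 2 + v ^ 2).
  { intros u v Hv. assert (0 < v ^ 2) by (apply pow2_gt_0; trivial). generalize (pow2_ge_0 u); lra. }
  assert (Hq' : forall u v, u <> 0 -> 0 < u ^ 2 + v ^ 2).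
  { intros u v Hv. assert (0 < u ^ 2) by (apply pow2_gt_0; trivial). generalize (pow2_ge_0 v); lra. }
  assert (I1 : 0 < RInt (fun t => Im (/ ((t, c) - (p1, p2)))%C) a b).
  { apply RInt_gt_0; [lra| |].
    - intros x Hx. rewrite EI. apply Rdiv_lt_0_compat; [lra | apply Hq; lra].
    - intros x Hx. apply (Cdiff_h (fun z => / (z - (p1, p2)))%C). apply Cdiff_inv_sub. intros [=]; lra. }
  assert (I2 : 0 < RInt (fun t => - Im (/ ((t, d) - (p1, p2)))%C) a b).
  { apply RInt_gt_0; [lra| |].
    - intros x Hx. rewrite EI.
      replace (- (- (d - p2) / ((x - p1) ^ 2 + (d - p2) ^ 2))) with ((d - p2) / ((x - p1) ^ 2 + (d - p2) ^ 2))
        by (field; apply Rgt_not_eq, Hq; lra).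
      apply Rdiv_lt_0_compat; [lra | apply Hq; lra].
    - intros x Hx. apply (continuous_opp (V := R_NormedModule)).
      apply (Cdiff_h (fun z => / (z - (p1, p2)))%C). apply Cdiff_inv_sub. intros [=]; lra. }
  assert (I3 : 0 < RInt (fun t => Re (/ ((b, t) - (p1, p2)))%C) c d).
  { apply RInt_gt_0; [lra| |].
    - intros x Hx. rewrite ER. apply Rdiv_lt_0_compat; [lra | apply Hq'; lra].
    - intros x Hx. apply (Cdiff_v (fun z => / (z - (p1, p2)))%C). apply Cdiff_inv_sub. intros [=]; lra. }
  assert (I4 : 0 < RInt (fun t => - Re (/ ((a, t) - (p1, p2)))%C) c d).
  { apply RInt_gt_0; [lra| |].
    - intros x Hx. rewrite ER.
      replace (- ((a - p1) / ((a - p1) ^ 2 + (x - p2) ^ 2))) with ((p1 - a) / ((a - p1) ^ 2 + (x - p2) ^ 2))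
        by (field; apply Rgt_not_eq, Hq'; lra).
      apply Rdiv_lt_0_compat; [lra | apply Hq'; lra].
    - intros x Hx. apply (continuous_opp (V := R_NormedModule)).
      apply (Cdiff_v (fun z => / (z - (p1, p2)))%C). apply Cdiff_inv_sub. intros [=]; lra. }
  rewrite (RInt_opp (V := R_CompleteNormedModule)) in I2.
  2: { apply (ex_RInt_continuous (V := R_CompleteNormedModule)). rewrite Rmin_left, Rmax_right by lra. intros x Hx.
     apply (Cdiff_h (fun z => / (z - (p1, p2)))%C). apply Cdiff_inv_sub. intros [=]; lra. }
  rewrite (RInt_opp (V := R_CompleteNormedModule)) in I4.
  2: { apply (ex_RInt_continuous (V := R_CompleteNormedModule)). rewrite Rmin_left, Rmax_right by lra. intros x Hx.
     apply (Cdiff_v (fun z => / (z - (p1, p2)))%C). apply Cdiff_inv_sub. intros [=]; lra. }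
  unfold opp in I2, I4; simpl in I2, I4.
  clear ER EI. unfold rint, CInt, Cminus, Cplus, Copp, Cmult, Ci, Im, Re in *; simpl in *. lra.
Qed.

(* Cauchy's integral formula; [Im_rint_inv_sub_pos] replaces the exact value 2 pi i of the winding integral. *)
Theorem rect_bound (p : C) a b c d : a < fst p < b -> c < snd p < d ->
  exists K, 0 <= K /\ forall f, hol_on f a b c d -> forall M,
    on_edges (fun z => Cmod (f z) <= M) a b c d -> Cmod (f p) <= K * M.
Proof.
  intros Ha Hc.
  set (W := rint (fun z => / (z - p))%C a b c d).
  assert (HW : 0 < Cmod W).
  { apply Rlt_le_trans with (Im W). apply Im_rint_inv_sub_pos; trivial.
    eapply Rle_trans; [apply Rle_abs | apply Im_le_Cmod]. }
  destruct p as [p1 p2]; simpl in Ha, Hc. set (p := (p1, p2)) in *.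
  set (r := Rmin (Rmin (p1 - a) (b - p1)) (Rmin (p2 - c) (d - p2))).
  assert (Hr1 : r <= p1 - a) by (eapply Rle_trans; apply Rmin_l).
  assert (Hr2 : r <= b - p1) by (eapply Rle_trans; [apply Rmin_l | apply Rmin_r]).
  assert (Hr3 : r <= p2 - c) by (eapply Rle_trans; [apply Rmin_r | apply Rmin_l]).
  assert (Hr4 : r <= d - p2) by (eapply Rle_trans; [apply Rmin_r | apply Rmin_r]).
  assert (Hr0 : 0 < r) by (repeat apply Rmin_glb_lt; lra).
  set (L := 2 * ((b - a) + (d - c))).
  assert (HL : 0 < L) by (unfold L; lra).
  (* [L] is the perimeter, [r] a lower bound for the distance from p to the boundary, and [W] the
     winding integral by which Cauchy's formula divides. *)
  exists (L / r / Cmod W). split.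
  { left. repeat apply Rdiv_lt_0_compat; trivial. }
  intros f Hf M HM.
  assert (Hne : on_edges (fun z => z <> p) a b c d).
  { split; intros t Ht; split; intros [=]; lra. }
  assert (Hdist : on_edges (fun z => r <= Cmod (z - p)) a b c d).
  { split; intros t Ht; split.
    1, 2: eapply Rle_trans; [|apply Im_le_Cmod].
    3, 4: eapply Rle_trans; [|apply re_le_Cmod].
    all: unfold Cminus, Cplus, Copp, Re, Im; simpl.
    - rewrite Rabs_left; lra.
    - rewrite Rabs_pos_eq; lra.
    - rewrite Rabs_left; lra.
    - rewrite Rabs_pos_eq; lra. }
  assert (Hhol : forall g, hol_on g a b c d -> edge_cont g a b c d).
  { intros g Hg. apply hol_on_edge_cont; trivial; lra. }
  assert (Hinv : edge_cont (fun z => / (z - p))%C a b c d).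
  { apply on_edges_diff_cont. destruct Hne as [N1 N2].
    split; intros t Ht; split; apply Cdiff_inv_sub; first [apply N1 | apply N2]; trivial. }
  assert (Hfinv : edge_cont (fun z => f z * / (z - p))%C a b c d).
  { destruct (Hhol f Hf) as [[F1 F2] [F3 F4]], Hinv as [[G1 G2] [G3 G4]].
    repeat split; intros; intros t Ht; apply Ccont_mult; auto. }
  (* The difference quotient stays bounded near p because f is differentiable there, so the point p
     can be ignored. *)
  assert (H0 : rint (fun z => (f z - f p) * / (z - p))%C a b c d = 0%C).
  { apply goursat_punctured with p; trivial.
    - intros x y Hx Hy Hxy. apply Cdiff_mult.
      + apply Cdiff_minus; [apply Hf; trivial | apply Cdiff_const].
      + apply Cdiff_inv_sub; trivial.
    - destruct (Hf p1 p2 ltac:(lra) ltac:(lra)) as [l Hl]. fold p in Hl.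
      rewrite is_Cderive_eps in Hl. destruct (Hl 1 Rlt_0_1) as [del [Hdel Hl']].
      exists del, (1 + Cmod l). split; trivial. intros w Hw Hwd. apply Hl' in Hwd.
      assert (Hwp : (w - p)%C <> 0%C).
      { intros E. apply Hw. replace w with ((w - p) + p)%C by ring. rewrite E. ring. }
      assert (Hm : 0 < Cmod (w - p)) by (apply Cmod_gt_0; trivial).
      rewrite Cmod_mult, Cmod_inv by trivial.
      apply (Rmult_le_reg_r (Cmod (w - p))); trivial.
      rewrite Rmult_assoc, Rinv_l, Rmult_1_r by lra.
      replace (f w - f p)%C with ((f w - f p - (w - p) * l) + (w - p) * l)%C by ring.
      eapply Rle_trans; [apply Cmod_triangle|]. rewrite (Cmod_mult (w - p)). lra. }
  assert (E : (f p * W)%C = rint (fun z => f z * / (z - p))%C a b c d).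
  { rewrite (rint_ext _ (fun z => f z * / (z - p) - f p * / (z - p))%C) in H0; try lra.
    2: { split; intros; split; ring. }
    rewrite rint_minus in H0; trivial; try lra.
    2: { destruct Hinv as [[G1 G2] [G3 G4]].
      split; split; intros t Ht; apply Ccont_mult; auto using Ccont_const. }
    rewrite rint_scal in H0; trivial; try lra. fold W in H0.
    replace (f p * W)%C with (f p * W + 0)%C by ring. rewrite <- H0. ring. }
  assert (HB : Cmod (rint (fun z => f z * / (z - p))%C a b c d) <= L * (M / r)).
  { unfold L. apply Cmod_rint_le; trivial; try lra.
    assert (HB : forall z, Cmod (f z) <= M -> z <> p -> r <= Cmod (z - p) -> Cmod (f z * / (z - p)) <= M / r).
    { intros z Hz Hzp Hzr. rewrite Cmod_mult, Cmod_inv.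
      2: { intros Ez. rewrite Ez, Cmod_0 in Hzr. lra. }
      apply Rmult_le_compat; trivial. apply Cmod_ge_0. left; apply Rinv_0_lt_compat; lra.
      apply Rinv_le_contravar; trivial. }
    destruct HM as [M1 M2], Hne as [N1 N2], Hdist as [D1 D2].
    split; intros t Ht; split; apply HB; first [apply M1|apply M2|apply N1|apply N2|apply D1|apply D2]; trivial. }
  rewrite <- E, Cmod_mult in HB.
  replace (L / r / Cmod W * M) with (L * (M / r) / Cmod W) by (field; lra).
  apply (Rmult_le_reg_r (Cmod W)); trivial.
  replace (L * (M / r) / Cmod W * Cmod W) with (L * (M / r)) by (field; lra). exact HB.
Qed.

(* The weight exp(-i N cosh(z - z0)), z0 the lower left corner, has modulus exp(N sinh(x - a) sin(y - c)):
   it is 1 on three sides of the rectangle and large inside. *)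
Lemma seq_vanishing (H : nat -> C -> C) (p : C) a b c : a < fst p < b -> c < snd p < c + PI ->
  (forall n, hol_on (H n) a b c (c + PI)) ->
  (exists M, forall n, on_edges (fun z => Cmod (H n z) <= M) a b c (c + PI)) ->
  (forall eps, 0 < eps -> exists n0, forall n y, (n0 <= n)%nat -> c <= y <= c + PI -> Cmod (H n (b, y)) <= eps) ->
  forall eps, 0 < eps -> exists n0, forall n, (n0 <= n)%nat -> Cmod (H n p) <= eps.
Proof.
  intros Ha Hc Hhol [M HM] Hlim eps Heps.
  destruct (rect_bound p a b c (c + PI) Ha Hc) as [K [HK HB]].
  destruct p as [p1 p2]. simpl in Ha, Hc.
  set (q := fun z : C => ((cexp (z - (a, c)) + cexp (- (z - (a, c)))) * (- Ci / 2))%C).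
  assert (Hq : forall x y, Re (q (x, y)) = sinh (x - a) * sin (y - c)).
  { intros x y. unfold q, cexp, Re, Im, sinh.
    unfold Cminus, Cdiv, Cinv, Cplus, Copp, Cmult, Ci, RtoC; simpl.
    rewrite <- (Ropp_involutive (y + - c)) at 1.
    rewrite !Ropp_involutive, cos_neg, sin_neg. unfold Rminus. field. }
  assert (Hqd : forall z, Cdiff q z).
  { intros z. unfold q. apply Cdiff_mult; [|apply Cdiff_const].
    apply Cdiff_plus; apply Cdiff_cexp; [|apply Cdiff_opp]; apply Cdiff_minus;
      first [apply Cdiff_id | apply Cdiff_const]. }
  assert (Hs : forall u, 0 <= u -> 0 <= sinh u).
  { intros u Hu. destruct Hu as [Hu | <-]; [|rewrite sinh_0; lra].
    left. rewrite <- sinh_0. apply sinh_lt; trivial. }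
  assert (Hh : 0 < sinh (p1 - a) * sin (p2 - c)).
  { apply Rmult_lt_0_compat. rewrite <- sinh_0. apply sinh_lt; lra. apply sin_gt_0; lra. }
  set (h := sinh (p1 - a) * sin (p2 - c)) in *.
  set (A := sinh (b - a)).
  assert (HM0 : 0 <= M).
  { destruct (HM 0%nat) as [H1 _]. eapply Rle_trans; [apply Cmod_ge_0|]. apply (H1 a); lra. }
  (* choose N with K (M + 1) exp (- N h) <= eps *)
  destruct (INR_unbounded (K * (M + 1) / (eps * h))) as [N HN].
  (* [n0] is chosen after [N]: on the right edge the weight may reach exp(N A), and H must
     compensate for it. The bound there becomes 1, whence M + 1 for all four edges. *)
  destruct (Hlim (exp (- (INR N * A)))) as [n0 Hn0]; [apply exp_pos|].
  exists n0. intros n Hn.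
  assert (B := HB (fun z => H n z * cexp (INR N * q z))%C).
  assert (B1 : hol_on (fun z => H n z * cexp (INR N * q z))%C a b c (c + PI)).
  { intros x y Hx Hy. apply Cdiff_mult. apply Hhol; trivial. apply Cdiff_cexp.
    apply Cdiff_mult; [apply Cdiff_const | apply Hqd]. }
  specialize (B B1 (M + 1)).
  assert (Hm : forall x y, Cmod (cexp (INR N * q (x, y))) = exp (INR N * (sinh (x - a) * sin (y - c)))).
  { intros x y. rewrite Cmod_cexp. f_equal. rewrite <- Hq. unfold Re, Cmult, RtoC; simpl. ring. }
  assert (HN0 := pos_INR N).
  destruct (HM n) as [M1 M2].
  assert (B2 : on_edges (fun z => Cmod (H n z * cexp (INR N * q z)) <= M + 1) a b c (c + PI)).
  { split; intros t Ht; split; rewrite Cmod_mult, Hm.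
    - replace (c - c) with 0 by ring. rewrite sin_0, !Rmult_0_r, exp_0. destruct (M1 t Ht); lra.
    - replace (c + PI - c) with PI by ring. rewrite sin_PI, !Rmult_0_r, exp_0. destruct (M1 t Ht); lra.
    - replace (a - a) with 0 by ring. rewrite sinh_0, !Rmult_0_l, Rmult_0_r, exp_0. destruct (M2 t Ht); lra.
    - fold A. assert (HA : 0 <= A) by (apply Hs; lra).
      apply Rle_trans with (exp (- (INR N * A)) * exp (INR N * A)).
      + apply Rmult_le_compat; try apply Cmod_ge_0; try (left; apply exp_pos).
        * apply Hn0; trivial.
        * apply exp_le_mono. apply Rmult_le_compat_l; trivial.
          assert (S := SIN_bound (t - c)). nra.
      + rewrite <- exp_plus, Rplus_opp_l, exp_0. lra. }
  specialize (B B2). cbv beta in B. rewrite Cmod_mult, Hm in B. fold h in B.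
  (* exp(N h) >= 1 + N h suffices, so a linear choice of N is enough. *)
  assert (Hx := exp_ineq1_le (INR N * h)).
  assert (HN1 : K * (M + 1) < INR N * (eps * h)).
  { apply Rmult_lt_compat_r with (r := eps * h) in HN; [|nra].
    replace (K * (M + 1) / (eps * h) * (eps * h)) with (K * (M + 1)) in HN by (field; lra). lra. }
  assert (Hp := Cmod_ge_0 (H n (p1, p2))).
  apply Rnot_lt_le. intros Hlt.
  assert (INR N * h * eps <= INR N * h * Cmod (H n (p1, p2))) by (apply Rmult_le_compat_l; nra).
  nra.
Qed.

(** * Partial fraction expansion of kappa *)

Lemma increment_ge_0 (f df : R -> R) (t : R) : 0 <= t ->
  (forall x, is_derive f x (df x)) -> (forall x, 0 <= x <= t -> 0 <= df x) -> f 0 <= f t.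
Proof.
  intros Ht Hd Hp.
  destruct (MVT_gen f 0 t df) as [c [Hc E]].
  - intros; apply Hd.
  - intros x _. apply derivable_continuous_pt. exists (df x). apply is_derive_Reals, Hd.
  - rewrite Rmin_left, Rmax_right in Hc by lra.
    assert (0 <= df c * (t - 0)) by (apply Rmult_le_pos; [apply Hp; trivial | lra]). lra.
Qed.

(** The seed of the next bounds: each of the upper bounds for sinh and cosh on [0, 1] integrates an
    earlier one through [increment_ge_0]. *)
Lemma cosh_le_2 x : 0 <= x <= 1 -> cosh x <= 2.
Proof.
  intros Hx. unfold cosh.
  assert (exp x <= exp 1) by (apply exp_le_mono; lra). assert (H3 := exp_le_3).
  assert (exp (- x) <= exp 0) by (apply exp_le_mono; lra). rewrite exp_0 in *. lra.
Qed.

Lemma is_derive_sinh x : is_derive sinh x (cosh x).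
Proof. apply is_derive_Reals, derivable_pt_lim_sinh. Qed.

Lemma is_derive_cosh x : is_derive cosh x (sinh x).
Proof. apply is_derive_Reals, derivable_pt_lim_cosh. Qed.

Lemma sinh_ge_0 x : 0 <= x -> 0 <= sinh x.
Proof.
  intros [H | <-]; [|rewrite sinh_0; lra]. left. rewrite <- sinh_0. apply sinh_lt; trivial.
Qed.

Lemma cosh_ge_1 x : 0 <= x -> 1 <= cosh x.
Proof.
  intros H. rewrite <- cosh_0.
  apply (increment_ge_0 cosh sinh); trivial. apply is_derive_cosh.
  intros y Hy; apply sinh_ge_0; lra.
Qed.

Lemma sinh_le x : 0 <= x <= 1 -> sinh x <= 2 * x.
Proof.
  intros Hx.
  assert (2 * 0 - sinh 0 <= 2 * x - sinh x); [|rewrite sinh_0 in *; lra].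
  apply (increment_ge_0 (fun y => 2 * y - sinh y) (fun y => 2 - cosh y)); try lra.
  - intros y. apply (is_derive_minus (fun y => 2 * y) sinh y 2 (cosh y)); [auto_derive; trivial; ring | apply is_derive_sinh].
  - intros y Hy. assert (H := cosh_le_2 y). lra.
Qed.

Lemma cosh_le x : 0 <= x <= 1 -> cosh x <= 1 + x ^ 2.
Proof.
  intros Hx.
  assert (0 ^ 2 - cosh 0 <= x ^ 2 - cosh x); [|rewrite cosh_0 in *; lra].
  apply (increment_ge_0 (fun y => y ^ 2 - cosh y) (fun y => 2 * y - sinh y)); try lra.
  - intros y. apply (is_derive_minus (fun y => y ^ 2) cosh y (2 * y) (sinh y)); [auto_derive; trivial; ring | apply is_derive_cosh].
  - intros y Hy. assert (H := sinh_le y). lra.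
Qed.

Lemma sinh_sub_bound x : 0 <= x <= 1 -> 0 <= sinh x - x <= x ^ 3.
Proof.
  intros Hx. split.
  - assert (sinh 0 - 0 <= sinh x - x); [|rewrite sinh_0 in *; lra].
    apply (increment_ge_0 (fun y => sinh y - y) (fun y => cosh y - 1)); try lra.
    + intros y. apply (is_derive_minus sinh (fun y => y) y (cosh y) 1); [apply is_derive_sinh | auto_derive; trivial; ring].
    + intros y Hy. assert (H := cosh_ge_1 y). lra.
  - assert (0 + 0 ^ 3 - sinh 0 <= x + x ^ 3 - sinh x); [|rewrite sinh_0 in *; lra].
    apply (increment_ge_0 (fun y => y + y ^ 3 - sinh y) (fun y => 1 + 3 * y ^ 2 - cosh y)); try lra.
    + intros y. apply (is_derive_minus (fun y => y + y ^ 3) sinh y (1 + 3 * y ^ 2) (cosh y)); [auto_derive; trivial; ring | apply is_derive_sinh].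
    + intros y Hy. assert (H := cosh_le y). assert (0 <= y ^ 2) by apply pow2_ge_0. lra.
Qed.

Lemma cosh_sub_bound x : 0 <= x <= 1 -> 0 <= cosh x - 1 - x ^ 2 / 2 <= x ^ 4.
Proof.
  intros Hx. split.
  - assert (cosh 0 - 0 ^ 2 / 2 <= cosh x - x ^ 2 / 2); [|rewrite cosh_0 in *; lra].
    apply (increment_ge_0 (fun y => cosh y - y ^ 2 / 2) (fun y => sinh y - y)); try lra.
    + intros y. apply (is_derive_minus cosh (fun y => y ^ 2 / 2) y (sinh y) y); [apply is_derive_cosh | auto_derive; trivial; field].
    + intros y Hy. assert (H := sinh_sub_bound y). lra.
  - assert (0 ^ 2 / 2 + 0 ^ 4 - cosh 0 <= x ^ 2 / 2 + x ^ 4 - cosh x); [|rewrite cosh_0 in *; lra].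
    apply (increment_ge_0 (fun y => y ^ 2 / 2 + y ^ 4 - cosh y) (fun y => y + 4 * y ^ 3 - sinh y)); try lra.
    + intros y. apply (is_derive_minus (fun y => y ^ 2 / 2 + y ^ 4) cosh y (y + 4 * y ^ 3) (sinh y)); [auto_derive; trivial; field | apply is_derive_cosh].
    + intros y Hy. assert (H := sinh_sub_bound y). assert (0 <= y ^ 3) by (apply pow_le; lra). lra.
Qed.

Lemma cos_sub_bound x : 0 <= x -> 0 <= cos x - 1 + x ^ 2 / 2 <= x ^ 4.
Proof.
  intros Hx.
  assert (S1 : forall y, 0 <= y -> sin y <= y).
  { intros y Hy. assert (H := Rabs_sin_le y). rewrite (Rabs_pos_eq y) in H by trivial.
    eapply Rle_trans; [apply Rle_abs | exact H]. }
  assert (S2 : forall y, 0 <= y -> y - y ^ 3 <= sin y).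
  { intros y Hy. assert (H := Rabs_sin_sub_le y). rewrite (Rabs_pos_eq y) in H by trivial.
    apply Rabs_le_between in H. lra. }
  split.
  - assert (cos 0 + 0 ^ 2 / 2 <= cos x + x ^ 2 / 2); [|rewrite cos_0 in *; lra].
    apply (increment_ge_0 (fun y => cos y + y ^ 2 / 2) (fun y => y - sin y)); try lra.
    + intros y. auto_derive; trivial. field.
    + intros y Hy. specialize (S1 y). lra.
  - assert (0 ^ 4 - cos 0 - 0 ^ 2 / 2 <= x ^ 4 - cos x - x ^ 2 / 2); [|rewrite cos_0 in *; lra].
    apply (increment_ge_0 (fun y => y ^ 4 - cos y - y ^ 2 / 2) (fun y => 4 * y ^ 3 + sin y - y)); try lra.
    + intros y. auto_derive; trivial. field.
    + intros y Hy. specialize (S2 y). assert (0 <= y ^ 3) by (apply pow_le; lra). lra.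
Qed.

(** 1 - cos x = 2 sin(x/2)^2, and sin t >= t - t^3/6 >= t/3 for 0 <= t <= 2. The estimate PI <= 4
    puts x/2 in that range. *)
Lemma one_sub_cos_ge x : 0 <= x <= PI -> x ^ 2 / 18 <= 1 - cos x.
Proof.
  intros Hx. assert (P := PI_4).
  replace x with (2 * (x / 2)) at 2 by field. rewrite cos_2a_sin.
  set (t := x / 2). replace (x ^ 2 / 18) with (2 * (t / 3) * (t / 3)) by (unfold t; field).
  assert (Ht : 0 <= t <= 2) by (unfold t; lra).
  assert (t / 3 <= sin t); [|nra].
  assert (sin 0 - 0 + 0 ^ 3 / 6 <= sin t - t + t ^ 3 / 6).
  { apply (increment_ge_0 (fun y => sin y - y + y ^ 3 / 6) (fun y => cos y - 1 + y ^ 2 / 2)); try lra.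
    - intros y. auto_derive; trivial. field.
    - intros y Hy. apply cos_sub_bound; lra. }
  rewrite sin_0 in *. nra.
Qed.

(** * Poisson kernels, their periodic sum and its duplication formula *)

Definition poisson (c u : R) : R := u / (u ^ 2 + c ^ 2).

Definition kappa (a u : R) : R := PI * sinh (2 * PI * u) / (cosh (2 * PI * u) - cos (2 * PI * a)).

(** The terms of index k and -k - 1 of the two-sided sum, paired. The series then runs over [nat]
    and matches the two Hurwitz series term by term. *)
Definition poisson2 (a u : R) (k : nat) : R := poisson (INR k + a) u + poisson (INR k + 1 - a) u.

Lemma poisson_bound c u : 0 < u -> 0 < c -> 0 <= poisson c u <= u / c ^ 2.
Proof.
  intros Hu Hc. unfold poisson.
  assert (0 < c ^ 2) by (apply pow_lt; trivial). assert (0 < u ^ 2) by (apply pow_lt; trivial).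
  split. left; apply Rdiv_lt_0_compat; lra.
  apply Rmult_le_compat_l; [lra|]. apply Rinv_le_contravar; lra.
Qed.

Lemma is_series_telescope (v : nat -> R) (l : R) : is_lim_seq v l ->
  is_series (fun k => v k - v (S k)) (v 0%nat - l).
Proof.
  intros H.
  apply (is_lim_seq_ext (fun n => v 0%nat - v (S n)) _ (v 0%nat - l)).
  - intros n. induction n as [|n IH].
    + rewrite sum_O. reflexivity.
    + rewrite sum_Sn, <- IH. apply Rminus_diag_uniq. unfold plus; simpl. ring.
  - apply is_lim_seq_minus'. apply is_lim_seq_const. apply (is_lim_seq_incr_1 v). exact H.
Qed.

Lemma is_lim_seq_inv_INR : is_lim_seq (fun n => / (INR n + 1)) 0.
Proof.
  replace (Finite 0) with (Rbar_inv p_infty) by reflexivity.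
  apply is_lim_seq_inv; [|discriminate].
  apply (is_lim_seq_ext (fun n => INR (S n))). { intros n; apply S_INR. }
  apply (is_lim_seq_incr_1 INR). apply is_lim_seq_INR.
Qed.

Lemma is_series_inv_mul : is_series (fun k => / ((INR k + 1) * (INR k + 2))) 1.
Proof.
  enough (E : is_series (fun k => / ((INR k + 1) * (INR k + 2))) (/ (INR 0 + 1) - 0)).
  { replace (/ (INR 0 + 1) - 0) with 1 in E by (simpl; field). exact E. }
  apply (is_series_ext (fun k => / (INR k + 1) - / (INR (S k) + 1))).
  - assert (H : forall x, 0 <= x -> / (x + 1) - / (x + 1 + 1) = / ((x + 1) * (x + 2))) by (intros; field; lra).
    intros k. rewrite S_INR. apply H, pos_INR.
  - apply (is_series_telescope (fun n => / (INR n + 1))), is_lim_seq_inv_INR.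
Qed.

(** The comparison series telescopes to 1, and (k + 1)^2 >= (k + 1)(k + 2) / 2 gives the constant.
    Index zero is left out because a or 1 - a may be arbitrarily small. *)
Lemma poisson2_bound a u k : 0 < a < 1 -> 0 < u ->
  0 <= poisson2 a u (S k) <= 4 * u * / ((INR k + 1) * (INR k + 2)).
Proof.
  intros Ha Hu. unfold poisson2. rewrite S_INR. assert (H := pos_INR k).
  destruct (poisson_bound (INR k + 1 + a) u) as [H1 H2]; try lra.
  destruct (poisson_bound (INR k + 1 + 1 - a) u) as [H3 H4]; try lra.
  assert (B : forall c, INR k + 1 <= c -> u / c ^ 2 <= 2 * u * / ((INR k + 1) * (INR k + 2))).
  { intros c Hc. unfold Rdiv.
    replace (2 * u * / ((INR k + 1) * (INR k + 2))) with (u * / ((INR k + 1) * ((INR k + 2) / 2))) by (field; lra).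
    apply Rmult_le_compat_l; [lra|]. apply Rinv_le_contravar. nra. nra. }
  assert (B1 := B (INR k + 1 + a)). assert (B2 := B (INR k + 1 + 1 - a)). lra.
Qed.

Lemma ex_series_poisson2 a u : 0 < a < 1 -> 0 < u -> ex_series (poisson2 a u).
Proof.
  intros Ha Hu. apply ex_series_incr_1.
  apply (ex_series_le (V := R_CompleteNormedModule) _ (fun k => 4 * u * / ((INR k + 1) * (INR k + 2)))).
  - intros k. destruct (poisson2_bound a u k Ha Hu).
    change (norm (poisson2 a u (S k))) with (Rabs (poisson2 a u (S k))). rewrite Rabs_pos_eq; trivial.
  - apply (ex_series_scal (V := R_NormedModule)). exists 1. apply is_series_inv_mul.
Qed.

(** Uniformly in a, only the zeroth pair can be large when u is small. *)
Lemma Series_poisson2_tail a u : 0 < a < 1 -> 0 < u ->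
  Rabs (Series (poisson2 a u) - poisson a u - poisson (1 - a) u) <= 4 * u.
Proof.
  intros Ha Hu. rewrite Series_incr_1 by (apply ex_series_poisson2; trivial).
  unfold poisson2 at 1. simpl INR. rewrite !Rplus_0_l.
  replace (poisson a u + poisson (1 - a) u + Series (fun k => poisson2 a u (S k)) - poisson a u - poisson (1 - a) u)
    with (Series (fun k => poisson2 a u (S k))) by ring.
  assert (E : is_series (fun k => 4 * u * / ((INR k + 1) * (INR k + 2))) (4 * u * 1))
    by apply (is_series_scal (K := R_AbsRing) (V := R_NormedModule) (4 * u)), is_series_inv_mul.
  rewrite Rmult_1_r in E.
  rewrite <- (is_series_unique _ _ E), Rabs_pos_eq.
  - apply Series_le; [|eexists; exact E]. intros k; apply poisson2_bound; trivial.
  - replace 0 with (Series (fun k => 0 * poisson2 a u (S k))) by (rewrite Series_scal_l; ring).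
    apply Series_le. intros k. destruct (poisson2_bound a u k); trivial. lra.
    apply (ex_series_incr_1 (poisson2 a u)), ex_series_poisson2; trivial.
Qed.

(** Near u = 0 the possible blow-up of kappa for small a is that of its nearest Poisson term. The
    constant must not depend on a, since the duplication argument moves a at every step. *)
Lemma kappa_pole a u : 0 < a <= 1 / 2 -> 0 < u <= 1 / 8 -> Rabs (kappa a u - poisson a u) <= 1728 * u.
Proof.
  intros Ha Hu. assert (P := PI_4). assert (HP := PI_RGT_0).
  unfold kappa, poisson.
  set (U := 2 * PI * u). set (A := 2 * PI * a).
  assert (HU : 0 < U <= 1) by (unfold U; nra).
  assert (HA : 0 < A <= PI) by (unfold A; nra).
  assert (B1 := sinh_sub_bound U ltac:(lra)). assert (B2 := cosh_sub_bound U ltac:(lra)).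
  assert (B3 := cos_sub_bound A ltac:(lra)). assert (B4 := one_sub_cos_ge A ltac:(lra)).
  set (S := U ^ 2 + A ^ 2).
  assert (HU2 : 0 < U ^ 2) by (apply pow_lt; lra). assert (HA2 : 0 < A ^ 2) by (apply pow_lt; lra).
  assert (HS : 0 < S) by (unfold S; lra).
  set (D := cosh U - cos A).
  assert (HD : S / 18 <= D) by (unfold D, S; lra).
  assert (HDS0 : 0 < D * S) by (apply Rmult_lt_0_compat; lra).
  (* In the variables U and A the Poisson term is PI (2 U / S), so N is S sinh U - 2 U D. The
     leading parts cancel because D is S / 2 plus the Taylor remainders of cosh and cos. *)
  set (N := (sinh U - U) * S - 2 * U * ((cosh U - 1 - U ^ 2 / 2) - (cos A - 1 + A ^ 2 / 2))).
  replace (PI * sinh U / D - u / (u ^ 2 + a ^ 2)) with (PI * (N / (D * S))).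
  2: { replace (u / (u ^ 2 + a ^ 2)) with (PI * (2 * U / S)).
       - unfold N. replace (cosh U) with (D + cos A) by (unfold D; ring). unfold S at 1 2. unfold S in *. field.
         split; lra.
       - unfold S, U, A. assert (0 < u ^ 2) by (apply pow_lt; lra). assert (0 < a ^ 2) by (apply pow_lt; lra).
         field. split; [lra|]. apply Rgt_not_eq.
         replace (_ + _) with (4 * PI ^ 2 * (u ^ 2 + a ^ 2)) by ring.
         assert (0 < PI ^ 2) by (apply pow_lt; lra). nra. }
  assert (HN : Rabs N <= 3 * U * S ^ 2).
  { assert (E1 : (sinh U - U) * S <= U * S ^ 2).
    { apply Rle_trans with (U ^ 3 * S). apply Rmult_le_compat_r; lra.
      replace (U ^ 3 * S) with (U * S * U ^ 2) by ring. replace (U * S ^ 2) with (U * S * S) by ring.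
      apply Rmult_le_compat_l; unfold S; nra. }
    assert (E2 : 0 <= (sinh U - U) * S) by (apply Rmult_le_pos; lra).
    assert (E3 : U ^ 4 + A ^ 4 <= S ^ 2) by (unfold S; nra).
    assert (0 <= U ^ 4) by (apply pow_le; lra). assert (0 <= A ^ 4) by (apply pow_le; lra).
    assert (E4 : Rabs ((cosh U - 1 - U ^ 2 / 2) - (cos A - 1 + A ^ 2 / 2)) <= S ^ 2) by (apply Rabs_le; lra).
    unfold N. unfold Rminus at 1. eapply Rle_trans; [apply Rabs_triang|].
    rewrite Rabs_Ropp, (Rabs_pos_eq ((sinh U - U) * S)) by trivial.
    rewrite Rabs_mult, (Rabs_pos_eq (2 * U)) by lra. nra. }
  rewrite Rabs_mult, Rabs_pos_eq by lra. unfold Rdiv. rewrite Rabs_mult, Rabs_inv, (Rabs_pos_eq (D * S)) by lra.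
  (* 54 = 3 * 18, from |N| <= 3 U S^2 and D >= S / 18. *)
  assert (HDS : Rabs N * / (D * S) <= 54 * U).
  { apply (Rmult_le_reg_r (D * S)); trivial. rewrite Rmult_assoc, Rinv_l, Rmult_1_r by lra.
    apply Rle_trans with (1 := HN). apply Rle_trans with (54 * U * (S / 18 * S)). right; field.
    apply Rmult_le_compat_l. lra. apply Rmult_le_compat_r; lra. }
  apply Rle_trans with (PI * (54 * U)). apply Rmult_le_compat_l; lra. unfold U.
  (* 1728 = 108 * 16, with 108 = 2 * 54. *)
  assert (PI * PI <= 16) by nra. replace (PI * (54 * (2 * PI * u))) with (108 * (PI * PI) * u) by ring.
  apply Rmult_le_compat_r; lra.
Qed.

Lemma kappa_sym a u : kappa (1 - a) u = kappa a u.
Proof.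
  unfold kappa. replace (2 * PI * (1 - a)) with (- (2 * PI * a) + 2 * PI) by ring.
  rewrite <- cos_neg. replace (- (- (2 * PI * a) + 2 * PI)) with (2 * PI * a - 2 * PI) by ring.
  rewrite cos_minus, cos_2PI, sin_2PI. f_equal. ring.
Qed.

(** 1736 = 1728 + 4 + 4: the pole estimate, the tail of the series, and the far term
    [poisson (1 - a) u]. The symmetry a -> 1 - a reduces to a <= 1/2. *)
Lemma kappa_sub_Series_bound a u : 0 < a < 1 -> 0 < u <= 1 / 8 ->
  Rabs (kappa a u - Series (poisson2 a u)) <= 1736 * u.
Proof.
  assert (G : forall a u, 0 < a <= 1 / 2 -> 0 < u <= 1 / 8 ->
    Rabs (kappa a u - Series (poisson2 a u)) <= 1736 * u).
  { clear. intros a u Ha Hu.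
    assert (H1 := kappa_pole a u Ha Hu). assert (H2 := Series_poisson2_tail a u ltac:(lra) ltac:(lra)).
    destruct (poisson_bound (1 - a) u) as [H3 H4]; try lra.
    assert (H5 : u / (1 - a) ^ 2 <= 4 * u).
    { unfold Rdiv. rewrite Rmult_comm. apply Rmult_le_compat_r; [lra|].
      rewrite <- (Rinv_inv 4). apply Rinv_le_contravar; nra. }
    apply Rabs_le_between in H1. apply Rabs_le_between in H2. apply Rabs_le. lra. }
  intros Ha Hu. destruct (Rle_lt_dec a (1 / 2)) as [H | H].
  - apply G; lra.
  - rewrite <- kappa_sym. rewrite (Series_ext (poisson2 a u) (poisson2 (1 - a) u)).
    + apply G; lra.
    + intros n. unfold poisson2. replace (INR n + 1 - (1 - a)) with (INR n + a) by ring.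
      replace (INR n + 1 - a) with (INR n + (1 - a)) by ring. ring.
Qed.

(** With v = PI u and w = PI a, cosh 2v - cos 2w = 2 (cosh v - cos w)(cosh v + cos w); the
    right-hand side is the partial fraction decomposition over these factors. *)
Lemma kappa_double a u : 0 < a < 1 -> 0 < u ->
  kappa a u = (kappa (a / 2) (u / 2) + kappa ((a + 1) / 2) (u / 2)) / 2.
Proof.
  intros Ha Hu. assert (HP := PI_RGT_0). unfold kappa.
  replace (2 * PI * (u / 2)) with (PI * u) by field.
  replace (2 * PI * (a / 2)) with (PI * a) by field.
  replace (2 * PI * ((a + 1) / 2)) with (PI * a + PI) by field.
  rewrite neg_cos.
  replace (2 * PI * u) with (2 * (PI * u)) by ring. replace (2 * PI * a) with (2 * (PI * a)) by ring.
  set (v := PI * u). set (w := PI * a).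
  rewrite cos_2a_cos.
  assert (E1 : sinh (2 * v) = 2 * sinh v * cosh v).
  { unfold sinh, cosh. replace (2 * v) with (v + v) by ring. rewrite Ropp_plus_distr, !exp_plus. field. }
  assert (E2 : cosh (2 * v) = 2 * cosh v ^ 2 - 1).
  { unfold cosh. replace (2 * v) with (v + v) by ring. rewrite Ropp_plus_distr, !exp_plus.
    assert (E : exp v * exp (- v) = 1) by (rewrite <- exp_plus, Rplus_opp_r; apply exp_0).
    replace 1 with (exp v * exp (- v)) by exact E. field. }
  rewrite E1, E2.
  assert (Hc : 1 < cosh v).
  { assert (B : sinh (v / 2) <> 0).
    { apply Rgt_not_eq. rewrite <- sinh_0. apply sinh_lt. unfold v; nra. }
    assert (cosh v = 1 + 2 * sinh (v / 2) ^ 2).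
    { unfold sinh, cosh. replace v with (v / 2 + v / 2) at 1 2 by field. rewrite Ropp_plus_distr, !exp_plus.
      assert (E : exp (v / 2) * exp (- (v / 2)) = 1) by (rewrite <- exp_plus, Rplus_opp_r; apply exp_0).
      replace 1 with (exp (v / 2) * exp (- (v / 2))) by exact E. field. }
    generalize (pow2_gt_0 _ B). lra. }
  assert (Hw := COS_bound w).
  field. repeat split; nra.
Qed.

Lemma Series_pair (f : nat -> R) : ex_series f -> Series (fun k => f (2 * k)%nat + f (S (2 * k))%nat) = Series f.
Proof.
  intros [l Hl]. rewrite (is_series_unique f l Hl). apply is_series_unique.
  assert (E : forall n, sum_n f (S (2 * n)) = sum_n (fun k => f (2 * k)%nat + f (S (2 * k))) n).
  { intros n. induction n as [|n IH].
    - simpl. rewrite sum_Sn, !sum_O. reflexivity.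
    - rewrite (sum_Sn (fun k => f (2 * k)%nat + f (S (2 * k))%nat)), <- IH.
      replace (S (2 * S n)) with (S (S (S (2 * n)))) by lia. rewrite (sum_Sn f (S (S (2 * n)))), (sum_Sn f (S (2 * n))).
      replace (2 * S n)%nat with (S (S (2 * n))) by lia. unfold plus; simpl; ring. }
  apply (is_lim_seq_ext (fun n => sum_n f (S (2 * n))) _ l).
  - exact E.
  - apply (is_lim_seq_subseq (sum_n f) l (fun n => S (2 * n))); trivial.
    apply eventually_subseq. intros n. lia.
Qed.

(** The two-sided index splits by parity: even integers give a/2, odd ones (a+1)/2, and [poisson] is
    homogeneous of degree -1. In the one-sided form the two classes mix inside the terms 2k and 2k +
    1, hence [Series_pair]. *)
Lemma Series_poisson2_double a u : 0 < a < 1 -> 0 < u ->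
  Series (poisson2 a u) = (Series (poisson2 (a / 2) (u / 2)) + Series (poisson2 ((a + 1) / 2) (u / 2))) / 2.
Proof.
  intros Ha Hu.
  rewrite <- (Series_pair (poisson2 a u)) by (apply ex_series_poisson2; lra).
  rewrite <- Series_plus by (apply ex_series_poisson2; lra).
  match goal with |- _ = ?x / 2 => change (x / 2) with (x * / 2) end. rewrite <- Series_scal_r.
  apply Series_ext. intros k. unfold poisson2.
  assert (H : forall c, 0 < c -> poisson (c / 2) (u / 2) = 2 * poisson c u).
  { intros c Hc. unfold poisson. assert (0 < c ^ 2) by (apply pow_lt; trivial). assert (0 < u ^ 2) by (apply pow_lt; trivial).
    field. lra. }
  assert (Hk := pos_INR k).
  replace (INR k + a / 2) with ((2 * INR k + a) / 2) by field.
  replace (INR k + 1 - a / 2) with ((2 * INR k + 2 - a) / 2) by field.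
  replace (INR k + (a + 1) / 2) with ((2 * INR k + 1 + a) / 2) by field.
  replace (INR k + 1 - (a + 1) / 2) with ((2 * INR k + 1 - a) / 2) by field.
  assert (E2 : INR (2 * k) = 2 * INR k) by (rewrite mult_INR; simpl; ring).
  assert (E3 : INR (S (2 * k)) = 2 * INR k + 1) by (rewrite S_INR, E2; ring).
  rewrite !H by lra. rewrite E3, E2.
  replace (2 * INR k + 1 + 1 - a) with (2 * INR k + 2 - a) by ring. field.
Qed.

(* The difference of the two sides satisfies the same duplication formula, and is O(u): iterating, it is O(u / 2^n). *)
Theorem is_series_poisson2 a u : 0 < a < 1 -> 0 < u -> is_series (poisson2 a u) (kappa a u).
Proof.
  intros Ha Hu.
  enough (E : kappa a u = Series (poisson2 a u)).
  { rewrite E. apply Series_correct, ex_series_poisson2; trivial. }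
  assert (Hn : forall n a u, 0 < a < 1 -> 0 < u <= 1 / 8 -> Rabs (kappa a u - Series (poisson2 a u)) <= 1736 * u / 2 ^ n).
  { clear. induction n as [|n IH]; intros a u Ha Hu.
    - simpl. rewrite Rdiv_1_r. apply kappa_sub_Series_bound; trivial.
    - rewrite kappa_double, Series_poisson2_double by lra.
      assert (H1 := IH (a / 2) (u / 2) ltac:(lra) ltac:(lra)).
      assert (H2 := IH ((a + 1) / 2) (u / 2) ltac:(lra) ltac:(lra)).
      assert (0 < 2 ^ n) by (apply pow_lt; lra).
      replace (1736 * u / 2 ^ S n) with ((1736 * (u / 2) / 2 ^ n + 1736 * (u / 2) / 2 ^ n) / 2) by (simpl; field; lra).
      apply Rabs_le_between in H1. apply Rabs_le_between in H2. apply Rabs_le. lra. }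
  assert (H0 : forall a u, 0 < a < 1 -> 0 < u <= 1 / 8 -> kappa a u = Series (poisson2 a u)).
  { clear a u Ha Hu. intros a u Ha Hu. apply Rminus_diag_uniq.
    apply Rabs_eq_0. apply Rle_antisym; [|apply Rabs_pos]. apply le_epsilon. intros e He. rewrite Rplus_0_l.
    destruct (Pow_x_infinity 2 ltac:(rewrite Rabs_pos_eq; lra) (1736 * u / e)) as [n N]. specialize (N n (le_n n)).
    rewrite Rabs_pos_eq in N by (apply pow_le; lra).
    eapply Rle_trans; [apply (Hn n); trivial|]. assert (0 < 2 ^ n) by (apply pow_lt; lra).
    apply (Rmult_le_reg_r (2 ^ n)); trivial. replace (1736 * u / 2 ^ n * 2 ^ n) with (1736 * u / e * e) by (field; lra).
    rewrite (Rmult_comm e). apply Rmult_le_compat_r; lra. }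
  (* Duplication also halves u, so it extends the identity from u <= 1/8 to every u > 0. *)
  assert (Hm : forall n a u, 0 < a < 1 -> 0 < u <= 2 ^ n / 8 -> kappa a u = Series (poisson2 a u)).
  { clear - H0. induction n as [|n IH]; intros a u Ha Hu.
    - apply H0; simpl in Hu; lra.
    - rewrite kappa_double, Series_poisson2_double by lra. simpl in Hu. rewrite !IH by lra. reflexivity. }
  destruct (Pow_x_infinity 2 ltac:(rewrite Rabs_pos_eq; lra) (8 * u)) as [n N]. specialize (N n (le_n n)).
  rewrite Rabs_pos_eq in N by (apply pow_le; lra).
  apply (Hm n); lra.
Qed.

(** * Laplace integrals *)

(** A truncated two-sided Laplace integral, that is, a Mellin integral in the variable u = exp y. *)
Definition LI (k : R -> R) (s : C) (a b : R) : C :=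
  CInt (fun y => cexp (- (s * RtoC y)) * RtoC (k y))%C a b.

Lemma Ccont_cexp_lin (s : C) y : Ccont (fun t => cexp (- (s * RtoC t)))%C y.
Proof.
  destruct s as [u v].
  split; unfold cexp, Re, Im; simpl; apply (ex_derive_continuous (K := R_AbsRing) (V := R_NormedModule));
  auto_derive; trivial.
Qed.

Lemma Re_neg_mul (s : C) (y : R) : Re (- (s * RtoC y))%C = - Re s * y.
Proof. unfold Re, Copp, Cmult, RtoC; simpl. ring. Qed.

Definition cont (k : R -> R) := forall y, continuous k y.

Lemma LI_integrand_cont k s a b : cont k -> Ccont_on (fun y => cexp (- (s * RtoC y)) * RtoC (k y))%C a b.
Proof.
  intros Hk y _. apply Ccont_mult. apply Ccont_cexp_lin. apply Ccont_RtoC, Hk.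
Qed.

Lemma cont_ex_RInt k a b : cont k -> ex_RInt k a b.
Proof. intros H. apply (ex_RInt_continuous (V := R_CompleteNormedModule)). intros; apply H. Qed.

Lemma LI_Chasles k s a b c : a <= b <= c -> cont k -> (LI k s a b + LI k s b c)%C = LI k s a c.
Proof. intros H Hk. apply CInt_Chasles; trivial. apply LI_integrand_cont; trivial. Qed.

Lemma LI_plus k1 k2 s a b : a <= b -> cont k1 -> cont k2 ->
  LI (fun y => k1 y + k2 y) s a b = (LI k1 s a b + LI k2 s a b)%C.
Proof.
  intros Hab H1 H2. unfold LI. rewrite <- CInt_plus by (trivial; apply LI_integrand_cont; trivial).
  apply CInt_ext; trivial. intros y _. rewrite RtoC_plus. ring.
Qed.

Lemma LI_minus k1 k2 s a b : a <= b -> cont k1 -> cont k2 ->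
  LI (fun y => k1 y - k2 y) s a b = (LI k1 s a b - LI k2 s a b)%C.
Proof.
  intros Hab H1 H2. unfold LI. rewrite <- CInt_minus by (trivial; apply LI_integrand_cont; trivial).
  apply CInt_ext; trivial. intros y _. rewrite RtoC_minus. ring.
Qed.

Lemma RInt_exp d a b : d <> 0 -> is_RInt (fun y => exp (d * y)) a b ((exp (d * b) - exp (d * a)) / d).
Proof.
  intros Hd.
  replace ((exp (d * b) - exp (d * a)) / d) with (minus (exp (d * b) / d) (exp (d * a) / d)).
  2: unfold minus, plus, opp; simpl; field; trivial.
  apply (is_RInt_derive (V := R_CompleteNormedModule) (fun y => exp (d * y) / d)).
  - intros y _. auto_derive; trivial. field; trivial.
  - intros y _. apply (ex_derive_continuous (K := R_AbsRing) (V := R_NormedModule)). auto_derive; trivial.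
Qed.

Lemma Cmod_CInt_exp f A d a b : a <= b -> d <> 0 -> Ccont_on f a b ->
  (forall y, a <= y <= b -> Cmod (f y) <= A * exp (d * y)) ->
  Cmod (CInt f a b) <= A * ((exp (d * b) - exp (d * a)) / d).
Proof.
  intros Hab Hd Hf H.
  assert (E : is_RInt (fun y => A * exp (d * y)) a b (A * ((exp (d * b) - exp (d * a)) / d))).
  { apply (is_RInt_scal (V := R_NormedModule)), RInt_exp; trivial. }
  rewrite <- (is_RInt_unique _ _ _ _ E).
  apply Cmod_CInt_le; trivial. eexists; exact E.
Qed.

Lemma Cmod_CInt_exp_pos f A d a b : a <= b -> 0 < d -> 0 <= A -> Ccont_on f a b ->
  (forall y, a <= y <= b -> Cmod (f y) <= A * exp (d * y)) -> Cmod (CInt f a b) <= A / d * exp (d * b).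
Proof.
  intros Hab Hd HA Hf H. eapply Rle_trans; [apply Cmod_CInt_exp with (A := A) (d := d); trivial; lra|].
  replace (A / d * exp (d * b)) with (A * (exp (d * b) / d)) by (field; lra).
  apply Rmult_le_compat_l; trivial. apply Rmult_le_compat_r. left; apply Rinv_0_lt_compat; lra.
  generalize (exp_pos (d * a)); lra.
Qed.

Lemma Cmod_CInt_exp_neg f A d a b : a <= b -> 0 < d -> 0 <= A -> Ccont_on f a b ->
  (forall y, a <= y <= b -> Cmod (f y) <= A * exp (- d * y)) -> Cmod (CInt f a b) <= A / d * exp (- d * a).
Proof.
  intros Hab Hd HA Hf H. eapply Rle_trans; [apply Cmod_CInt_exp with (A := A) (d := - d); trivial; lra|].
  replace (A / d * exp (- d * a)) with (A * (exp (- d * a) / d)) by (field; lra).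
  replace ((exp (- d * b) - exp (- d * a)) / - d) with ((exp (- d * a) - exp (- d * b)) / d) by (field; lra).
  apply Rmult_le_compat_l; trivial. apply Rmult_le_compat_r. left; apply Rinv_0_lt_compat; lra.
  generalize (exp_pos (- d * b)); lra.
Qed.

Lemma Cmod_LI_integrand k s y : Cmod (cexp (- (s * RtoC y)) * RtoC (k y))%C = exp (- Re s * y) * Rabs (k y).
Proof. rewrite Cmod_mult, Cmod_cexp, Cmod_R, Re_neg_mul. reflexivity. Qed.

(** On a bounded interval a small increment h of s keeps |h y| <= 1/2, so [cexp_taylor] applies
    uniformly under the integral sign and leaves an error of at most G |h|^2. *)
Lemma Cdiff_LI k a b z : a <= b -> cont k -> Cdiff (fun s => LI k s a b) z.
Proof.
  intros Hab Hk.
  set (g := fun y => exp (- Re z * y) * Rabs (k y)).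
  assert (Hg : ex_RInt g a b).
  { apply cont_ex_RInt. intros y. apply (continuous_mult (K := R_AbsRing)).
    - apply (ex_derive_continuous (K := R_AbsRing) (V := R_NormedModule)). auto_derive; trivial.
    - apply (continuous_comp k Rabs). apply Hk. apply continuous_Rabs. }
  set (Y := Rabs a + Rabs b + 1).
  assert (HY : 1 <= Y). { unfold Y. generalize (Rabs_pos a) (Rabs_pos b); lra. }
  assert (HyY : forall y, a <= y <= b -> Rabs y <= Y).
  { intros y Hy. apply Rabs_le. unfold Y. assert (H1 := Rle_abs b). assert (H2 := Rle_abs (- a)).
    rewrite Rabs_Ropp in H2. generalize (Rabs_pos a) (Rabs_pos b); lra. }
  set (G := 8 * Y ^ 2 * RInt g a b).
  assert (HG : 0 <= G).
  { unfold G. apply Rmult_le_pos. generalize (pow2_ge_0 Y); lra. apply RInt_ge_0; trivial.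
    intros y _. apply Rmult_le_pos; [left; apply exp_pos | apply Rabs_pos]. }
  exists (CInt (fun y => - RtoC y * (cexp (- (z * RtoC y)) * RtoC (k y)))%C a b).
  apply is_Cderive_eps. intros eps Heps.
  exists (Rmin (/ (2 * Y)) (eps / (G + 1))). split.
  { apply Rmin_glb_lt. apply Rinv_0_lt_compat; lra. apply Rdiv_lt_0_compat; lra. }
  intros w Hw. set (h := (w - z)%C) in *.
  assert (Hh1 : Cmod h < / (2 * Y)) by (eapply Rlt_le_trans; [exact Hw | apply Rmin_l]).
  assert (Hh2 : Cmod h < eps / (G + 1)) by (eapply Rlt_le_trans; [exact Hw | apply Rmin_r]).
  assert (Hh0 := Cmod_ge_0 h).
  assert (C1 := LI_integrand_cont k w a b Hk). assert (C2 := LI_integrand_cont k z a b Hk).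
  assert (C3 : Ccont_on (fun y => - RtoC y * (cexp (- (z * RtoC y)) * RtoC (k y)))%C a b).
  { intros y Hy. apply Ccont_mult. apply Ccont_opp, Ccont_RtoC, continuous_id. apply C2; trivial. }
  unfold LI. rewrite <- CInt_minus, <- CInt_scal, <- CInt_minus; trivial.
  2: { intros y Hy. apply Ccont_minus; auto. }
  2: { intros y Hy. apply Ccont_mult; auto using Ccont_const. }
  eapply Rle_trans; [apply Cmod_CInt_le with (g := fun y => 8 * Y ^ 2 * Cmod h ^ 2 * g y); trivial|].
  - intros y Hy. apply Ccont_minus. apply Ccont_minus; auto. apply Ccont_mult; auto using Ccont_const.
  - apply (ex_RInt_scal (V := R_NormedModule)); trivial.
  - intros y Hy. specialize (HyY y Hy).
    set (v := (- (h * RtoC y))%C).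
    replace (cexp (- (w * RtoC y)))%C with (cexp (- (z * RtoC y)) * cexp v)%C.
    2: { rewrite <- cexp_plus. f_equal. unfold v, h. ring. }
    replace (_ - _)%C with (cexp (- (z * RtoC y)) * RtoC (k y) * (cexp v - 1 - v))%C.
    2: { unfold v. ring. }
    rewrite Cmod_mult, Cmod_LI_integrand. fold (g y).
    assert (Hv : Cmod v = Cmod h * Rabs y). { unfold v. rewrite Cmod_opp, Cmod_mult, Cmod_R. reflexivity. }
    assert (Hvy : Cmod v <= Cmod h * Y). { rewrite Hv. apply Rmult_le_compat_l; trivial. }
    assert (Hv2 : Cmod v <= 1 / 2).
    { apply Rle_trans with (1 := Hvy). apply Rle_trans with (/ (2 * Y) * Y). apply Rmult_le_compat_r; lra.
      right; field; lra. }
    apply cexp_taylor in Hv2.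
    assert (0 <= g y). { apply Rmult_le_pos; [left; apply exp_pos | apply Rabs_pos]. }
    assert (Cmod v ^ 2 <= (Cmod h * Y) ^ 2) by (apply pow_incr; split; [apply Cmod_ge_0 | trivial]).
    rewrite Rmult_comm. apply Rmult_le_compat_r; trivial. nra.
  - assert (E : RInt (fun y => 8 * Y ^ 2 * Cmod h ^ 2 * g y) a b = G * Cmod h ^ 2).
    { unfold G. rewrite (RInt_scal (V := R_CompleteNormedModule) g a b) by trivial. unfold scal; simpl; unfold mult; simpl. ring. }
    rewrite E. replace (G * Cmod h ^ 2) with (G * Cmod h * Cmod h) by ring. apply Rmult_le_compat_r; trivial.
    apply Rmult_lt_compat_r with (r := G + 1) in Hh2; [|lra].
    replace (eps / (G + 1) * (G + 1)) with eps in Hh2 by (field; lra). nra.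
Qed.

Lemma Cmod_cexp_imag_sub_1 (t : R) : Cmod (cexp (0, t) - 1) <= 2 * Rabs t.
Proof.
  eapply Rle_trans; [apply Cmod_le_Rabs_sum|].
  unfold cexp, Re, Im; simpl. rewrite exp_0.
  replace (1 * cos t + - (1)) with (cos t - 1) by ring. replace (1 * sin t + - 0) with (sin t) by ring.
  assert (H1 := Rabs_sin_le t).
  assert (H2 : Rabs (cos t - 1) <= Rabs t).
  { assert (H := bounded_variation cos (fun t => - sin t) 1 0 t).
    rewrite cos_0, !Rminus_0_r, Rmult_1_l in H. apply H.
    intros u _. split. { auto_derive; trivial; ring. } apply Rabs_le. generalize (SIN_bound u); lra. }
  lra.
Qed.

(** A factor y, coming from a derivative in s, is absorbed by half of an exponential decay of rate
    d. *)
Lemma Rabs_le_exp d y : 0 < d -> Rabs y <= 2 / d * exp (d / 2 * Rabs y).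
Proof.
  intros Hd. assert (H := exp_ineq1_le (d / 2 * Rabs y)).
  replace (Rabs y) with (2 / d * (d / 2 * Rabs y)) at 1 by (field; lra).
  apply Rmult_le_compat_l; [|lra]. left; apply Rdiv_lt_0_compat; lra.
Qed.

(* e is a vertical displacement of s. *)
Lemma Cmod_LI_shift_integrand k (s : C) (e y A d : R) : 0 < d -> 0 <= A ->
  exp (- Re s * y) * Rabs (k y) <= A * exp (- d * Rabs y) ->
  Cmod (cexp (- ((s + (0, e)) * RtoC y)) * RtoC (k y) - cexp (- (s * RtoC y)) * RtoC (k y))%C
  <= 4 / d * A * Rabs e * exp (- (d / 2) * Rabs y).
Proof.
  intros Hd HA H.
  replace (cexp (- ((s + (0, e)) * RtoC y)))%C with (cexp (- (s * RtoC y)) * cexp (0, (- (e * y))%R))%C.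
  2: { rewrite <- cexp_plus. f_equal. destruct s; unfold Cplus, Copp, Cmult, RtoC; simpl. apply f_equal2; ring. }
  replace (_ - _)%C with (cexp (- (s * RtoC y)) * RtoC (k y) * (cexp (0, (- (e * y))%R) - 1))%C by ring.
  rewrite Cmod_mult, Cmod_LI_integrand.
  assert (H1 := Cmod_cexp_imag_sub_1 (- (e * y))). rewrite Rabs_Ropp, Rabs_mult in H1.
  assert (H2 := Rabs_le_exp d y Hd).
  assert (H3 : exp (- (d / 2) * Rabs y) = exp (- d * Rabs y) * exp (d / 2 * Rabs y)).
  { rewrite <- exp_plus. f_equal. field. }
  rewrite H3.
  eapply Rle_trans.
  { apply Rmult_le_compat; [| apply Cmod_ge_0 | exact H | exact H1].
    apply Rmult_le_pos; [left; apply exp_pos | apply Rabs_pos]. }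
  assert (He := exp_pos (- d * Rabs y)). assert (He2 := Rabs_pos e).
  replace (4 / d * A * Rabs e * (exp (- d * Rabs y) * exp (d / 2 * Rabs y)))
    with (A * exp (- d * Rabs y) * (2 * (Rabs e * (2 / d * exp (d / 2 * Rabs y))))) by (field; lra).
  apply Rmult_le_compat_l. apply Rmult_le_pos; lra.
  apply Rmult_le_compat_l. lra. apply Rmult_le_compat_l; trivial.
Qed.

Lemma CInt_shift f v a b : a <= b -> (forall y, Ccont f y) ->
  CInt (fun y => f (y + v)) a b = CInt f (a + v) (b + v).
Proof.
  intros Hab Hf. destruct (Ccont_on_ex_RInt f (a + v) (b + v)) as [H1 H2]. lra. { intros y _; apply Hf. }
  assert (G : forall g : R -> R, ex_RInt g (a + v) (b + v) -> RInt (fun y => g (y + v)) a b = RInt g (a + v) (b + v)).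
  { clear. intros g Hg. assert (E := RInt_comp_lin (V := R_CompleteNormedModule) g 1 v a b).
    rewrite !Rmult_1_l in E. rewrite <- E by trivial. apply RInt_ext. intros y _.
    unfold scal; simpl; unfold mult; simpl. rewrite !Rmult_1_l. reflexivity. }
  unfold CInt. apply f_equal2.
  - apply (G (fun y => Re (f y))); trivial.
  - apply (G (fun y => Im (f y))); trivial.
Qed.

(** * The two kernels *)

(** [P] is the part of k at +oo that limits convergence. Once it is removed there, the Laplace
    integral of k converges absolutely for -q < Re s < 2; on 1 - q <= Re s <= 7/4 the integrand
    decays at rate at least 1 at +oo and 1/4 at -oo. *)
Record kernel_bound (k P : R -> R) (A q : R) : Prop := {
  kb_cont : cont k;
  kb_contP : cont P;
  kb_ge_0 : 0 <= A;
  kb_neg : forall y, y <= 0 -> Rabs (k y) <= A * exp (2 * y);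
  kb_pos : forall y, 0 <= y -> Rabs (k y - P y) <= A * exp (- q * y) }.

(** The entire part of the continuation: [P] is subtracted on the positive half-line only, and its
    transform is continued separately. *)
Definition core (k P : R -> R) (T : R) (s : C) : C :=
  (LI k s (- T) 0 + LI (fun y => k y - P y)%R s 0 T)%C.

Lemma cont_minus k P : cont k -> cont P -> cont (fun y => k y - P y).
Proof. intros H1 H2 y. apply (continuous_minus (V := R_NormedModule)); auto. Qed.

Lemma kb_neg_integrand k P A q (s : C) y : kernel_bound k P A q -> Re s <= 7 / 4 -> y <= 0 ->
  exp (- Re s * y) * Rabs (k y) <= A * exp (1 / 4 * y).
Proof.
  intros K Hs Hy. destruct K as [_ _ HA H _]. specialize (H y Hy).
  apply Rle_trans with (exp (- Re s * y) * (A * exp (2 * y))).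
  - apply Rmult_le_compat_l; trivial. left; apply exp_pos.
  - replace (exp (- Re s * y) * (A * exp (2 * y))) with (A * (exp (- Re s * y) * exp (2 * y))) by ring.
    rewrite <- exp_plus. apply Rmult_le_compat_l; trivial. apply exp_le_mono. nra.
Qed.

Lemma kb_pos_integrand k P A q (s : C) y : kernel_bound k P A q -> 1 - q <= Re s -> 0 <= y ->
  exp (- Re s * y) * Rabs (k y - P y) <= A * exp (- 1 * y).
Proof.
  intros K Hs Hy. destruct K as [_ _ HA _ H]. specialize (H y Hy).
  apply Rle_trans with (exp (- Re s * y) * (A * exp (- q * y))).
  - apply Rmult_le_compat_l; trivial. left; apply exp_pos.
  - replace (exp (- Re s * y) * (A * exp (- q * y))) with (A * (exp (- Re s * y) * exp (- q * y))) by ring.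
    rewrite <- exp_plus. apply Rmult_le_compat_l; trivial. apply exp_le_mono. nra.
Qed.

Lemma Cdiff_core k P T z : cont k -> cont P -> 0 <= T -> Cdiff (core k P T) z.
Proof.
  intros Hk HP HT. apply Cdiff_plus; apply Cdiff_LI; trivial; try lra. apply cont_minus; trivial.
Qed.

(** 5 = 4 + 1, the integrals of exp(y / 4) over y < 0 and of exp(-y) over y > 0. Independence of T
    is the point. *)
Lemma core_bound k P A q T (s : C) : kernel_bound k P A q -> 0 <= T -> 1 - q <= Re s <= 7 / 4 ->
  Cmod (core k P T s) <= 5 * A.
Proof.
  intros K HT Hs. assert (HA := kb_ge_0 _ _ _ _ K).
  assert (Hk := kb_cont _ _ _ _ K). assert (Hm := cont_minus _ _ Hk (kb_contP _ _ _ _ K)).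
  unfold core. eapply Rle_trans; [apply Cmod_triangle|].
  assert (Cmod (LI k s (- T) 0) <= A / (1 / 4) * exp (1 / 4 * 0)).
  { apply Cmod_CInt_exp_pos; try lra. apply LI_integrand_cont; trivial.
    intros y Hy. rewrite Cmod_LI_integrand. eapply kb_neg_integrand; [exact K | lra | lra]. }
  assert (Cmod (LI (fun y => k y - P y) s 0 T) <= A / 1 * exp (- (1) * 0)).
  { apply Cmod_CInt_exp_neg; try lra. apply LI_integrand_cont; trivial.
    intros y Hy. rewrite (Cmod_LI_integrand (fun y => k y - P y)). eapply kb_pos_integrand; [exact K | lra | lra]. }
  rewrite !Rmult_0_r, exp_0 in *. lra.
Qed.

(** Half of each decay rate is spent on the factor y: 16 / (1/8) = 128 on the left and 4 / (1/2) = 8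
    on the right. Uniformity in T lets e tend to 0 independently of the truncation. *)
Lemma core_lipschitz k P A q T (s : C) e : kernel_bound k P A q -> 0 <= T -> 1 - q <= Re s <= 7 / 4 ->
  Cmod (core k P T (s + (0, e)) - core k P T s)%C <= 136 * A * Rabs e.
Proof.
  intros K HT Hs. assert (HA := kb_ge_0 _ _ _ _ K). assert (He := Rabs_pos e).
  assert (Hk := kb_cont _ _ _ _ K). assert (Hm := cont_minus _ _ Hk (kb_contP _ _ _ _ K)).
  unfold core.
  replace (_ - _)%C with ((LI k (s + (0, e)) (- T) 0 - LI k s (- T) 0)
    + (LI (fun y => k y - P y)%R (s + (0, e)) 0 T - LI (fun y => k y - P y)%R s 0 T))%C by ring.
  eapply Rle_trans; [apply Cmod_triangle|].
  unfold LI. rewrite <- !CInt_minus; try lra; try (apply LI_integrand_cont; trivial).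
  replace (136 * A * Rabs e) with (128 * A * Rabs e + 8 * A * Rabs e) by ring.
  apply Rplus_le_compat.
  - eapply Rle_trans; [apply (Cmod_CInt_exp_pos _ (4 / (1 / 4) * A * Rabs e) (1 / 4 / 2)); try lra|].
    + replace (4 / (1 / 4)) with 16 by field. nra.
    + intros y Hy. apply Ccont_minus; apply (LI_integrand_cont k _ (- T) 0 Hk); trivial.
    + intros y Hy. eapply Rle_trans; [apply (Cmod_LI_shift_integrand k s e y A (1 / 4)); try lra|].
      * replace (- (1 / 4) * Rabs y) with (1 / 4 * y) by (rewrite Rabs_left1 by lra; ring).
        eapply kb_neg_integrand; [exact K | lra | lra].
      * replace (- (1 / 4 / 2) * Rabs y) with (1 / 4 / 2 * y) by (rewrite Rabs_left1 by lra; ring). lra.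
    + rewrite Rmult_0_r, exp_0. right; field.
  - eapply Rle_trans; [apply (Cmod_CInt_exp_neg _ (4 / 1 * A * Rabs e) (1 / 2)); try lra|].
    + nra.
    + intros y Hy. apply Ccont_minus; apply (LI_integrand_cont (fun y => k y - P y) _ 0 T Hm); trivial.
    + intros y Hy. eapply Rle_trans; [apply (Cmod_LI_shift_integrand (fun y => k y - P y) s e y A 1); try lra|].
      * rewrite Rabs_pos_eq with (x := y) by lra.
        eapply kb_pos_integrand; [exact K | lra | lra].
      * rewrite (Rabs_pos_eq y) by lra. lra.
    + rewrite Rmult_0_r, exp_0. right; field.
Qed.

(* kB and kK are the integrands of B and K in the variable y = ln u; PB j and PK are the parts of their
   expansions at +oo that produce the poles of the continuation. *)
Definition kB (y : R) : R := / (1 + exp (- 2 * y)).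
Definition PB (j : nat) (y : R) : R := sum_n (fun i => (-1) ^ i * exp (- (2 * INR i) * y)) j.
Definition kK (a y : R) : R := exp y * kappa a (exp y).
Definition PK (y : R) : R := PI * exp y.

(** The exact remainder of the geometric series of ratio -exp(-2 y). *)
Lemma PB_spec j y : kB y - PB j y = (-1) ^ (S j) * exp (- (2 * INR (S j)) * y) * kB y.
Proof.
  unfold kB. assert (H := exp_pos (- 2 * y)).
  induction j as [|j IH].
  - unfold PB. rewrite sum_O, pow_O, pow_1. change (INR 0) with 0. change (INR 1) with 1.
    replace (- (2 * 0) * y) with 0 by ring. replace (- (2 * 1) * y) with (-2 * y) by ring. rewrite exp_0. field. lra.
  - unfold PB in *. rewrite sum_SnR.
    assert (E : exp (- (2 * INR (S (S j))) * y) = exp (- (2 * INR (S j)) * y) * exp (- 2 * y)).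
    { rewrite <- exp_plus. f_equal. rewrite (S_INR (S j)). ring. }
    rewrite E.
    replace ((-1) ^ S (S j)) with (- (-1) ^ S j) by (simpl; ring).
    match type of IH with ?l - ?p = ?r => replace p with (l - r) by lra end.
    field. lra.
Qed.

Lemma kB_pos y : 0 < kB y <= 1.
Proof.
  unfold kB. assert (H := exp_pos (- 2 * y)). split. apply Rinv_0_lt_compat; lra.
  rewrite <- Rinv_1. apply Rinv_le_contravar; lra.
Qed.

Lemma kB_le_exp2 y : kB y <= exp (2 * y).
Proof.
  unfold kB. assert (H := exp_pos (- 2 * y)).
  replace (exp (2 * y)) with (/ exp (- 2 * y)).
  apply Rinv_le_contravar; lra.
  rewrite <- exp_Ropp. f_equal; ring.
Qed.

Lemma cont_of_derive k : (forall y, ex_derive k y) -> cont k.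
Proof. intros H y. apply (ex_derive_continuous (K := R_AbsRing) (V := R_NormedModule)), H. Qed.

Lemma cont_kB : cont kB.
Proof.
  apply cont_of_derive. intros y. unfold kB. auto_derive. generalize (exp_pos (- 2 * y)); lra.
Qed.

Lemma cont_PB j : cont (PB j).
Proof.
  apply cont_of_derive. intros y. unfold PB. apply (ex_derive_sum_n (K := R_AbsRing) (V := R_NormedModule)).
  intros k _. auto_derive; trivial.
Qed.

Lemma kB_kernel_bound j : kernel_bound kB (PB j) 1 (2 * INR (S j)).
Proof.
  split.
  - apply cont_kB.
  - apply cont_PB.
  - lra.
  - intros y _. rewrite Rabs_pos_eq by (generalize (kB_pos y); lra). rewrite Rmult_1_l. apply kB_le_exp2.
  - intros y _. rewrite PB_spec, !Rabs_mult, pow_1_abs, Rmult_1_l, Rmult_1_l.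
    rewrite (Rabs_pos_eq (exp _)) by (left; apply exp_pos). rewrite (Rabs_pos_eq (kB y)) by (generalize (kB_pos y); lra).
    rewrite <- (Rmult_1_r (exp _)) at 2. apply Rmult_le_compat_l. left; apply exp_pos. apply kB_pos.
Qed.

(** * Expansion of kappa in exponentials *)

Lemma kappa_den_pos a u : 0 < a < 1 -> 0 <= u -> 1 - cos (2 * PI * a) <= cosh (2 * PI * u) - cos (2 * PI * a).
Proof.
  intros Ha Hu. assert (H := cosh_ge_1 (2 * PI * u)). assert (HP := PI_RGT_0).
  assert (0 <= 2 * PI * u) by (apply Rmult_le_pos; lra). lra.
Qed.

Lemma one_sub_cos_pos a : 0 < a < 1 -> 0 < 1 - cos (2 * PI * a).
Proof.
  intros Ha. assert (HP := PI_RGT_0).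
  replace (2 * PI * a) with (2 * (PI * a)) by ring. rewrite cos_2a_sin.
  assert (0 < sin (PI * a)) by (apply sin_gt_0; nra). nra.
Qed.

Lemma cont_kK a : 0 < a < 1 -> cont (kK a).
Proof.
  intros Ha. apply cont_of_derive. intros y. unfold kK, kappa, cosh, sinh. auto_derive.
  repeat split. assert (H1 := one_sub_cos_pos a Ha). assert (H2 := kappa_den_pos a (exp y) Ha).
  unfold cosh in H2. assert (0 <= exp y) by (left; apply exp_pos).
  apply Rgt_not_eq. unfold Rdiv in H2. lra.
Qed.

(* With q = exp(-2 pi u) and z = q exp(2 pi i a), kappa = pi + 2 pi Re (z / (1 - z)); this is the remainder
   Re (z^(N+1) / (1 - z)) of the geometric series. *)
Definition geom_rem (a u : R) (N : nat) : R :=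
  exp (- (2 * PI * u)) ^ S N * (cos (INR (S N) * (2 * PI * a)) - exp (- (2 * PI * u)) * cos (INR N * (2 * PI * a)))
  / (1 - 2 * exp (- (2 * PI * u)) * cos (2 * PI * a) + exp (- (2 * PI * u)) ^ 2).

(** The right-hand side is |1 - z|^2 for z = t exp(2 pi i a). With cos(2 pi a) = 1 - 2 e it equals e
    (1 + t)^2 + (1 - e)(1 - t)^2, hence is at least e. *)
Lemma geom_den_pos a u : 0 < a < 1 -> 0 <= u ->
  (1 - cos (2 * PI * a)) / 2 <= 1 - 2 * exp (- (2 * PI * u)) * cos (2 * PI * a) + exp (- (2 * PI * u)) ^ 2.
Proof.
  intros Ha Hu. assert (H1 := one_sub_cos_pos a Ha). assert (HP := PI_RGT_0).
  assert (H2 := exp_pos (- (2 * PI * u))).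
  assert (H3 : exp (- (2 * PI * u)) <= 1).
  { rewrite <- exp_0. apply exp_le_mono. assert (0 <= 2 * PI * u) by (apply Rmult_le_pos; lra). lra. }
  assert (H4 := COS_bound (2 * PI * a)).
  set (t := exp (- (2 * PI * u))) in *. set (e := (1 - cos (2 * PI * a)) / 2) in *.
  replace (cos (2 * PI * a)) with (1 - 2 * e) by (unfold e; field).
  assert (0 < e <= 1) by (unfold e; lra).
  replace (1 - 2 * t * (1 - 2 * e) + t ^ 2) with (e * (1 + t) ^ 2 + (1 - e) * (1 - t) ^ 2) by ring.
  assert (0 <= (1 - e) * (1 - t) ^ 2) by (apply Rmult_le_pos; [lra | apply pow2_ge_0]). nra.
Qed.

(** The real part of z^(N+1) / (1 - z) = z^(N+1) + z^(N+2) / (1 - z); the three-term recurrence of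
    cos replaces complex arithmetic. *)
Lemma geom_rem_step a u N : 0 < a < 1 -> 0 <= u ->
  geom_rem a u N = cos (INR (S N) * (2 * PI * a)) * exp (- (2 * PI * u)) ^ S N + geom_rem a u (S N).
Proof.
  intros Ha Hu. assert (D1 := geom_den_pos a u Ha Hu). assert (D2 := one_sub_cos_pos a Ha).
  unfold geom_rem. set (t := exp (- (2 * PI * u))) in *. set (x := 2 * PI * a) in *.
  assert (E : cos (INR (S (S N)) * x) = 2 * cos x * cos (INR (S N) * x) - cos (INR N * x)).
  { replace (INR (S (S N)) * x) with (INR (S N) * x + x) by (rewrite (S_INR (S N)); ring).
    replace (INR N * x) with (INR (S N) * x - x) by (rewrite S_INR; ring).
    rewrite cos_plus, cos_minus. ring. }
  rewrite E. simpl (t ^ S (S N)). change (t * (t * t ^ N)) with (t * t ^ S N). field. lra.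
Qed.

Lemma kappa_geom_rem_0 a u : 0 < a < 1 -> 0 <= u -> kappa a u = PI + 2 * PI * geom_rem a u 0.
Proof.
  intros Ha Hu. assert (D1 := geom_den_pos a u Ha Hu). assert (D2 := one_sub_cos_pos a Ha).
  unfold geom_rem, kappa, sinh, cosh.
  assert (D3 := kappa_den_pos a u Ha Hu). unfold cosh in D3.
  simpl INR. rewrite !Rmult_1_l, Rmult_0_l, cos_0.
  set (v := 2 * PI * u) in *. set (w := 2 * PI * a) in *.
  assert (E : exp v = / exp (- v)) by (rewrite <- exp_Ropp; f_equal; ring).
  assert (H := exp_pos (- v)). rewrite E in *. set (t := exp (- v)) in *.
  set (c := cos w) in *.
  replace ((/ t + t) / 2 - c) with ((1 - 2 * t * c + t ^ 2) / (2 * t)) by (field; lra).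
  set (D := 1 - 2 * t * c + t ^ 2) in *.
  replace (PI * ((/ t - t) / 2) / (D / (2 * t))) with (PI * (1 - t ^ 2) / D) by (field; lra).
  replace (1 - t ^ 2) with (D + 2 * t * (c - t)) by (unfold D; ring). field. lra.
Qed.

Lemma kappa_geom a u N : 0 < a < 1 -> 0 <= u ->
  kappa a u = PI + 2 * PI * (sum_n (fun l => cos (INR (S l) * (2 * PI * a)) * exp (- (2 * PI * u)) ^ S l) N
                             + geom_rem a u (S N)).
Proof.
  intros Ha Hu.
  induction N as [|N IH].
  - rewrite sum_O, <- geom_rem_step by trivial. apply kappa_geom_rem_0; trivial.
  - rewrite sum_SnR, IH, (geom_rem_step a u (S N)) by trivial. ring.
Qed.

Lemma geom_rem_bound a u N : 0 < a < 1 -> 0 <= u ->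
  Rabs (geom_rem a u N) <= 4 / (1 - cos (2 * PI * a)) * exp (- (2 * PI * u)) ^ S N.
Proof.
  intros Ha Hu. assert (D1 := geom_den_pos a u Ha Hu). assert (D2 := one_sub_cos_pos a Ha).
  assert (HP := PI_RGT_0). assert (H2 := exp_pos (- (2 * PI * u))).
  assert (H3 : exp (- (2 * PI * u)) <= 1).
  { rewrite <- exp_0. apply exp_le_mono. assert (0 <= 2 * PI * u) by (apply Rmult_le_pos; lra). lra. }
  unfold geom_rem. set (t := exp (- (2 * PI * u))) in *. set (D := 1 - 2 * t * cos (2 * PI * a) + t ^ 2) in *.
  set (d := 1 - cos (2 * PI * a)) in *.
  assert (Ht : 0 < t ^ S N) by (apply pow_lt; trivial).
  unfold Rdiv at 1. rewrite !Rabs_mult, Rabs_inv, (Rabs_pos_eq D), (Rabs_pos_eq (t ^ S N)) by lra.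
  assert (Hn : Rabs (cos (INR (S N) * (2 * PI * a)) - t * cos (INR N * (2 * PI * a))) <= 2).
  { assert (C1 := COS_bound (INR (S N) * (2 * PI * a))). assert (C2 := COS_bound (INR N * (2 * PI * a))).
    apply Rabs_le. nra. }
  assert (HD : / D <= / (d / 2)) by (apply Rinv_le_contravar; lra).
  replace (4 / d * t ^ S N) with (t ^ S N * 2 * / (d / 2)) by (field; lra).
  apply Rmult_le_compat; trivial.
  - apply Rmult_le_pos; [lra | apply Rabs_pos].
  - left; apply Rinv_0_lt_compat; lra.
  - apply Rmult_le_compat_l; lra.
Qed.

Lemma exp_pow t n : exp t ^ n = exp (t * INR n).
Proof.
  induction n as [|n IH]. simpl. rewrite Rmult_0_r, exp_0; trivial.
  rewrite S_INR. simpl. rewrite IH, <- exp_plus. f_equal; ring.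
Qed.

Lemma exp_ge_pow_fact n u : 0 <= u -> u ^ n / INR (Factorial.fact n) <= exp u.
Proof.
  revert u. induction n as [|n IH]; intros u Hu.
  - simpl. rewrite Rdiv_1_r, <- exp_0. apply exp_le_mono; trivial.
  - assert (Hf := INR_fact_lt_0 n). assert (Hn := pos_INR n).
    assert (E : INR (Factorial.fact (S n)) = (INR n + 1) * INR (Factorial.fact n))
      by (rewrite fact_simpl, mult_INR, S_INR; ring).
    rewrite E. set (F := INR (Factorial.fact n)) in *.
    assert (exp 0 - 0 ^ S n / ((INR n + 1) * F) <= exp u - u ^ S n / ((INR n + 1) * F)).
    { apply (increment_ge_0 (fun y => exp y - y ^ S n / ((INR n + 1) * F)) (fun y => exp y - y ^ n / F)); trivial.
      - intros y. auto_derive; trivial. change (pred (S n)) with n. rewrite <- (S_INR n) at 1.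
        change (match n with 0%nat => 1 | S _ => INR n + 1 end) with (INR (S n)). rewrite S_INR. field. lra.
      - intros y Hy. specialize (IH y). lra. }
    rewrite pow_i, exp_0 in H by lia. unfold Rdiv at 1 in H. rewrite Rmult_0_l in H. lra.
Qed.

(** * Analytic continuation of the truncated integrals *)

Lemma sinh_le_mul_exp v : 0 <= v -> sinh v <= v * exp v.
Proof.
  intros Hv. unfold sinh. assert (H1 := exp_ineq1_le (- v)).
  assert (H2 : exp v * exp (- v) = 1) by (rewrite <- exp_plus, Rplus_opp_r; apply exp_0).
  assert (H3 : 1 <= exp v) by (rewrite <- exp_0; apply exp_le_mono; trivial).
  assert (exp v * (1 - v) <= 1) by (rewrite <- H2; apply Rmult_le_compat_l; lra).
  assert (v <= v * exp v) by nra. lra.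
Qed.

(** kappa(u) = O(u) at 0, and kappa - pi is exponentially small at infinity, so any rate q is
    allowed. The factorial of q + 1 comes from exp u >= u^(q+1) / (q+1)!; the extra power pays for
    the factor exp y in [kK]. *)
Lemma kK_kernel_bound a q : 0 < a < 1 -> exists A, kernel_bound (kK a) PK A (INR q).
Proof.
  intros Ha. assert (HP := PI_RGT_0). assert (Hd := one_sub_cos_pos a Ha).
  set (d := 1 - cos (2 * PI * a)) in *.
  set (A1 := PI * (2 * PI) * exp (2 * PI) / d).
  set (A2 := 2 * PI * (4 / d) * INR (Factorial.fact (S q))).
  assert (He := exp_pos (2 * PI)). assert (Hf := INR_fact_lt_0 (S q)).
  assert (HA1 : 0 <= A1). { left. unfold A1. apply Rdiv_lt_0_compat; trivial. apply Rmult_lt_0_compat; trivial. nra. }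
  assert (HA2 : 0 <= A2). { left. unfold A2. assert (0 < 4 / d) by (apply Rdiv_lt_0_compat; lra).
    apply Rmult_lt_0_compat; trivial. apply Rmult_lt_0_compat; lra. }
  exists (A1 + A2). split.
  - apply cont_kK; trivial.
  - apply cont_of_derive. intros y. unfold PK. auto_derive; trivial.
  - lra.
  - intros y Hy. unfold kK. set (u := exp y).
    assert (Hu : 0 < u <= 1). { split. apply exp_pos. unfold u. rewrite <- exp_0. apply exp_le_mono; trivial. }
    assert (E : exp (2 * y) = u * u). { unfold u. rewrite <- exp_plus. f_equal; ring. }
    rewrite E.
    assert (Hv : 0 <= 2 * PI * u) by nra.
    assert (S1 := sinh_ge_0 _ Hv). assert (S2 := sinh_le_mul_exp _ Hv).
    assert (S3 : exp (2 * PI * u) <= exp (2 * PI)) by (apply exp_le_mono; nra).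
    assert (D := kappa_den_pos a u Ha ltac:(lra)). fold d in D.
    set (den := cosh (2 * PI * u) - cos (2 * PI * a)) in *.
    assert (K1 : 0 <= kappa a u <= A1 * u).
    { unfold kappa. fold den. split.
      - apply Rmult_le_pos. apply Rmult_le_pos; lra. left; apply Rinv_0_lt_compat; lra.
      - replace (A1 * u) with (PI * (2 * PI * u * exp (2 * PI)) * / d) by (unfold A1; field; lra).
        apply Rmult_le_compat.
        + apply Rmult_le_pos; lra.
        + left; apply Rinv_0_lt_compat; lra.
        + apply Rmult_le_compat_l. lra. apply Rle_trans with (1 := S2). apply Rmult_le_compat_l; lra.
        + apply Rinv_le_contravar; lra. }
    rewrite Rabs_mult, !Rabs_pos_eq by lra.
    replace ((A1 + A2) * (u * u)) with (u * (A1 * u) + A2 * (u * u)) by ring.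
    assert (0 <= A2 * (u * u)) by (apply Rmult_le_pos; nra).
    assert (u * kappa a u <= u * (A1 * u)) by (apply Rmult_le_compat_l; lra). lra.
  - intros y Hy. unfold kK, PK. set (u := exp y).
    assert (Hu : 1 <= u). { unfold u. rewrite <- exp_0. apply exp_le_mono; trivial. }
    rewrite (kappa_geom_rem_0 a u) by lra.
    replace (u * (PI + 2 * PI * geom_rem a u 0) - PI * u) with (u * (2 * PI) * geom_rem a u 0) by ring.
    rewrite Rabs_mult, (Rabs_pos_eq (u * (2 * PI))) by nra.
    assert (G := geom_rem_bound a u 0 Ha ltac:(lra)). fold d in G. rewrite pow_1 in G.
    assert (X : exp (- (2 * PI * u)) <= INR (Factorial.fact (S q)) * / u ^ S q).
    { assert (Hup : 0 < u ^ S q) by (apply pow_lt; lra).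
      rewrite exp_Ropp.
      replace (INR (Factorial.fact (S q)) * / u ^ S q) with (/ (u ^ S q / INR (Factorial.fact (S q)))) by (field; lra).
      apply Rinv_le_contravar. apply Rdiv_lt_0_compat; lra.
      apply Rle_trans with (exp u). apply exp_ge_pow_fact; lra.
      apply exp_le_mono. assert (1 <= 2 * PI) by (generalize PI2_3_2; lra). nra. }
    assert (E : exp (- INR q * y) = / u ^ q).
    { unfold u. rewrite exp_pow, <- exp_Ropp. f_equal; ring. }
    rewrite E.
    assert (H4 : 0 < 4 / d) by (apply Rdiv_lt_0_compat; lra).
    apply Rle_trans with (u * (2 * PI) * (4 / d * (INR (Factorial.fact (S q)) * / u ^ S q))).
    { apply Rmult_le_compat_l. nra. apply Rle_trans with (1 := G). apply Rmult_le_compat_l; lra. }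
    assert (Huq : 0 < u ^ q) by (apply pow_lt; lra).
    replace (u * (2 * PI) * (4 / d * (INR (Factorial.fact (S q)) * / u ^ S q))) with (A2 * / u ^ q).
    2: { unfold A2. change (u ^ S q) with (u * u ^ q). field. repeat split; lra. }
    apply Rmult_le_compat_r. left; apply Rinv_0_lt_compat; trivial. lra.
Qed.

Lemma CInt_cexp_lin (w : C) T : 0 <= T -> w <> 0%C ->
  CInt (fun y => cexp (- (w * RtoC y)))%C 0 T = ((1 - cexp (- (w * RtoC T))) / w)%C.
Proof.
  intros HT Hw.
  (* After multiplication by w, both components are derivatives of elementary functions. *)
  assert (E : (w * CInt (fun y => cexp (- (w * RtoC y))) 0 T)%C = (1 - cexp (- (w * RtoC T)))%C).
  { rewrite <- CInt_scal; trivial. 2: intros y _; apply Ccont_cexp_lin.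
    destruct w as [p q].
    assert (G : forall F f : R -> R, (forall y, is_derive F y (f y)) -> cont f -> RInt f 0 T = F T - F 0).
    { intros F f H1 H2. apply is_RInt_unique. apply (is_RInt_derive (V := R_CompleteNormedModule) F); auto. }
    assert (E1 : forall y, ((p, q) * cexp (- ((p, q) * RtoC y)))%C =
      (exp (- (p * y)) * (p * cos (q * y) + q * sin (q * y)), exp (- (p * y)) * (q * cos (q * y) - p * sin (q * y)))).
    { intros y. unfold cexp, RtoC, Re, Im, Cmult, Copp; simpl.
      replace (- (p * y - q * 0)) with (- (p * y)) by ring. replace (- (p * 0 + q * y)) with (- (q * y)) by ring.
      rewrite cos_neg, sin_neg. apply f_equal2; ring. }
    rewrite (CInt_ext _ (fun y => (exp (- (p * y)) * (p * cos (q * y) + q * sin (q * y)), exp (- (p * y)) * (q * cos (q * y) - p * sin (q * y)))))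
      by (trivial; intros; apply E1).
    unfold CInt, Re, Im; simpl.
    rewrite (G (fun y => - (exp (- (p * y)) * cos (q * y)))).
    2: intros y; auto_derive; trivial; ring.
    2: apply cont_of_derive; intros y; auto_derive; trivial.
    rewrite (G (fun y => exp (- (p * y)) * sin (q * y))).
    2: intros y; auto_derive; trivial; ring.
    2: apply cont_of_derive; intros y; auto_derive; trivial.
    unfold cexp, RtoC, Re, Im, Cmult, Cminus, Cplus, Copp; simpl.
    replace (- (p * T - q * 0)) with (- (p * T)) by ring. replace (- (p * 0 + q * T)) with (- (q * T)) by ring.
    rewrite !Rmult_0_r, Ropp_0, exp_0, cos_0, sin_0, cos_neg, sin_neg. apply f_equal2; ring. }
  unfold Cdiv. rewrite <- E. field. trivial.
Qed.

Lemma neq_0_of_Im (z : C) : 0 < Im z -> z <> 0%C.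
Proof. intros H E. rewrite E in H. unfold Im in H; simpl in H; lra. Qed.

Lemma neq_0_of_Re (z : C) : 0 < Re z -> z <> 0%C.
Proof. intros H E. rewrite E in H. unfold Re in H; simpl in H; lra. Qed.

Lemma Cmod_inv_le_Im (z : C) eta : 0 < eta <= Im z -> Cmod (/ z) <= / eta.
Proof.
  intros H. rewrite Cmod_inv by (apply neq_0_of_Im; lra).
  apply Rinv_le_contravar; [lra|]. apply Rle_trans with (Im z); [lra|].
  eapply Rle_trans; [apply Rle_abs | apply Im_le_Cmod].
Qed.

(** 3/4 = 7/4 - 1 is the margin on the line Re s = 7/4 in the worst case la = -1, that of [PK],
    which grows like exp y. *)
Lemma LI_exp_tail (c la : R) (s : C) T : 0 <= T -> 3 / 4 <= Re s + la ->
  Cmod (LI (fun y => c * exp (- la * y))%R s 0 T - RtoC c / (s + RtoC la))%C <= Rabs c * (4 / 3) * exp (- (3 / 4) * T).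
Proof.
  intros HT Hs.
  assert (Hre : Re (s + RtoC la)%C = Re s + la) by reflexivity.
  assert (Hne : (s + RtoC la)%C <> 0%C) by (apply neq_0_of_Re; lra).
  assert (E : LI (fun y => c * exp (- la * y))%R s 0 T = (RtoC c * ((1 - cexp (- ((s + RtoC la) * RtoC T))) / (s + RtoC la)))%C).
  { rewrite <- CInt_cexp_lin, <- CInt_scal; trivial. 2: intros y _; apply Ccont_cexp_lin.
    apply CInt_ext; trivial. intros y _.
    replace (- ((s + RtoC la) * RtoC y))%C with (- (s * RtoC y) + RtoC (- la * y))%C by (rewrite RtoC_mult, RtoC_opp; ring).
    rewrite cexp_plus.
    replace (cexp (RtoC (- la * y))) with (RtoC (exp (- la * y))).
    rewrite RtoC_mult. ring.
    unfold cexp, RtoC, Re, Im; simpl. rewrite cos_0, sin_0. apply f_equal2; ring. }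
  rewrite E.
  replace (_ - _)%C with (- (RtoC c * (cexp (- ((s + RtoC la) * RtoC T)) * / (s + RtoC la))))%C by (field; trivial).
  rewrite Cmod_opp, !Cmod_mult, Cmod_R, Cmod_cexp, Re_neg_mul, Cmod_inv, Hre by trivial.
  rewrite Rmult_assoc. apply Rmult_le_compat_l. apply Rabs_pos.
  rewrite Rmult_comm. apply Rmult_le_compat.
  - left; apply Rinv_0_lt_compat, Cmod_gt_0; trivial.
  - left; apply exp_pos.
  - replace (4 / 3) with (/ (3 / 4)) by field. apply Rinv_le_contravar; [lra|].
    apply Rle_trans with (Re s + la); [lra|]. rewrite <- Hre. eapply Rle_trans; [apply Rle_abs | apply re_le_Cmod].
  - apply exp_le_mono. nra.
Qed.

(* Phat is the analytic continuation of the Laplace transform of P over the positive half-line. *)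
Record laplace_cont (P : R -> R) (Phat : C -> C) : Prop := {
  lc_diff : forall z, 0 < Im z -> Cdiff Phat z;
  lc_bound : forall eta, 0 < eta -> exists B, forall z, eta <= Im z -> Cmod (Phat z) <= B;
  lc_tail : exists B, 0 <= B /\ forall s T, 0 <= T -> Re s = 7 / 4 -> Cmod (LI P s 0 T - Phat s)%C <= B * exp (- (3 / 4) * T) }.

Lemma laplace_cont_exp c la : - 1 <= la -> laplace_cont (fun y => c * exp (- la * y)) (fun s => RtoC c / (s + RtoC la))%C.
Proof.
  intros Hla.
  assert (Him : forall s, Im (s + RtoC la)%C = Im s) by (intros s; unfold Im; simpl; ring).
  split.
  - intros z Hz. apply Cdiff_mult. apply Cdiff_const. apply Cdiff_inv.
    + apply Cdiff_plus. apply Cdiff_id. apply Cdiff_const.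
    + apply neq_0_of_Im. rewrite Him; trivial.
  - intros eta Heta. exists (Rabs c * / eta). intros z Hz. unfold Cdiv. rewrite Cmod_mult, Cmod_R.
    apply Rmult_le_compat_l. apply Rabs_pos. apply Cmod_inv_le_Im. rewrite Him. lra.
  - exists (Rabs c * (4 / 3)). split. { generalize (Rabs_pos c); lra. }
    intros s T HT Hs. apply LI_exp_tail; trivial. lra.
Qed.

Lemma laplace_cont_plus P1 P2 h1 h2 : cont P1 -> cont P2 -> laplace_cont P1 h1 -> laplace_cont P2 h2 ->
  laplace_cont (fun y => P1 y + P2 y) (fun s => h1 s + h2 s)%C.
Proof.
  intros C1 C2 [A1 B1 [D1 [D1' E1]]] [A2 B2 [D2 [D2' E2]]]. split.
  - intros z Hz. apply Cdiff_plus; auto.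
  - intros eta Heta. destruct (B1 eta Heta) as [M1 H1], (B2 eta Heta) as [M2 H2].
    exists (M1 + M2). intros z Hz. eapply Rle_trans; [apply Cmod_triangle|]. specialize (H1 z Hz); specialize (H2 z Hz); lra.
  - exists (D1 + D2). split. lra. intros s T HT Hs. rewrite LI_plus; trivial.
    replace (_ - _)%C with ((LI P1 s 0 T - h1 s) + (LI P2 s 0 T - h2 s))%C by ring.
    eapply Rle_trans; [apply Cmod_triangle|]. specialize (E1 s T HT Hs); specialize (E2 s T HT Hs); lra.
Qed.

(** The transform of [PB j], one simple pole for each exponential: 0, -2, ..., -2j. *)
Fixpoint hatB (j : nat) (s : C) : C :=
  match j with
  | O => (RtoC 1 / (s + RtoC 0))%C
  | S i => (hatB i s + RtoC ((-1) ^ j) / (s + RtoC (2 * INR j)))%C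
  end.

Definition hatK (s : C) : C := (RtoC PI / (s + RtoC (-1)))%C.

Lemma laplace_cont_ext P1 P2 h1 h2 : (forall y, P1 y = P2 y) -> (forall s, h1 s = h2 s) ->
  laplace_cont P1 h1 -> laplace_cont P2 h2.
Proof.
  intros HP Hh [A1 B1 [D1 [D1' E1]]]. split.
  - intros z Hz. apply (Cdiff_ext h1); auto.
  - intros eta Heta. destruct (B1 eta Heta) as [M HM]. exists M. intros z Hz. rewrite <- Hh. auto.
  - exists D1. split; trivial. intros s T HT Hs. rewrite <- Hh. unfold LI.
    rewrite (CInt_ext _ (fun y => cexp (- (s * RtoC y)) * RtoC (P1 y))%C); trivial. apply E1; trivial.
    intros y _. rewrite HP. reflexivity.
Qed.

Lemma laplace_cont_B j : laplace_cont (PB j) (hatB j).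
Proof.
  induction j as [|j IH].
  - apply (laplace_cont_ext (fun y => 1 * exp (- 0 * y)) _ (fun s => RtoC 1 / (s + RtoC 0))%C).
    + intros y. unfold PB. rewrite sum_O, pow_O. f_equal. f_equal. change (INR 0) with 0. ring.
    + reflexivity.
    + apply laplace_cont_exp. lra.
  - apply (laplace_cont_ext (fun y => PB j y + (-1) ^ S j * exp (- (2 * INR (S j)) * y)) _
      (fun s => hatB j s + RtoC ((-1) ^ S j) / (s + RtoC (2 * INR (S j))))%C).
    + intros y. unfold PB. rewrite sum_SnR. reflexivity.
    + reflexivity.
    + apply laplace_cont_plus; trivial. apply cont_PB.
      apply cont_of_derive; intros y; auto_derive; trivial.
      apply laplace_cont_exp. generalize (pos_INR (S j)); lra.
Qed.

Lemma laplace_cont_K : laplace_cont PK hatK.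
Proof.
  apply (laplace_cont_ext (fun y => PI * exp (- (-1) * y)) _ (fun s => RtoC PI / (s + RtoC (-1)))%C).
  - intros y. unfold PK. do 2 f_equal. ring.
  - reflexivity.
  - apply laplace_cont_exp. lra.
Qed.

(** On this line [Phat] is still the convergent transform of P, so adding it to [core] restores the
    plain truncated integral up to the tail beyond T. *)
Lemma core_line k P Phat A q : kernel_bound k P A q -> laplace_cont P Phat ->
  exists B, 0 <= B /\ forall s T, 0 <= T -> Re s = 7 / 4 ->
    Cmod (LI k s (- T) T - (core k P T s + Phat s))%C <= B * exp (- (3 / 4) * T).
Proof.
  intros K [_ _ [B [HB H]]]. exists B. split; trivial. intros s T HT Hs.
  assert (Hk := kb_cont _ _ _ _ K). assert (HP := kb_contP _ _ _ _ K).
  rewrite <- (LI_Chasles k s (- T) 0 T) by (trivial; lra). unfold core.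
  rewrite (LI_minus k P s 0 T) by trivial.
  replace (_ - _)%C with (LI P s 0 T - Phat s)%C by ring. apply H; trivial.
Qed.

(** * Complex series, partial sums and tails *)

Notation Csum f n := (@sum_n C_AbelianGroup f n) (only parsing).

Lemma CsumS (f : nat -> C) n : Csum f (S n) = (Csum f n + f (S n))%C.
Proof. exact (@sum_Sn C_AbelianGroup f n). Qed.

(** Closeness in C is componentwise in this uniform structure, hence eps / 2 in the passage to
    [Cmod]. *)
Lemma is_series_C (f : nat -> C) (l : C) :
  @is_series C_AbsRing C_NormedModule f l <->
  forall eps, 0 < eps -> exists N, forall n, (N <= n)%nat -> Cmod (Csum f n - l)%C <= eps.
Proof.
  split.
  - intros H eps Heps.
    assert (H2 := proj1 (filterlim_locally (F := eventually) _ l) H (mkposreal (eps / 2) ltac:(lra))).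
    destruct H2 as [N HN]. exists N. intros n Hn. specialize (HN n Hn).
    destruct HN as [H3 H4].
    eapply Rle_trans; [apply Cmod_le_Rabs_sum|].
    change (Rabs (Re (Csum f n) - Re l) < eps / 2) in H3. change (Rabs (Im (Csum f n) - Im l) < eps / 2) in H4.
    change (Rabs (Re (Csum f n) - Re l) + Rabs (Im (Csum f n) - Im l) <= eps). lra.
  - intros H. apply filterlim_locally. intros eps.
    destruct (H (eps / 2)) as [N HN]. { generalize (cond_pos eps); lra. }
    exists N. intros n Hn. specialize (HN n Hn). assert (He := cond_pos eps).
    split.
    + change (Rabs (Re (Csum f n - l)%C) < eps). eapply Rle_lt_trans; [apply re_le_Cmod | lra].
    + change (Rabs (Im (Csum f n - l)%C) < eps). eapply Rle_lt_trans; [apply Im_le_Cmod | lra].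
Qed.

Lemma Re_Csum (f : nat -> C) n : Re (Csum f n) = sum_n (fun k => Re (f k)) n.
Proof.
  induction n as [|n IH]. rewrite !sum_O; reflexivity.
  rewrite CsumS, sum_SnR, <- IH. reflexivity.
Qed.

Lemma is_series_R_eps (f : nat -> R) (l : R) : is_series f l ->
  forall eps, 0 < eps -> exists N, forall n, (N <= n)%nat -> Rabs (sum_n f n - l) <= eps.
Proof.
  intros H eps Heps.
  destruct (proj1 (filterlim_locally (F := eventually) _ l) H (mkposreal eps Heps)) as [N HN].
  exists N. intros n Hn. left. exact (HN n Hn).
Qed.

Lemma is_series_Re (f : nat -> C) (l : C) : @is_series C_AbsRing C_NormedModule f l ->
  is_series (fun k => Re (f k)) (Re l).
Proof.
  intros H. rewrite is_series_C in H.
  apply filterlim_locally. intros eps. assert (He := cond_pos eps).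
  destruct (H (eps / 2)) as [N HN]; [lra|]. exists N. intros n Hn. specialize (HN n Hn).
  change (Rabs (sum_n (fun k => Re (f k)) n - Re l) < eps). rewrite <- Re_Csum.
  change (Rabs (Re (Csum f n - l)%C) < eps). eapply Rle_lt_trans; [apply re_le_Cmod | lra].
Qed.

Lemma sum_n_le_series (w : nat -> R) (W : R) n : is_series w W -> (forall k, 0 <= w k) -> sum_n w n <= W.
Proof.
  intros H Hw. apply le_epsilon. intros e He. destruct (is_series_R_eps w W H e He) as [N HN].
  assert (M : forall m, sum_n w n <= sum_n w (n + m)%nat).
  { induction m as [|m IH]. rewrite Nat.add_0_r; lra. rewrite Nat.add_succ_r, sum_SnR. specialize (Hw (S (n + m))). lra. }
  specialize (M N). specialize (HN (n + N)%nat ltac:(lia)). apply Rabs_le_between in HN. lra.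
Qed.

Lemma Csum_tail_bound (f : nat -> C) (l : C) (w : nat -> R) (W : R) n :
  @is_series C_AbsRing C_NormedModule f l -> is_series w W -> (forall k, Cmod (f k) <= w k) ->
  Cmod (l - Csum f n)%C <= W - sum_n w n.
Proof.
  intros Hf HW Hfw.
  assert (Hw : forall k, 0 <= w k) by (intros k; eapply Rle_trans; [apply Cmod_ge_0 | apply Hfw]).
  apply le_epsilon. intros e He.
  rewrite is_series_C in Hf. destruct (Hf e He) as [N HN].
  assert (M : forall m, Cmod (Csum f (n + m) - Csum f n)%C <= sum_n w (n + m)%nat - sum_n w n).
  { induction m as [|m IH].
    - rewrite Nat.add_0_r. unfold Rminus. rewrite Rplus_opp_r.
      replace (Csum f n - Csum f n)%C with (RtoC 0) by ring. rewrite Cmod_0; lra.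
    - rewrite Nat.add_succ_r, sum_SnR, CsumS. specialize (Hfw (S (n + m))).
      replace (_ - _)%C with ((Csum f (n + m) - Csum f n) + f (S (n + m)))%C by ring.
      eapply Rle_trans; [apply Cmod_triangle|]. lra. }
  specialize (M N). specialize (HN (n + N)%nat ltac:(lia)).
  replace (l - Csum f n)%C with (- (Csum f (n + N) - l) + (Csum f (n + N) - Csum f n))%C by ring.
  eapply Rle_trans; [apply Cmod_triangle|]. rewrite Cmod_opp.
  assert (H1 := sum_n_le_series w W (n + N) HW Hw). lra.
Qed.

Lemma exp_decay B d eps : 0 <= B -> 0 < d -> 0 < eps -> exists T0, 0 <= T0 /\ forall T, T0 <= T -> B * exp (- d * T) <= eps.
Proof.
  intros HB Hd He. exists (B / eps / d). split.
  { unfold Rdiv. repeat apply Rmult_le_pos; trivial; left; apply Rinv_0_lt_compat; trivial. }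
  intros T HT. assert (H1 := exp_ineq1_le (d * T)).
  assert (H2 : B / eps <= d * T).
  { replace (B / eps) with (d * (B / eps / d)) by (field; lra). apply Rmult_le_compat_l; lra. }
  replace (- d * T) with (- (d * T)) by ring. rewrite exp_Ropp.
  assert (H3 := exp_pos (d * T)).
  apply (Rmult_le_reg_r (exp (d * T))); trivial. rewrite Rmult_assoc, Rinv_l, Rmult_1_r by lra.
  replace B with (eps * (B / eps)) by (field; lra). apply Rmult_le_compat_l; lra.
Qed.

(** * Laplace integrals of translates of [kB] *)

Lemma kB_le_exp th y : 0 <= th <= 2 -> kB y <= exp (th * y).
Proof.
  intros Hth. destruct (Rle_lt_dec 0 y) as [H | H].
  - apply Rle_trans with 1. apply kB_pos. rewrite <- exp_0. apply exp_le_mono. nra.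
  - eapply Rle_trans; [apply kB_le_exp2|]. apply exp_le_mono. nra.
Qed.

(** Dilation by c becomes translation by ln c, which the Laplace integral turns into the factor
    c^(-s) of the Dirichlet series. *)
Lemma poisson_kB c y : 0 < c -> exp y * poisson c (exp y) = kB (y - ln c).
Proof.
  intros Hc. unfold poisson, kB.
  replace (exp (-2 * (y - ln c))) with (c ^ 2 / exp y ^ 2).
  2: { rewrite <- (exp_ln c) at 1 by trivial. rewrite !exp_pow. unfold Rdiv. rewrite <- exp_Ropp, <- exp_plus. f_equal. simpl INR. ring. }
  assert (H := exp_pos y). assert (0 < c ^ 2) by (apply pow_lt; trivial). assert (0 < exp y ^ 2) by (apply pow_lt; trivial).
  field. split; lra.
Qed.

(** The two missing ends are bounded with kB <= exp(2 y) on the left and kB <= 1 on the right, and 4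
    + 4/7 <= 5. The left end decays only at rate 2 - 7/4 = 1/4. *)
Lemma LI_kB_extend (s : C) (L T al be : R) : Re s = 7 / 4 -> 0 <= L <= T ->
  - T - L <= al <= - T + L -> T - L <= be <= T + L ->
  Cmod (LI kB s (- T - L) (T + L) - LI kB s al be)%C <= 5 * exp (L / 4) * exp (- (1 / 4) * T).
Proof.
  intros Hs HL Hal Hbe.
  assert (Hc : forall a b, Ccont_on (fun y => cexp (- (s * RtoC y)) * RtoC (kB y))%C a b).
  { intros a b. apply LI_integrand_cont, cont_kB. }
  rewrite <- (LI_Chasles kB s (- T - L) al (T + L)), <- (LI_Chasles kB s al be (T + L)); try lra; try apply cont_kB.
  replace (_ - _)%C with (LI kB s (- T - L) al + LI kB s be (T + L))%C by ring.
  eapply Rle_trans; [apply Cmod_triangle|].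
  assert (B1 : Cmod (LI kB s (- T - L) al) <= 1 / (1 / 4) * exp (1 / 4 * al)).
  { apply Cmod_CInt_exp_pos; trivial; try lra. intros y Hy.
    rewrite (Cmod_LI_integrand kB), Hs, Rabs_pos_eq by (generalize (kB_pos y); lra). rewrite Rmult_1_l.
    replace (1 / 4 * y) with (- (7 / 4) * y + 2 * y) by field. rewrite exp_plus.
    apply Rmult_le_compat_l. left; apply exp_pos. apply kB_le_exp2. }
  assert (B2 : Cmod (LI kB s be (T + L)) <= 1 / (7 / 4) * exp (- (7 / 4) * be)).
  { apply Cmod_CInt_exp_neg; trivial; try lra. intros y Hy.
    rewrite (Cmod_LI_integrand kB), Hs, Rabs_pos_eq by (generalize (kB_pos y); lra). rewrite Rmult_1_l.
    rewrite <- (Rmult_1_r (exp (- (7 / 4) * y))) at 2.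
    apply Rmult_le_compat_l. left; apply exp_pos. apply kB_pos. }
  assert (X1 : exp (1 / 4 * al) <= exp (L / 4) * exp (- (1 / 4) * T)).
  { rewrite <- exp_plus. apply exp_le_mono. lra. }
  assert (X2 : exp (- (7 / 4) * be) <= exp (L / 4) * exp (- (1 / 4) * T)).
  { rewrite <- exp_plus. apply exp_le_mono. lra. }
  assert (0 < exp (L / 4) * exp (- (1 / 4) * T)) by (apply Rmult_lt_0_compat; apply exp_pos). lra.
Qed.

Lemma LI_kB_bound (s : C) T : Re s = 7 / 4 -> 0 <= T -> Cmod (LI kB s (- T) T) <= 5.
Proof.
  intros Hs HT.
  assert (Hc : forall a b, Ccont_on (fun y => cexp (- (s * RtoC y)) * RtoC (kB y))%C a b).
  { intros a b. apply LI_integrand_cont, cont_kB. }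
  rewrite <- (LI_Chasles kB s (- T) 0 T); [|lra|apply cont_kB].
  eapply Rle_trans; [apply Cmod_triangle|].
  assert (B1 : Cmod (LI kB s (- T) 0) <= 1 / (1 / 4) * exp (1 / 4 * 0)).
  { apply Cmod_CInt_exp_pos; trivial; try lra. intros y Hy.
    rewrite (Cmod_LI_integrand kB), Hs, Rabs_pos_eq by (generalize (kB_pos y); lra). rewrite Rmult_1_l.
    replace (1 / 4 * y) with (- (7 / 4) * y + 2 * y) by field. rewrite exp_plus.
    apply Rmult_le_compat_l. left; apply exp_pos. apply kB_le_exp2. }
  assert (B2 : Cmod (LI kB s 0 T) <= 1 / (7 / 4) * exp (- (7 / 4) * 0)).
  { apply Cmod_CInt_exp_neg; trivial; try lra. intros y Hy.
    rewrite (Cmod_LI_integrand kB), Hs, Rabs_pos_eq by (generalize (kB_pos y); lra). rewrite Rmult_1_l.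
    rewrite <- (Rmult_1_r (exp (- (7 / 4) * y))) at 2.
    apply Rmult_le_compat_l. left; apply exp_pos. apply kB_pos. }
  rewrite Rmult_0_r, exp_0 in *. lra.
Qed.

Lemma Cmod_cpow_pos (t : R) (s : C) : Cmod (cpow_pos t (Copp s)) = exp (- Re s * ln t).
Proof. rewrite cpow_pos_cexp, Cmod_cexp. f_equal. unfold Re, Cmult, Copp, RtoC; simpl. ring. Qed.

Lemma cont_kB_shift l : cont (fun y => kB (y - l)).
Proof.
  apply cont_of_derive. intros y. unfold kB. auto_derive. match goal with |- context [exp ?t] => generalize (exp_pos t) end; lra.
Qed.

Lemma LI_kB_shift (s : C) l T : 0 <= T ->
  LI (fun y => kB (y - l)) s (- T) T = (cexp (- (s * RtoC l)) * LI kB s (- T - l) (T - l))%C.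
Proof.
  intros HT. unfold LI at 2.
  change (- T - l) with (- T + - l). change (T - l) with (T + - l).
  assert (Hf : forall y, Ccont (fun y => cexp (- (s * RtoC y)) * RtoC (kB y))%C y).
  { intros y. apply (LI_integrand_cont kB s y y cont_kB). lra. }
  rewrite <- CInt_shift; trivial; try lra.
  rewrite <- CInt_scal; try lra.
  - apply CInt_ext. lra. intros y _. change (y - l) with (y + - l).
    replace (cexp (- (s * RtoC y)))%C with (cexp (- (s * RtoC l)) * cexp (- (s * RtoC (y + - l))))%C; [ring|].
    rewrite <- cexp_plus. f_equal. rewrite RtoC_plus, RtoC_opp. ring.
  - intros y _. apply Ccont_mult.
    + destruct s as [u v]. split; unfold cexp, Re, Im; simpl; apply (ex_derive_continuous (K := R_AbsRing) (V := R_NormedModule)); auto_derive; trivial.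
    + apply Ccont_RtoC, cont_kB_shift.
Qed.

Lemma poisson_LI_limit c : 0 < c -> forall eps, 0 < eps -> exists T0, 0 <= T0 /\ forall T s, T0 <= T -> Re s = 7 / 4 ->
  Cmod (cpow_pos c (Copp s) * LI kB s (- T) T - LI (fun y => kB (y - ln c))%R s (- T) T)%C <= eps.
Proof.
  intros Hc eps Heps. set (L := Rabs (ln c)).
  set (Bc := exp (- (7 / 4) * ln c) * (10 * exp (L / 4))).
  assert (HB : 0 <= Bc). { unfold Bc. generalize (exp_pos (- (7 / 4) * ln c)) (exp_pos (L / 4)); nra. }
  destruct (exp_decay Bc (1 / 4) eps HB ltac:(lra) Heps) as [T1 [HT1 HD]].
  assert (HL : 0 <= L) by apply Rabs_pos.
  exists (Rmax T1 L). split. { eapply Rle_trans; [exact HT1 | apply Rmax_l]. }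
  intros T s HT Hs.
  assert (HTa : T1 <= T) by (eapply Rle_trans; [apply Rmax_l | exact HT]).
  assert (HTb : L <= T) by (eapply Rle_trans; [apply Rmax_r | exact HT]).
  rewrite LI_kB_shift by lra.
  rewrite cpow_pos_cexp.
  replace (cexp (RtoC (ln c) * - s))%C with (cexp (- (s * RtoC (ln c))))%C by (f_equal; ring).
  (* The shifted and the unshifted intervals are both compared with the common larger one
     [-T - L, T + L]; hence 10 = 5 + 5 in [Bc]. *)
  replace (cexp (- (s * RtoC (ln c))) * LI kB s (- T) T - cexp (- (s * RtoC (ln c))) * LI kB s (- T - ln c) (T - ln c))%C
    with (cexp (- (s * RtoC (ln c))) * ((LI kB s (- T - L)%R (T + L)%R - LI kB s (- T - ln c)%R (T - ln c)%R)
       - (LI kB s (- T - L)%R (T + L)%R - LI kB s (- T)%R T)))%C by ring.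
  rewrite Cmod_mult, Cmod_cexp, Re_neg_mul, Hs.
  assert (Hl1 := Rle_abs (ln c)). assert (Hl2 := Rle_abs (- ln c)). rewrite Rabs_Ropp in Hl2. fold L in Hl1, Hl2.
  assert (B1 := LI_kB_extend s L T (- T - ln c) (T - ln c) Hs ltac:(lra) ltac:(lra) ltac:(lra)).
  assert (B2 := LI_kB_extend s L T (- T) T Hs ltac:(lra) ltac:(lra) ltac:(lra)).
  specialize (HD T HTa). unfold Bc in HD.
  apply Rle_trans with (2 := HD). rewrite Rmult_assoc. apply Rmult_le_compat_l. left; apply exp_pos.
  unfold Cminus at 1. eapply Rle_trans; [apply Cmod_triangle|]. rewrite Cmod_opp. lra.
Qed.

(** * The identity on the line Re s = 7/4 and its propagation *)

Definition pairterm (a : R) (s : C) (k : nat) : C :=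
  (cpow_pos (INR k + a) (- s) + cpow_pos (INR k + (1 - a)) (- s))%C.

Definition wpair (a th : R) (k : nat) : R :=
  exp (- th * ln (INR k + a)) + exp (- th * ln (INR k + (1 - a))).

Lemma Cmod_pairterm a s k : Cmod (pairterm a s k) <= wpair a (Re s) k.
Proof.
  unfold pairterm, wpair. eapply Rle_trans; [apply Cmod_triangle|]. rewrite !Cmod_cpow_pos. lra.
Qed.

Lemma is_series_pairterm a F1 F2 (s : C) : is_hurwitz_zeta (1 - a) F1 -> is_hurwitz_zeta a F2 -> 1 < Re s ->
  @is_series C_AbsRing C_NormedModule (pairterm a s) (F1 s + F2 s)%C.
Proof.
  intros [_ H1] [_ H2] Hs. specialize (H1 s Hs). specialize (H2 s Hs).
  rewrite Cplus_comm.
  apply (is_series_plus (K := C_AbsRing) (V := C_NormedModule)); [exact H2 | exact H1].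
Qed.

(** Convergence of the majorant is read off from the hypotheses at the real point th, where the
    Dirichlet terms are positive. *)
Lemma is_series_wpair a F1 F2 th : is_hurwitz_zeta (1 - a) F1 -> is_hurwitz_zeta a F2 -> 1 < th ->
  is_series (wpair a th) (Re (F1 (RtoC th) + F2 (RtoC th))%C).
Proof.
  intros H1 H2 Hth.
  apply (is_series_ext (fun k => Re (pairterm a (RtoC th) k))).
  - intros k. unfold pairterm, wpair, cpow_pos, Re, Im; simpl. rewrite Ropp_0, !Rmult_0_l, cos_0, !Rmult_1_r. reflexivity.
  - apply is_series_Re, is_series_pairterm; trivial.
Qed.

Definition partial_kernel (a : R) (K : nat) (y : R) : R := sum_n (fun k => exp y * poisson2 a (exp y) k) K.

Lemma poisson2_kB a k y : 0 < a < 1 ->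
  exp y * poisson2 a (exp y) k = kB (y - ln (INR k + a)) + kB (y - ln (INR k + (1 - a))).
Proof.
  intros Ha. assert (Hk := pos_INR k). unfold poisson2.
  replace (INR k + 1 - a) with (INR k + (1 - a)) by ring.
  rewrite Rmult_plus_distr_l, !poisson_kB by lra. reflexivity.
Qed.

Lemma cont_plus k1 k2 : cont k1 -> cont k2 -> cont (fun y => k1 y + k2 y).
Proof. intros H1 H2 y. apply (continuous_plus (V := R_NormedModule)); auto. Qed.

Lemma cont_ext k1 k2 : (forall y, k1 y = k2 y) -> cont k1 -> cont k2.
Proof. intros E H y. apply (continuous_ext k1); auto. Qed.

Lemma LI_ext k1 k2 s a b : a <= b -> (forall y, k1 y = k2 y) -> LI k1 s a b = LI k2 s a b.
Proof. intros Hab E. apply CInt_ext; trivial. intros y _. rewrite E. reflexivity. Qed.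

Lemma cont_poisson2 a k : 0 < a < 1 -> cont (fun y => exp y * poisson2 a (exp y) k).
Proof.
  intros Ha. apply (cont_ext (fun y => kB (y - ln (INR k + a)) + kB (y - ln (INR k + (1 - a))))).
  - intros y. rewrite poisson2_kB; trivial.
  - apply cont_plus; apply cont_kB_shift.
Qed.

Lemma cont_partial_kernel a K : 0 < a < 1 -> cont (partial_kernel a K).
Proof.
  intros Ha. induction K as [|K IH].
  - apply (cont_ext (fun y => exp y * poisson2 a (exp y) 0)).
    + intros y. unfold partial_kernel. rewrite sum_O. reflexivity.
    + apply cont_poisson2; trivial.
  - apply (cont_ext (fun y => partial_kernel a K y + exp y * poisson2 a (exp y) (S K))).
    + intros y. unfold partial_kernel. rewrite sum_SnR. reflexivity.
    + apply cont_plus; trivial. apply cont_poisson2; trivial.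
Qed.

Lemma pairterm_LI_limit a k : 0 < a < 1 -> forall eps, 0 < eps -> exists T0, 0 <= T0 /\ forall T s, T0 <= T -> Re s = 7 / 4 ->
  Cmod (pairterm a s k * LI kB s (- T) T - LI (fun y => exp y * poisson2 a (exp y) k)%R s (- T) T)%C <= eps.
Proof.
  intros Ha eps Heps. assert (Hk := pos_INR k).
  destruct (poisson_LI_limit (INR k + a) ltac:(lra) (eps / 2) ltac:(lra)) as [T1 [HT1 H1]].
  destruct (poisson_LI_limit (INR k + (1 - a)) ltac:(lra) (eps / 2) ltac:(lra)) as [T2 [HT2 H2]].
  exists (T1 + T2). split. lra. intros T s HT Hs.
  rewrite (LI_ext (fun y => exp y * poisson2 a (exp y) k) (fun y => kB (y - ln (INR k + a)) + kB (y - ln (INR k + (1 - a))))); [|lra|intros; apply poisson2_kB; trivial].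
  rewrite LI_plus; try lra; try apply cont_kB_shift.
  unfold pairterm. specialize (H1 T s ltac:(lra) Hs). specialize (H2 T s ltac:(lra) Hs).
  replace (_ - _)%C with ((cpow_pos (INR k + a) (- s) * LI kB s (- T) T - LI (fun y => kB (y - ln (INR k + a)))%R s (- T) T)
    + (cpow_pos (INR k + (1 - a)) (- s) * LI kB s (- T) T - LI (fun y => kB (y - ln (INR k + (1 - a))))%R s (- T) T))%C by ring.
  eapply Rle_trans; [apply Cmod_triangle|]. lra.
Qed.

Lemma partial_LI_limit a K : 0 < a < 1 -> forall eps, 0 < eps -> exists T0, 0 <= T0 /\ forall T s, T0 <= T -> Re s = 7 / 4 ->
  Cmod (Csum (pairterm a s) K * LI kB s (- T) T - LI (partial_kernel a K) s (- T) T)%C <= eps.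
Proof.
  intros Ha. induction K as [|K IH]; intros eps Heps.
  - destruct (pairterm_LI_limit a 0 Ha eps Heps) as [T0 [HT0 H]]. exists T0; split; trivial.
    intros T s HT Hs. specialize (H T s HT Hs).
    rewrite sum_O. rewrite (LI_ext (partial_kernel a 0) (fun y => exp y * poisson2 a (exp y) 0)); trivial. lra.
    intros y; unfold partial_kernel; rewrite sum_O; reflexivity.
  - destruct (pairterm_LI_limit a (S K) Ha (eps / 2) ltac:(lra)) as [T1 [HT1 H1]].
    destruct (IH (eps / 2) ltac:(lra)) as [T2 [HT2 H2]].
    exists (T1 + T2). split. lra. intros T s HT Hs.
    specialize (H1 T s ltac:(lra) Hs). specialize (H2 T s ltac:(lra) Hs).
    rewrite CsumS, (LI_ext (partial_kernel a (S K)) (fun y => partial_kernel a K y + exp y * poisson2 a (exp y) (S K))).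
    2: lra. 2: intros y; unfold partial_kernel; rewrite sum_SnR; reflexivity.
    rewrite LI_plus. 2: lra. 2: apply cont_partial_kernel; trivial. 2: apply cont_poisson2; trivial.
    match goal with |- Cmod ((?A + ?B) * ?L - (?X + ?Y))%C <= _ =>
      replace ((A + B) * L - (X + Y))%C with ((A * L - X) + (B * L - Y))%C by ring end.
    eapply Rle_trans; [apply Cmod_triangle|]. lra.
Qed.

(** The bound kB(y) <= exp(th y) for 0 <= th <= 2 dominates each term of the kernel by exp(th y)
    times the matching Dirichlet term, so tail is compared with tail. *)
Lemma kK_partial_bound a th W K y : 0 < a < 1 -> 0 <= th <= 2 -> is_series (wpair a th) W ->
  0 <= kK a y - partial_kernel a K y <= exp (th * y) * (W - sum_n (wpair a th) K).
Proof.
  intros Ha Hth HW.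
  assert (Hy := exp_pos y).
  assert (HK : is_series (fun k => exp y * poisson2 a (exp y) k) (kK a y)).
  { apply (is_series_scal (K := R_AbsRing) (V := R_NormedModule) (exp y)), is_series_poisson2; trivial. }
  assert (Hp : forall k, 0 <= exp y * poisson2 a (exp y) k <= exp (th * y) * wpair a th k).
  { intros k. rewrite poisson2_kB by trivial. unfold wpair. rewrite Rmult_plus_distr_l, <- !exp_plus.
    assert (B1 := kB_pos (y - ln (INR k + a))). assert (B2 := kB_pos (y - ln (INR k + (1 - a)))).
    assert (B3 := kB_le_exp th (y - ln (INR k + a)) Hth). assert (B4 := kB_le_exp th (y - ln (INR k + (1 - a))) Hth).
    replace (th * y + - th * ln (INR k + a)) with (th * (y - ln (INR k + a))) by ring.
    replace (th * y + - th * ln (INR k + (1 - a))) with (th * (y - ln (INR k + (1 - a)))) by ring. lra. }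
  split.
  - assert (H := sum_n_le_series _ _ K HK ltac:(intros k; apply Hp)). unfold partial_kernel. lra.
  - assert (HW' : is_series (fun k => exp (th * y) * wpair a th k) (exp (th * y) * W)).
    { apply (is_series_scal (K := R_AbsRing) (V := R_NormedModule) (exp (th * y))); trivial. }
    assert (HD : is_series (fun k => exp (th * y) * wpair a th k - exp y * poisson2 a (exp y) k) (exp (th * y) * W - kK a y)).
    { apply (is_series_minus (K := R_AbsRing) (V := R_NormedModule)); trivial. }
    assert (H := sum_n_le_series _ _ K HD ltac:(intros k; specialize (Hp k); lra)).
    assert (E : sum_n (fun k => exp (th * y) * wpair a th k - exp y * poisson2 a (exp y) k) K
      = exp (th * y) * sum_n (wpair a th) K - partial_kernel a K y).
    { unfold partial_kernel. clear. induction K as [|K IH]. rewrite !sum_O; reflexivity. rewrite !sum_SnR, IH. apply Rminus_diag_uniq. ring. }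
    rewrite E in H. lra.
Qed.

(** th = 2 serves for y <= 0 and th = 3/2 for y >= 0. Against exp(-7 y / 4) each leaves decay at
    rate 1/4, whose integral is 4. The bound depends neither on T nor on Im s. *)
Lemma kK_partial_LI a W2 W3 K T (s : C) : 0 < a < 1 -> 0 <= T -> Re s = 7 / 4 ->
  is_series (wpair a 2) W2 -> is_series (wpair a (3 / 2)) W3 ->
  Cmod (LI (kK a) s (- T) T - LI (partial_kernel a K) s (- T) T)%C
  <= 4 * (W2 - sum_n (wpair a 2) K) + 4 * (W3 - sum_n (wpair a (3 / 2)) K).
Proof.
  intros Ha HT Hs H2 H3.
  assert (HkK := cont_kK a Ha). assert (Hp := cont_partial_kernel a K Ha).
  assert (Hm := cont_minus _ _ HkK Hp).
  assert (B2 := fun y => kK_partial_bound a 2 W2 K y Ha ltac:(lra) H2).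
  assert (B3 := fun y => kK_partial_bound a (3 / 2) W3 K y Ha ltac:(lra) H3).
  set (t2 := W2 - sum_n (wpair a 2) K) in *. set (t3 := W3 - sum_n (wpair a (3 / 2)) K) in *.
  assert (Ht2 : 0 <= t2). { specialize (B2 0). rewrite Rmult_0_r, exp_0 in B2. lra. }
  assert (Ht3 : 0 <= t3). { specialize (B3 0). rewrite Rmult_0_r, exp_0 in B3. lra. }
  rewrite <- LI_minus by (trivial; lra).
  rewrite <- (LI_Chasles _ s (- T) 0 T) by (trivial; lra).
  eapply Rle_trans; [apply Cmod_triangle|]. apply Rplus_le_compat.
  - eapply Rle_trans; [apply (Cmod_CInt_exp_pos _ t2 (1 / 4)); try lra|].
    + apply (LI_integrand_cont (fun y => kK a y - partial_kernel a K y)); trivial.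
    + intros y Hy. rewrite (Cmod_LI_integrand (fun y => kK a y - partial_kernel a K y)), Hs.
      specialize (B2 y). rewrite Rabs_pos_eq by lra.
      apply Rle_trans with (exp (- (7 / 4) * y) * (exp (2 * y) * t2)).
      * apply Rmult_le_compat_l. left; apply exp_pos. lra.
      * right. replace (1 / 4 * y) with (- (7 / 4) * y + 2 * y) by field. rewrite exp_plus. ring.
    + rewrite Rmult_0_r, exp_0. lra.
  - eapply Rle_trans; [apply (Cmod_CInt_exp_neg _ t3 (1 / 4)); try lra|].
    + apply (LI_integrand_cont (fun y => kK a y - partial_kernel a K y)); trivial.
    + intros y Hy. rewrite (Cmod_LI_integrand (fun y => kK a y - partial_kernel a K y)), Hs.
      specialize (B3 y). rewrite Rabs_pos_eq by lra.
      apply Rle_trans with (exp (- (7 / 4) * y) * (exp (3 / 2 * y) * t3)).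
      * apply Rmult_le_compat_l. left; apply exp_pos. lra.
      * right. replace (- (1 / 4) * y) with (- (7 / 4) * y + 3 / 2 * y) by field. rewrite exp_plus. ring.
    + rewrite Rmult_0_r, exp_0. lra.
Qed.

(** The truncated integrals continued to the left: an entire part plus explicit poles. On Re s = 7/4
    they agree with the integrals over [-T, T] up to O(exp(-3 T / 4)). *)
Definition MB (j : nat) (T : R) (s : C) : C := (core kB (PB j) T s + hatB j s)%C.
Definition MK (a : R) (T : R) (s : C) : C := (core (kK a) PK T s + hatK s)%C.

(** The number K of Dirichlet terms is fixed first, through tails uniform in T and s, and T is taken
    large afterwards. [T0] does not depend on s, as the right edge in [seq_vanishing] requires. *)
Lemma line_limit a F1 F2 j : 0 < a < 1 -> is_hurwitz_zeta (1 - a) F1 -> is_hurwitz_zeta a F2 ->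
  forall eps, 0 < eps -> exists T0, 0 <= T0 /\ forall T s, T0 <= T -> Re s = 7 / 4 ->
    Cmod ((F1 s + F2 s) * MB j T s - MK a T s)%C <= eps.
Proof.
  intros Ha HF1 HF2 eps Heps.
  destruct (core_line kB (PB j) (hatB j) _ _ (kB_kernel_bound j) (laplace_cont_B j)) as [B1 [HB1 L1]].
  destruct (kK_kernel_bound a 0 Ha) as [A KA].
  destruct (core_line (kK a) PK hatK _ _ KA laplace_cont_K) as [B2 [HB2 L2]].
  assert (S2 := is_series_wpair a F1 F2 2 HF1 HF2 ltac:(lra)).
  assert (S3 := is_series_wpair a F1 F2 (3 / 2) HF1 HF2 ltac:(lra)).
  assert (S7 := is_series_wpair a F1 F2 (7 / 4) HF1 HF2 ltac:(lra)).
  match type of S2 with is_series _ ?w => set (W2 := w) in * end.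
  match type of S3 with is_series _ ?w => set (W3 := w) in * end.
  match type of S7 with is_series _ ?w => set (W7 := w) in * end.
  assert (Hw : forall th k, 0 <= wpair a th k).
  { intros th k. unfold wpair. generalize (exp_pos (- th * ln (INR k + a))) (exp_pos (- th * ln (INR k + (1 - a)))); lra. }
  (* The five errors in the final decomposition add up to at most 16 e: e, 5 e, e, 8 e and e. *)
  set (e := eps / 20).
  destruct (is_series_R_eps _ _ S2 e ltac:(unfold e; lra)) as [N2 HN2].
  destruct (is_series_R_eps _ _ S3 e ltac:(unfold e; lra)) as [N3 HN3].
  destruct (is_series_R_eps _ _ S7 e ltac:(unfold e; lra)) as [N7 HN7].
  set (K := (N2 + N3 + N7)%nat).
  specialize (HN2 K ltac:(unfold K; lia)). specialize (HN3 K ltac:(unfold K; lia)). specialize (HN7 K ltac:(unfold K; lia)).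
  apply Rabs_le_between in HN2. apply Rabs_le_between in HN3. apply Rabs_le_between in HN7.
  assert (HW7 : 0 <= W7).
  { apply Rle_trans with (sum_n (wpair a (7 / 4)) 0). rewrite sum_O; apply Hw. apply sum_n_le_series; auto. }
  destruct (partial_LI_limit a K Ha e ltac:(unfold e; lra)) as [T1 [HT1 P1]].
  destruct (exp_decay (W7 * B1) (3 / 4) e) as [T2 [HT2 P2]]; try (unfold e; lra). { apply Rmult_le_pos; lra. }
  destruct (exp_decay B2 (3 / 4) e) as [T3 [HT3 P3]]; try (unfold e; lra).
  exists (T1 + T2 + T3). split. lra. intros T s HT Hs.
  specialize (P1 T s ltac:(lra) Hs). specialize (P2 T ltac:(lra)). specialize (P3 T ltac:(lra)).
  specialize (L1 s T ltac:(lra) Hs). specialize (L2 s T ltac:(lra) Hs).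
  assert (HSs := is_series_pairterm a F1 F2 s HF1 HF2 ltac:(lra)).
  assert (Hwb : forall k, Cmod (pairterm a s k) <= wpair a (7 / 4) k). { intros k; rewrite <- Hs; apply Cmod_pairterm. }
  assert (Q1 := fun K => Csum_tail_bound _ _ _ _ K HSs S7 Hwb).
  set (Ss := (F1 s + F2 s)%C) in *.
  assert (QS : Cmod Ss <= W7).
  { specialize (Q1 0%nat). rewrite !sum_O in Q1. specialize (Hwb 0%nat).
    replace Ss with ((Ss - pairterm a s 0) + pairterm a s 0)%C by ring. eapply Rle_trans; [apply Cmod_triangle|]. lra. }
  specialize (Q1 K).
  assert (Q2 := LI_kB_bound s T Hs ltac:(lra)).
  assert (Q3 := kK_partial_LI a W2 W3 K T s Ha ltac:(lra) Hs S2 S3).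
  fold (MB j T s) in L1. fold (MK a T s) in L2.
  set (LB := LI kB s (- T) T) in *. set (LK := LI (kK a) s (- T) T) in *. set (LP := LI (partial_kernel a K) s (- T) T) in *.
  set (SK := Csum (pairterm a s) K) in *.
  replace (Ss * MB j T s - MK a T s)%C with
    (- (Ss * (LB - MB j T s)) + ((Ss - SK) * LB + ((SK * LB - LP) + (- (LK - LP) + (LK - MK a T s)))))%C by ring.
  assert (R1 : Cmod (Ss * (LB - MB j T s)) <= e).
  { rewrite Cmod_mult. apply Rle_trans with (W7 * (B1 * exp (- (3 / 4) * T))); [|lra].
    apply Rmult_le_compat; trivial; apply Cmod_ge_0. }
  assert (R2 : Cmod ((Ss - SK) * LB) <= e * 5).
  { rewrite Cmod_mult. apply Rmult_le_compat; try apply Cmod_ge_0; lra. }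
  eapply Rle_trans; [apply Cmod_triangle|]. rewrite Cmod_opp.
  assert (X1 := Cmod_triangle ((Ss - SK) * LB) ((SK * LB - LP) + (- (LK - LP) + (LK - MK a T s)))).
  assert (X2 := Cmod_triangle (SK * LB - LP) (- (LK - LP) + (LK - MK a T s))).
  assert (X3 := Cmod_triangle (- (LK - LP)) (LK - MK a T s)). rewrite Cmod_opp in X3.
  unfold e in *. lra.
Qed.

Lemma Ccont_on_bounded f a b : a <= b -> Ccont_on f a b -> exists M, forall x, a <= x <= b -> Cmod (f x) <= M.
Proof.
  intros Hab Hf.
  destruct (continuity_ab_maj (fun x => Rabs (Re (f x)) + Rabs (Im (f x))) a b Hab) as [x0 [H _]].
  - intros x Hx. destruct (Hf x Hx) as [H1 H2]. apply continuity_pt_filterlim.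
    apply (continuous_plus (V := R_NormedModule) (fun x => Rabs (Re (f x))) (fun x => Rabs (Im (f x))));
    [apply (continuous_comp (fun x => Re (f x)) Rabs) | apply (continuous_comp (fun x => Im (f x)) Rabs)]; trivial; apply continuous_Rabs.
  - exists (Rabs (Re (f x0)) + Rabs (Im (f x0))). intros x Hx.
    eapply Rle_trans; [apply Cmod_le_Rabs_sum|]. apply (H x Hx).
Qed.

(** The bottom edge at height e / 2 keeps the rectangle off the real singularities with s inside,
    since e <= 1. On the edges, MB and MK are bounded uniformly in n, and F1 + F2 by continuity. *)
Lemma strip_limit a F1 F2 j (e : R) : 0 < a < 1 -> is_hurwitz_zeta (1 - a) F1 -> is_hurwitz_zeta a F2 ->
  0 < e <= 1 -> let s := (- (2 * INR j), e) in
  forall eps, 0 < eps -> exists n0, forall n, (n0 <= n)%nat ->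
    Cmod ((F1 s + F2 s) * MB j (INR n) s - MK a (INR n) s)%C <= eps.
Proof.
  intros Ha HF1 HF2 He s. assert (HP := PI_RGT_0). assert (HP2 := PI2_3_2). assert (Hj := pos_INR j).
  (* This is 1 - q for q = 2 (j + 1), the leftmost abscissa that [core_bound] allows. *)
  set (lft := - (2 * INR j) - 1).
  assert (HqB := kB_kernel_bound j).
  destruct (kK_kernel_bound a (2 * S j) Ha) as [A HqK].
  assert (Eq : INR (2 * S j) = 2 * INR (S j)) by (rewrite mult_INR; reflexivity).
  rewrite Eq in HqK. assert (EqS := S_INR j).
  assert (HSd : forall z, 0 < Im z -> Cdiff (fun s => F1 s + F2 s)%C z).
  { intros z Hz. assert (Hz1 : z <> RtoC 1). { intros E. rewrite E in Hz. unfold Im in Hz; simpl in Hz; lra. }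
    apply Cdiff_plus; [apply (proj1 HF1) | apply (proj1 HF2)]; trivial. }
  set (H := fun n s => ((F1 s + F2 s) * MB j (INR n) s - MK a (INR n) s)%C).
  apply (seq_vanishing H s lft (7 / 4) (e / 2)).
  - unfold s, lft; simpl. lra.
  - unfold s; simpl. lra.
  - intros n x y Hx Hy. unfold H, MB, MK. apply Cdiff_minus.
    + apply Cdiff_mult. apply HSd; simpl; lra. apply Cdiff_plus.
      * apply Cdiff_core; [apply cont_kB | apply cont_PB | apply pos_INR].
      * apply (lc_diff _ _ (laplace_cont_B j)). simpl; lra.
    + apply Cdiff_plus.
      * apply Cdiff_core; [apply cont_kK; trivial | apply (kb_contP _ _ _ _ HqK) | apply pos_INR].
      * apply (lc_diff _ _ laplace_cont_K). simpl; lra.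
  - destruct (lc_bound _ _ (laplace_cont_B j) (e / 2) ltac:(lra)) as [BB HBB].
    destruct (lc_bound _ _ laplace_cont_K (e / 2) ltac:(lra)) as [BK HBK].
    assert (HM : exists M, on_edges (fun z => Cmod (F1 z + F2 z)%C <= M) lft (7 / 4) (e / 2) (e / 2 + PI)).
    { assert (Hec : edge_cont (fun s => F1 s + F2 s)%C lft (7 / 4) (e / 2) (e / 2 + PI)).
      { apply hol_on_edge_cont; try (unfold lft; lra). intros x y Hx Hy. apply HSd. simpl; lra. }
      destruct Hec as [[E1 E2] [E3 E4]].
      apply Ccont_on_bounded in E1, E2, E3, E4; try (unfold lft; lra).
      destruct E1 as [M1 E1], E2 as [M2 E2], E3 as [M3 E3], E4 as [M4 E4].
      exists (Rmax (Rmax M1 M2) (Rmax M3 M4)).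
      assert (X1 := Rmax_l (Rmax M1 M2) (Rmax M3 M4)). assert (X2 := Rmax_r (Rmax M1 M2) (Rmax M3 M4)).
      assert (Y1 := Rmax_l M1 M2). assert (Y2 := Rmax_r M1 M2). assert (Y3 := Rmax_l M3 M4). assert (Y4 := Rmax_r M3 M4).
      split; intros t Ht; split.
      - specialize (E1 t Ht). cbv beta in E1. lra.
      - specialize (E2 t Ht). cbv beta in E2. lra.
      - specialize (E3 t Ht). cbv beta in E3. lra.
      - specialize (E4 t Ht). cbv beta in E4. lra. }
    destruct HM as [M [HM1 HM2]].
    exists (M * (5 * 1 + BB) + (5 * A + BK)). intros n.
    assert (G : forall x y, lft <= x <= 7 / 4 -> e / 2 <= y -> Cmod (F1 (x, y) + F2 (x, y))%C <= M ->
      Cmod (H n (x, y)) <= M * (5 * 1 + BB) + (5 * A + BK)).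
    { intros x y Hx Hy HS. unfold H, Cminus. eapply Rle_trans; [apply Cmod_triangle|]. rewrite Cmod_opp, Cmod_mult.
      assert (C1 := core_bound _ _ _ _ (INR n) (x, y) HqB (pos_INR n) ltac:(unfold Re; simpl fst; unfold lft in *; lra)).
      assert (C2 := core_bound _ _ _ _ (INR n) (x, y) HqK (pos_INR n) ltac:(unfold Re; simpl fst; unfold lft in *; lra)).
      specialize (HBB (x, y) Hy). specialize (HBK (x, y) Hy).
      apply Rplus_le_compat.
      - apply Rmult_le_compat; try apply Cmod_ge_0; trivial. unfold MB. eapply Rle_trans; [apply Cmod_triangle|]. lra.
      - unfold MK. eapply Rle_trans; [apply Cmod_triangle|]. lra. }
    split; intros t Ht; split; apply G; try (unfold lft in *; lra); first [apply HM1 | apply HM2]; trivial.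
  - intros eps Heps. destruct (line_limit a F1 F2 j Ha HF1 HF2 eps Heps) as [T0 [HT0 HL]].
    destruct (INR_unbounded T0) as [n0 Hn0]. exists n0. intros n y Hn Hy. apply HL; [|reflexivity].
    apply le_INR in Hn. lra.
Qed.

(** * The value at -2j *)

(* An antiderivative of exp (- v) v^m, from 0 at +oo to - m! at 0. *)
Fixpoint gamma_prim (m : nat) (v : R) : R :=
  match m with
  | O => - exp (- v)
  | S i => - (exp (- v) * v ^ m) + INR m * gamma_prim i v
  end.

Lemma is_derive_gamma_prim (m : nat) (v : R) : is_derive (gamma_prim m) v (exp (- v) * v ^ m).
Proof.
  induction m as [|m IH].
  - change (is_derive (fun v => - exp (- v)) v (exp (- v) * v ^ 0)). auto_derive; trivial. ring.
  - change (is_derive (fun v => - (exp (- v) * v ^ S m) + INR (S m) * gamma_prim m v) v (exp (- v) * v ^ S m)).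
    replace (exp (- v) * v ^ S m) with ((exp (- v) * v ^ S m - exp (- v) * (INR (S m) * v ^ m)) + INR (S m) * (exp (- v) * v ^ m)) by ring.
    apply (is_derive_plus (V := R_NormedModule) (fun v => - (exp (- v) * v ^ S m)) (fun v => INR (S m) * gamma_prim m v)).
    + auto_derive; trivial. change (pred (S m)) with m.
      change (match m with 0%nat => 1 | S _ => INR m + 1 end) with (INR (S m)). change (v ^ S m) with (v * v ^ m). ring.
    + apply is_derive_scal. exact IH.
Qed.

Lemma gamma_prim_0 m : gamma_prim m 0 = - INR (Factorial.fact m).
Proof.
  induction m as [|m IH].
  - simpl. rewrite Ropp_0, exp_0. reflexivity.
  - change (- (exp (- 0) * 0 ^ S m) + INR (S m) * gamma_prim m 0 = - INR (Factorial.fact (S m))).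
    rewrite IH, fact_simpl, mult_INR, pow_i by lia. ring.
Qed.

Lemma gamma_prim_le_0 m v : 0 <= v -> gamma_prim m v <= 0.
Proof.
  intros Hv. assert (He := exp_pos (- v)). induction m as [|m IH].
  - simpl. lra.
  - change (- (exp (- v) * v ^ S m) + INR (S m) * gamma_prim m v <= 0).
    assert (0 <= v ^ S m) by (apply pow_le; trivial). assert (Hm := pos_INR (S m)).
    assert (0 <= exp (- v) * v ^ S m) by (apply Rmult_le_pos; lra). nra.
Qed.

Lemma gamma_prim_ge m v : 0 <= v -> - INR (Factorial.fact m) <= gamma_prim m v.
Proof.
  intros Hv. rewrite <- gamma_prim_0.
  apply (increment_ge_0 (gamma_prim m) (fun v => exp (- v) * v ^ m)); trivial.
  - intros x; apply is_derive_gamma_prim.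
  - intros x Hx. apply Rmult_le_pos. left; apply exp_pos. apply pow_le; lra.
Qed.

Lemma gamma_prim_near_0 m v : 0 <= v <= 1 -> gamma_prim m v <= - INR (Factorial.fact m) + v.
Proof.
  intros Hv.
  assert (H : 0 - gamma_prim m 0 <= v - gamma_prim m v).
  { apply (increment_ge_0 (fun v => v - gamma_prim m v) (fun v => 1 - exp (- v) * v ^ m)); try lra.
    - intros x. apply (is_derive_minus (V := R_NormedModule) (fun v => v) (gamma_prim m)).
      auto_derive; trivial. apply is_derive_gamma_prim.
    - intros x Hx. assert (exp (- x) <= 1) by (rewrite <- exp_0; apply exp_le_mono; lra).
      assert (x ^ m <= 1) by (rewrite <- (pow1 m); apply pow_incr; lra).
      assert (0 <= x ^ m) by (apply pow_le; lra). assert (Hp := exp_pos (- x)). nra. }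
  rewrite gamma_prim_0 in H. lra.
Qed.

Lemma gamma_prim_infty m : exists c, 0 <= c /\ forall v, 0 < v -> - (c / v) <= gamma_prim m v.
Proof.
  assert (G : forall m v, 0 < v -> exp (- v) * v ^ m <= INR (Factorial.fact (S m)) / v).
  { clear m. intros m v Hv. assert (H := exp_ge_pow_fact (S m) v ltac:(lra)).
    assert (Hf := INR_fact_lt_0 (S m)). assert (He := exp_pos v). assert (Hvm : 0 < v ^ S m) by (apply pow_lt; trivial).
    rewrite exp_Ropp. apply (Rmult_le_reg_r (exp v * v)). apply Rmult_lt_0_compat; trivial.
    replace (/ exp v * v ^ m * (exp v * v)) with (v ^ S m) by (change (v ^ S m) with (v * v ^ m); field; lra).
    replace (INR (Factorial.fact (S m)) / v * (exp v * v)) with (INR (Factorial.fact (S m)) * exp v) by (field; lra).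
    apply Rmult_le_compat_l with (r := INR (Factorial.fact (S m))) in H; [|lra].
    replace (INR (Factorial.fact (S m)) * (v ^ S m / INR (Factorial.fact (S m)))) with (v ^ S m) in H by (field; lra). exact H. }
  induction m as [|m [c [Hc IH]]].
  - exists 1. split. lra. intros v Hv. specialize (G 0%nat v Hv). rewrite pow_O, Rmult_1_r in G.
    change (INR (Factorial.fact 1)) with 1 in G. change (- (1 / v) <= - exp (- v)). lra.
  - assert (Hf := INR_fact_lt_0 (S (S m))). assert (Hm := pos_INR (S m)).
    exists (INR (Factorial.fact (S (S m))) + INR (S m) * c). split. { assert (0 <= INR (S m) * c) by (apply Rmult_le_pos; trivial). lra. }
    intros v Hv. specialize (IH v Hv). specialize (G (S m) v Hv).
    change (- ((INR (Factorial.fact (S (S m))) + INR (S m) * c) / v) <= - (exp (- v) * v ^ S m) + INR (S m) * gamma_prim m v).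
    replace ((INR (Factorial.fact (S (S m))) + INR (S m) * c) / v) with (INR (Factorial.fact (S (S m))) / v + INR (S m) * (c / v)) by (field; lra).
    apply Rmult_le_compat_l with (r := INR (S m)) in IH; trivial. lra.
Qed.

(** With u = exp y, the integral of u^m exp(-la u) over exp(-T) < u < exp T, a truncation of m! /
    la^(m+1). *)
Definition gam_int (m : nat) (la T : R) : R := RInt (fun y => exp (INR (S m) * y) * exp (- (la * exp y))) (- T) T.

Lemma cont_gam m la : cont (fun y => exp (INR (S m) * y) * exp (- (la * exp y))).
Proof. apply cont_of_derive. intros y. auto_derive; trivial. Qed.

Lemma gam_int_eq m la T : 0 < la ->
  gam_int m la T = (gamma_prim m (la * exp T) - gamma_prim m (la * exp (- T))) / la ^ S m.
Proof.
  intros Hla. assert (Hl : 0 < la ^ S m) by (apply pow_lt; trivial).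
  unfold gam_int. apply is_RInt_unique.
  replace ((gamma_prim m (la * exp T) - gamma_prim m (la * exp (- T))) / la ^ S m)
    with (minus (/ la ^ S m * gamma_prim m (la * exp T)) (/ la ^ S m * gamma_prim m (la * exp (- T)))).
  2: { match goal with |- minus ?x ?y = ?z => change (x - y = z) end. unfold Rdiv. ring. }
  apply (is_RInt_derive (V := R_CompleteNormedModule) (fun y => / la ^ S m * gamma_prim m (la * exp y))).
  - intros y _.
    replace (exp (INR (S m) * y) * exp (- (la * exp y)))
      with (/ la ^ S m * (la * exp y * (exp (- (la * exp y)) * (la * exp y) ^ m))).
    + apply is_derive_scal.
      apply (is_derive_comp (V := R_NormedModule) (gamma_prim m) (fun y => la * exp y)).
      apply is_derive_gamma_prim. auto_derive; trivial. ring.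
    + replace (exp (INR (S m) * y)) with (exp y ^ S m) by (rewrite exp_pow; f_equal; ring).
      rewrite Rpow_mult_distr. change (la ^ S m) with (la * la ^ m). change (exp y ^ S m) with (exp y * exp y ^ m).
      assert (0 < la ^ m) by (apply pow_lt; trivial). field. lra.
  - intros y _. apply cont_gam.
Qed.

Lemma gam_int_le m la T : 0 < la -> gam_int m la T <= INR (Factorial.fact m) / la ^ S m.
Proof.
  intros Hla. rewrite gam_int_eq by trivial.
  assert (Hl : 0 < la ^ S m) by (apply pow_lt; trivial).
  apply Rmult_le_compat_r. left; apply Rinv_0_lt_compat; trivial.
  assert (H1 := gamma_prim_le_0 m (la * exp T)). assert (H2 := gamma_prim_ge m (la * exp (- T))).
  assert (0 <= la * exp T) by (apply Rmult_le_pos; [lra | left; apply exp_pos]).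
  assert (0 <= la * exp (- T)) by (apply Rmult_le_pos; [lra | left; apply exp_pos]).
  specialize (H1 H). specialize (H2 H0). lra.
Qed.

Lemma gam_int_limit m la eps : 0 < la -> 0 < eps -> exists T0, 0 <= T0 /\ forall T, T0 <= T ->
  Rabs (gam_int m la T - INR (Factorial.fact m) / la ^ S m) <= eps.
Proof.
  intros Hla Heps. assert (Hl : 0 < la ^ S m) by (apply pow_lt; trivial).
  destruct (gamma_prim_infty m) as [c [Hc HG]].
  assert (Hcl : 0 <= c / la) by (apply Rmult_le_pos; [trivial | left; apply Rinv_0_lt_compat; trivial]).
  destruct (exp_decay (c / la + la) 1 (eps * la ^ S m)) as [T1 [HT1 D1]]; try lra. { apply Rmult_lt_0_compat; trivial. }
  destruct (exp_decay la 1 1) as [T2 [HT2 D2]]; try lra.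
  exists (T1 + T2). split. lra. intros T HT. specialize (D1 T ltac:(lra)). specialize (D2 T ltac:(lra)).
  replace (- (1) * T) with (- T) in * by ring.
  rewrite gam_int_eq by trivial.
  assert (He := exp_pos T). assert (He' := exp_pos (- T)).
  assert (P1 : 0 < la * exp T) by (apply Rmult_lt_0_compat; trivial).
  assert (P2 : 0 < la * exp (- T)) by (apply Rmult_lt_0_compat; trivial).
  assert (Q1 := HG _ P1). assert (Q2 := gamma_prim_le_0 m (la * exp T) ltac:(lra)).
  assert (Q3 := gamma_prim_ge m (la * exp (- T)) ltac:(lra)). assert (Q4 := gamma_prim_near_0 m (la * exp (- T)) ltac:(lra)).
  assert (E : c / (la * exp T) = c / la * exp (- T)) by (rewrite exp_Ropp; field; lra).
  set (F := INR (Factorial.fact m)) in *.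
  replace ((gamma_prim m (la * exp T) - gamma_prim m (la * exp (- T))) / la ^ S m - F / la ^ S m)
    with ((gamma_prim m (la * exp T) - gamma_prim m (la * exp (- T)) - F) * / la ^ S m) by (unfold Rdiv; ring).
  rewrite Rabs_mult, Rabs_inv, (Rabs_pos_eq (la ^ S m)) by lra.
  apply (Rmult_le_reg_r (la ^ S m)); trivial. rewrite Rmult_assoc, Rinv_l, Rmult_1_r by lra.
  apply Rle_trans with (2 := D1). apply Rabs_le. nra.
Qed.

(** * Evaluation of the continued kernel integral at -2j *)

Lemma LI_real k r a b : a <= b -> cont k -> LI k (RtoC r) a b = RtoC (RInt (fun y => exp (- r * y) * k y) a b).
Proof.
  intros Hab Hk. unfold LI.
  rewrite (CInt_ext _ (fun y => RtoC (exp (- r * y) * k y))); trivial.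
  - unfold CInt, RtoC, Re, Im; simpl. apply f_equal2. reflexivity.
    rewrite RInt_const. apply (scal_zero_r (K := R_AbsRing) (V := R_NormedModule)).
  - intros y _. rewrite RtoC_mult. f_equal.
    unfold cexp, RtoC, Re, Im, Copp, Cmult; simpl.
    replace (- (r * 0 + 0 * y)) with 0 by ring. replace (- (r * y - 0 * 0)) with (- r * y) by ring.
    rewrite cos_0, sin_0. apply f_equal2; ring.
Qed.

Lemma RInt_sum_n (c : nat -> R) (f : nat -> R -> R) a b N : (forall l, cont (f l)) ->
  cont (fun y => sum_n (fun l => c l * f l y) N) /\
  RInt (fun y => sum_n (fun l => c l * f l y) N) a b = sum_n (fun l => c l * RInt (f l) a b) N.
Proof.
  intros Hf.
  assert (Hc : forall l, cont (fun y => c l * f l y)).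
  { intros l y. apply (continuous_mult (K := R_AbsRing)). apply continuous_const. apply Hf. }
  assert (Hs : forall l, RInt (fun y => c l * f l y) a b = c l * RInt (f l) a b).
  { intros l. apply (RInt_scal (V := R_CompleteNormedModule) (f l) a b (c l)). apply cont_ex_RInt, Hf. }
  induction N as [|N [IH1 IH2]].
  - split.
    + apply (cont_ext (fun y => c 0%nat * f 0%nat y)); trivial. intros y; rewrite sum_O; reflexivity.
    + rewrite sum_O, <- Hs. apply RInt_ext. intros y _; rewrite sum_O; reflexivity.
  - split.
    + apply (cont_ext (fun y => sum_n (fun l => c l * f l y) N + c (S N) * f (S N) y)).
      * intros y; rewrite sum_SnR; reflexivity.
      * apply cont_plus; trivial.
    + rewrite sum_SnR, <- IH2, <- Hs.
      rewrite <- (RInt_plus (V := R_CompleteNormedModule)) by (apply cont_ex_RInt; trivial).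
      apply RInt_ext. intros y _; rewrite sum_SnR; reflexivity.
Qed.

Lemma sum_gam_limit m (c : nat -> R) N eps : (forall l, Rabs (c l) <= 1) -> 0 < eps ->
  exists T0, 0 <= T0 /\ forall T, T0 <= T ->
  Rabs (sum_n (fun l => c l * gam_int m (2 * PI * INR (S l)) T) N
        - sum_n (fun l => c l * (INR (Factorial.fact m) / (2 * PI * INR (S l)) ^ S m)) N) <= eps.
Proof.
  intros Hc. revert eps.
  assert (Hl : forall l, 0 < 2 * PI * INR (S l)).
  { intros l. assert (HP := PI_RGT_0). apply Rmult_lt_0_compat. lra. apply lt_0_INR; lia. }
  assert (G : forall l T e, Rabs (gam_int m (2 * PI * INR (S l)) T - INR (Factorial.fact m) / (2 * PI * INR (S l)) ^ S m) <= e ->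
    Rabs (c l * gam_int m (2 * PI * INR (S l)) T - c l * (INR (Factorial.fact m) / (2 * PI * INR (S l)) ^ S m)) <= e).
  { intros l T e He. rewrite <- Rmult_minus_distr_l, Rabs_mult. specialize (Hc l).
    generalize (Rabs_pos (c l)) (Rabs_pos (gam_int m (2 * PI * INR (S l)) T - INR (Factorial.fact m) / (2 * PI * INR (S l)) ^ S m)). nra. }
  induction N as [|N IH]; intros eps Heps.
  - destruct (gam_int_limit m _ eps (Hl 0%nat) Heps) as [T0 [HT0 H]]. exists T0; split; trivial.
    intros T HT. rewrite !sum_O. apply G, H; trivial.
  - destruct (gam_int_limit m _ (eps / 2) (Hl (S N)) ltac:(lra)) as [T1 [HT1 H1]].
    destruct (IH (eps / 2) ltac:(lra)) as [T2 [HT2 H2]].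
    exists (T1 + T2). split. lra. intros T HT. rewrite !sum_SnR.
    specialize (H1 T ltac:(lra)). specialize (H2 T ltac:(lra)). apply G in H1.
    match goal with |- Rabs (?A + ?B - (?X + ?Y)) <= _ => replace (A + B - (X + Y)) with ((A - X) + (B - Y)) by ring end.
    eapply Rle_trans; [apply Rabs_triang|]. lra.
Qed.

(** At s = -2j the continued value of the transform of [PK] is minus its convergent integral over y
    < 0. Hence [PK] may be subtracted on both half-lines; the exponential term is what truncation at
    -T leaves over. *)
Lemma MK_real a j T : 0 < a < 1 -> 0 <= T ->
  MK a T (RtoC (- (2 * INR j))) =
  RtoC (RInt (fun y => exp (2 * INR j * y) * (kK a y - PK y)) (- T) T - PI * exp (- (2 * INR j + 1) * T) / (2 * INR j + 1)).
Proof.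
  intros Ha HT. assert (Hj := pos_INR j).
  assert (Hk := cont_kK a Ha). assert (HP : cont PK) by (apply cont_of_derive; intros y; unfold PK; auto_derive; trivial).
  assert (Hm := cont_minus _ _ Hk HP).
  assert (He : cont (fun y => exp (2 * INR j * y))) by (apply cont_of_derive; intros y; auto_derive; trivial).
  assert (Hmul : forall k, cont k -> cont (fun y => exp (2 * INR j * y) * k y)).
  { intros k Hk' y. apply (continuous_mult (K := R_AbsRing)); auto. }
  unfold MK, core. rewrite !LI_real by (trivial; lra).
  rewrite Ropp_involutive.
  assert (E1 : RInt (fun y => exp (2 * INR j * y) * kK a y) (- T) 0
    = RInt (fun y => exp (2 * INR j * y) * (kK a y - PK y)) (- T) 0 + PI * ((1 - exp (- (2 * INR j + 1) * T)) / (2 * INR j + 1))).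
  { assert (E2 : is_RInt (fun y => PI * exp ((2 * INR j + 1) * y)) (- T) 0 (PI * ((exp ((2 * INR j + 1) * 0) - exp ((2 * INR j + 1) * - T)) / (2 * INR j + 1)))).
    { apply (is_RInt_scal (V := R_NormedModule)), RInt_exp. lra. }
    rewrite Rmult_0_r, exp_0 in E2. replace ((2 * INR j + 1) * - T) with (- (2 * INR j + 1) * T) in E2 by ring.
    rewrite <- (is_RInt_unique _ _ _ _ E2).
    rewrite <- (RInt_plus (V := R_CompleteNormedModule)).
    - apply RInt_ext. intros y _. unfold PK.
      replace ((2 * INR j + 1) * y) with (2 * INR j * y + y) by ring. rewrite exp_plus.
      match goal with |- _ = plus ?x ?z => change (plus x z) with (x + z) end. apply Rminus_diag_uniq. ring.
    - apply cont_ex_RInt, Hmul; trivial.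
    - eexists; exact E2. }
  rewrite E1.
  assert (E3 : hatK (RtoC (- (2 * INR j))) = RtoC (- (PI / (2 * INR j + 1)))).
  { unfold hatK. rewrite <- RtoC_plus, <- RtoC_div by lra. f_equal. field. lra. }
  rewrite E3, <- !RtoC_plus. f_equal.
  rewrite <- (RInt_Chasles (V := R_CompleteNormedModule) (fun y => exp (2 * INR j * y) * (kK a y - PK y)) (- T) 0 T)
    by (apply cont_ex_RInt, Hmul; trivial).
  match goal with |- context [plus ?x ?z] => change (plus x z) with (x + z) end. field. lra.
Qed.

Lemma Rabs_cos_le_1 x : Rabs (cos x) <= 1.
Proof. apply Rabs_le. generalize (COS_bound x); lra. Qed.

(** The remainder after the terms l <= N is dominated by a multiple of the next exponential. Its
    integral is bounded uniformly in T and tends to 0 with N even for j = 0, without absolute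
    convergence of the cosine series. *)
Lemma RInt_kK_approx a j N T : 0 < a < 1 -> 0 <= T ->
  Rabs (RInt (fun y => exp (2 * INR j * y) * (kK a y - PK y)) (- T) T
    - 2 * PI * sum_n (fun l => cos (INR (S l) * (2 * PI * a)) * gam_int (2 * j) (2 * PI * INR (S l)) T) N)
  <= 2 * PI * (4 / (1 - cos (2 * PI * a)) * (INR (Factorial.fact (2 * j)) / (2 * PI * INR (S (S N))) ^ S (2 * j))).
Proof.
  intros Ha HT. assert (HP := PI_RGT_0). assert (Hd := one_sub_cos_pos a Ha).
  set (d := 1 - cos (2 * PI * a)) in *. assert (H4 : 0 < 4 / d) by (apply Rdiv_lt_0_compat; lra).
  set (f := fun l y => exp (INR (S (2 * j)) * y) * exp (- (2 * PI * INR (S l) * exp y))).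
  destruct (RInt_sum_n (fun l => cos (INR (S l) * (2 * PI * a))) f (- T) T N) as [S1 S2].
  { intros l. apply cont_gam. }
  unfold gam_int. fold (f 0%nat).
  change (fun l => cos (INR (S l) * (2 * PI * a)) * RInt (fun y => exp (INR (S (2 * j)) * y) * exp (- (2 * PI * INR (S l) * exp y))) (- T) T)
    with (fun l => cos (INR (S l) * (2 * PI * a)) * RInt (f l) (- T) T).
  rewrite <- S2.
  assert (Hk := cont_kK a Ha). assert (HcP : cont PK) by (apply cont_of_derive; intros y; unfold PK; auto_derive; trivial).
  assert (Hm := cont_minus _ _ Hk HcP).
  assert (He : cont (fun y => exp (2 * INR j * y) * (kK a y - PK y))).
  { intros y. apply (continuous_mult (K := R_AbsRing)); auto.
    apply (ex_derive_continuous (K := R_AbsRing) (V := R_NormedModule)). auto_derive; trivial. }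
  set (g := fun y => sum_n (fun l => cos (INR (S l) * (2 * PI * a)) * f l y) N) in *.
  assert (Hg2 : cont (fun y => 2 * PI * g y)).
  { intros y. apply (continuous_mult (K := R_AbsRing)). apply continuous_const. apply S1. }
  assert (E1 : 2 * PI * RInt g (- T) T = RInt (fun y => 2 * PI * g y) (- T) T).
  { symmetry. apply (RInt_scal (V := R_CompleteNormedModule) g (- T) T (2 * PI)). apply cont_ex_RInt; trivial. }
  rewrite E1.
  assert (E2 : RInt (fun y => exp (2 * INR j * y) * (kK a y - PK y)) (- T) T - RInt (fun y => 2 * PI * g y) (- T) T
    = RInt (fun y => exp (2 * INR j * y) * (kK a y - PK y) - 2 * PI * g y) (- T) T).
  { symmetry. apply (RInt_minus (V := R_CompleteNormedModule)); apply cont_ex_RInt; trivial. }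
  rewrite E2.
  set (c0 := 2 * PI * (4 / d)).
  assert (Hfb : forall y, Rabs (exp (2 * INR j * y) * (kK a y - PK y) - 2 * PI * g y) <= c0 * f (S N) y).
  { intros y. set (u := exp y). assert (Hu : 0 < u) by apply exp_pos.
    assert (G := geom_rem_bound a u (S N) Ha ltac:(lra)). fold d in G.
    assert (Es : exp (INR (S (2 * j)) * y) = exp (2 * INR j * y) * u).
    { unfold u. rewrite <- exp_plus. f_equal. rewrite S_INR, mult_INR. change (INR 2) with 2. ring. }
    assert (Eg : g y = exp (2 * INR j * y) * u * sum_n (fun l => cos (INR (S l) * (2 * PI * a)) * exp (- (2 * PI * u)) ^ S l) N).
    { unfold g, f. rewrite <- Es. clear. fold u. induction N as [|N IH].
      - rewrite !sum_O, exp_pow. replace (- (2 * PI * INR 1 * u)) with (- (2 * PI * u) * INR 1) by ring.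
        apply Rminus_diag_uniq; ring.
      - rewrite !sum_SnR, IH, exp_pow. replace (- (2 * PI * INR (S (S N)) * u)) with (- (2 * PI * u) * INR (S (S N))) by ring.
        apply Rminus_diag_uniq; ring. }
    rewrite Eg. unfold kK, PK. fold u. rewrite (kappa_geom a u N Ha ltac:(lra)).
    match goal with |- Rabs ?X <= _ => replace X with (exp (2 * INR j * y) * u * (2 * PI) * geom_rem a u (S N)) by ring end.
    assert (0 < exp (2 * INR j * y)) by apply exp_pos.
    assert (Hpos : 0 < exp (2 * INR j * y) * u * (2 * PI)) by (apply Rmult_lt_0_compat; [apply Rmult_lt_0_compat; trivial | lra]).
    rewrite Rabs_mult, (Rabs_pos_eq _ (Rlt_le _ _ Hpos)).
    unfold f. rewrite Es. fold u.
    replace (- (2 * PI * INR (S (S N)) * u)) with (- (2 * PI * u) * INR (S (S N))) by ring. rewrite <- exp_pow.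
    replace (c0 * (exp (2 * INR j * y) * u * exp (- (2 * PI * u)) ^ S (S N)))
      with (exp (2 * INR j * y) * u * (2 * PI) * (4 / d * exp (- (2 * PI * u)) ^ S (S N))) by (unfold c0; ring).
    apply Rmult_le_compat_l; lra. }
  assert (Hcf : cont (fun y => c0 * f (S N) y)).
  { intros y. apply (continuous_mult (K := R_AbsRing)). apply continuous_const. apply cont_gam. }
  assert (Hcd := cont_minus _ _ He Hg2).
  apply Rle_trans with (RInt (fun y => c0 * f (S N) y) (- T) T).
  - eapply Rle_trans; [apply abs_RInt_le; [lra | apply cont_ex_RInt; exact Hcd]|].
    apply RInt_le; try lra.
    + apply cont_ex_RInt. intros y. apply (continuous_comp _ Rabs). apply Hcd. apply continuous_Rabs.
    + apply cont_ex_RInt; trivial.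
    + intros y _. apply Hfb.
  - assert (E3 : RInt (fun y => c0 * f (S N) y) (- T) T = c0 * gam_int (2 * j) (2 * PI * INR (S (S N))) T).
    { apply (RInt_scal (V := R_CompleteNormedModule) (f (S N)) (- T) T c0). apply cont_ex_RInt, cont_gam. }
    rewrite E3. unfold c0. rewrite Rmult_assoc. apply Rmult_le_compat_l. lra. apply Rmult_le_compat_l. lra.
    apply gam_int_le. apply Rmult_lt_0_compat. lra. apply lt_0_INR; lia.
Qed.

Lemma MK_limit a j N eps : 0 < a < 1 -> 0 < eps -> exists T0, 0 <= T0 /\ forall T, T0 <= T ->
  Cmod (MK a T (RtoC (- (2 * INR j)))
    - RtoC (2 * PI * sum_n (fun l => cos (INR (S l) * (2 * PI * a)) * (INR (Factorial.fact (2 * j)) / (2 * PI * INR (S l)) ^ S (2 * j))) N)%R)%C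
  <= eps + 2 * PI * (4 / (1 - cos (2 * PI * a)) * (INR (Factorial.fact (2 * j)) / (2 * PI * INR (S (S N))) ^ S (2 * j))).
Proof.
  intros Ha Heps. assert (HP := PI_RGT_0). assert (Hj := pos_INR j).
  destruct (sum_gam_limit (2 * j) (fun l => cos (INR (S l) * (2 * PI * a))) N (eps / (4 * PI))) as [T1 [HT1 H1]].
  { intros l; apply Rabs_cos_le_1. } { apply Rdiv_lt_0_compat; lra. }
  assert (Hc : 0 < PI / (2 * INR j + 1)) by (apply Rdiv_lt_0_compat; lra).
  destruct (exp_decay (PI / (2 * INR j + 1)) (2 * INR j + 1) (eps / 2)) as [T2 [HT2 H2]]; try lra.
  exists (T1 + T2). split. lra. intros T HT. specialize (H1 T ltac:(lra)). specialize (H2 T ltac:(lra)).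
  assert (H3 := RInt_kK_approx a j N T Ha ltac:(lra)).
  rewrite MK_real, <- RtoC_minus, Cmod_R by (trivial; lra).
  set (I := RInt (fun y => exp (2 * INR j * y) * (kK a y - PK y)) (- T) T) in *.
  set (S1 := sum_n (fun l => cos (INR (S l) * (2 * PI * a)) * gam_int (2 * j) (2 * PI * INR (S l)) T) N) in *.
  set (S2 := sum_n (fun l => cos (INR (S l) * (2 * PI * a)) * (INR (Factorial.fact (2 * j)) / (2 * PI * INR (S l)) ^ S (2 * j))) N) in *.
  assert (H4 : Rabs (2 * PI * (S1 - S2)) <= eps / 2).
  { rewrite Rabs_mult, Rabs_pos_eq by lra. replace (eps / 2) with (2 * PI * (eps / (4 * PI))) by (field; lra).
    apply Rmult_le_compat_l; lra. }
  assert (H5 : PI * exp (- (2 * INR j + 1) * T) / (2 * INR j + 1) = PI / (2 * INR j + 1) * exp (- (2 * INR j + 1) * T)) by (field; lra).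
  rewrite H5. set (r := PI / (2 * INR j + 1) * exp (- (2 * INR j + 1) * T)) in *.
  assert (0 <= r). { unfold r. apply Rmult_le_pos; [lra | left; apply exp_pos]. }
  apply Rabs_le_between in H3. apply Rabs_le_between in H4. apply Rabs_le. lra.
Qed.

(** * Conclusion *)

Lemma Cmod_inv_le_1 (z : C) : Re z <= - 1 -> z <> 0%C /\ Cmod (/ z) <= 1.
Proof.
  intros H.
  assert (Hz : z <> 0%C). { intros E. rewrite E in H. unfold Re in H; simpl in H; lra. }
  split; trivial. rewrite Cmod_inv by trivial. rewrite <- Rinv_1. apply Rinv_le_contravar; [lra|].
  eapply Rle_trans; [|apply re_le_Cmod]. rewrite Rabs_left1; lra.
Qed.

Lemma Cmod_sign j : Cmod (RtoC ((-1) ^ j)) = 1.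
Proof. rewrite Cmod_R. apply pow_1_abs. Qed.

Lemma hatB_left_bound i (s : C) : Re s + 2 * INR i <= - 1 -> Cmod (hatB i s) <= INR i + 1.
Proof.
  induction i as [|i IH]; intros H.
  - change (INR 0) with 0 in *. change (Cmod (RtoC 1 / (s + RtoC 0))%C <= 0 + 1).
    destruct (Cmod_inv_le_1 (s + RtoC 0)%C) as [_ H1]. { unfold Re in *; simpl in *; lra. }
    unfold Cdiv. rewrite Cmod_mult, Cmod_1. lra.
  - change (Cmod (hatB i s + RtoC ((-1) ^ S i) / (s + RtoC (2 * INR (S i))))%C <= INR (S i) + 1).
    destruct (Cmod_inv_le_1 (s + RtoC (2 * INR (S i)))%C) as [_ H1].
    { change (Re s + 2 * INR (S i) <= -1). exact H. }
    eapply Rle_trans; [apply Cmod_triangle|]. unfold Cdiv. rewrite Cmod_mult, Cmod_sign.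
    rewrite S_INR in *. specialize (IH ltac:(lra)). lra.
Qed.

Lemma Cmod_imag (e : R) : Cmod (0, e) = Rabs e.
Proof.
  replace ((0, e) : C) with (Ci * RtoC e)%C by (unfold Ci, RtoC, Cmult; simpl; apply f_equal2; ring).
  rewrite Cmod_mult, Cmod_Ci, Cmod_R. ring.
Qed.

Lemma imag_neq_0 (e : R) : 0 < e -> ((0, e) : C) <> 0%C.
Proof. intros He E. assert (H := Cmod_imag e). rewrite E, Cmod_0, Rabs_pos_eq in H; lra. Qed.

(** Only the last partial fraction has its pole at -2j. The other j poles stay at distance at least
    1 and contribute O(e) after multiplication by i e. *)
Lemma hatB_pole j (e : R) : 0 < e ->
  Cmod ((0, e) * hatB j ((- (2 * INR j))%R, e) - RtoC ((-1) ^ j))%C <= e * (INR j + 1).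
Proof.
  intros He. assert (Hne := imag_neq_0 e He). destruct j as [|i].
  - change (INR 0) with 0. change (hatB 0 (- (2 * 0), e)) with (RtoC 1 / (((- (2 * 0))%R, e) + RtoC 0))%C.
    replace (((- (2 * 0))%R, e) + RtoC 0)%C with ((0, e) : C) by (unfold Cplus, RtoC; simpl; apply f_equal2; ring).
    replace (_ - _)%C with (RtoC 0). rewrite Cmod_0; lra. rewrite pow_O. field. trivial.
  - set (s := (- (2 * INR (S i)), e) : C).
    change (hatB (S i) s) with (hatB i s + RtoC ((-1) ^ S i) / (s + RtoC (2 * INR (S i))))%C.
    replace (s + RtoC (2 * INR (S i)))%C with ((0, e) : C) by (unfold s, Cplus, RtoC; simpl fst; simpl snd; apply f_equal2; ring).
    replace (_ - _)%C with ((0, e) * hatB i s)%C by (field; trivial).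
    rewrite Cmod_mult, Cmod_imag, Rabs_pos_eq by lra. apply Rmult_le_compat_l. lra.
    assert (Hs : Re s = - (2 * INR (S i))) by reflexivity.
    assert (H := hatB_left_bound i s). rewrite S_INR in *. specialize (H ltac:(lra)). lra.
Qed.

Lemma hatK_left j (e : R) : 0 < e -> let s0 := RtoC (- (2 * INR j)) in
  Cmod (hatK (s0 + (0, e))%C) <= PI /\ Cmod (hatK (s0 + (0, e)) - hatK s0)%C <= PI * e.
Proof.
  intros He s0. assert (Hj := pos_INR j). assert (HP := PI_RGT_0).
  destruct (Cmod_inv_le_1 (s0 + (0, e) + RtoC (-1))%C) as [N1 B1]. { unfold s0, Re; simpl. lra. }
  destruct (Cmod_inv_le_1 (s0 + RtoC (-1))%C) as [N2 B2]. { unfold s0, Re; simpl. lra. }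
  unfold hatK. split.
  - unfold Cdiv. rewrite Cmod_mult, Cmod_R, Rabs_pos_eq by lra. nra.
  - replace (_ - _)%C with (- (RtoC PI * ((0, e) * (/ (s0 + (0, e) + RtoC (-1)) * / (s0 + RtoC (-1))))))%C by (field; split; trivial).
    rewrite Cmod_opp, !Cmod_mult, Cmod_R, Cmod_imag, !Rabs_pos_eq by lra.
    apply Rmult_le_compat_l. lra.
    assert (G1 := Cmod_ge_0 (/ (s0 + (0, e) + RtoC (-1)))). assert (G2 := Cmod_ge_0 (/ (s0 + RtoC (-1)))).
    rewrite <- (Rmult_1_r e) at 3. apply Rmult_le_compat_l; nra.
Qed.

Lemma Cadd_sub_cancel (z w : C) : (z + w - z)%C = w.
Proof. ring. Qed.

(** At s = s0 + i e the relation S MB = MK, up to an error vanishing as n grows, becomes S (sg +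
    O(e)) = i e MK after multiplication by i e. The limit e -> 0 gives S(s0) = 0; division by i e
    then gives sg D = MK(s0) + O(e), with constants independent of n. *)
Lemma deriv_limit a F1 F2 j D : 0 < a < 1 -> is_hurwitz_zeta (1 - a) F1 -> is_hurwitz_zeta a F2 ->
  is_Cderive (fun s => F1 s + F2 s)%C (RtoC (- (2 * INR j))) D ->
  forall eps, 0 < eps -> exists n0, forall n, (n0 <= n)%nat ->
    Cmod (MK a (INR n) (RtoC (- (2 * INR j))) - RtoC ((-1) ^ j) * D)%C <= eps.
Proof.
  intros Ha HF1 HF2 HD. assert (Hj := pos_INR j). assert (HP := PI_RGT_0).
  set (s0 := RtoC (- (2 * INR j))) in *. set (sg := RtoC ((-1) ^ j)).
  assert (Hsg : Cmod sg = 1) by apply Cmod_sign.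
  destruct (kK_kernel_bound a (2 * S j) Ha) as [A HqK].
  assert (Eq : INR (2 * S j) = 2 * INR (S j)) by (rewrite mult_INR; reflexivity).
  rewrite Eq in HqK. assert (EqS := S_INR j). assert (HA := kb_ge_0 _ _ _ _ HqK).
  set (Sf := fun s => (F1 s + F2 s)%C) in *.
  rewrite is_Cderive_eps in HD.
  change (forall eps, 0 < eps -> exists delta, 0 < delta /\ forall w, Cmod (w - s0)%C < delta ->
    Cmod (Sf w - Sf s0 - (w - s0) * D)%C <= eps * Cmod (w - s0)%C) in HD.
  assert (Es : forall e, (s0 + (0, e))%C = (- (2 * INR j), e)).
  { intros e. unfold s0, RtoC, Cplus; simpl. apply f_equal2; ring. }
  set (B1 := INR j + 6). set (BK := 5 * A + PI).
  assert (HB1 : 0 < B1) by (unfold B1; lra). assert (HBK : 0 <= BK) by (unfold BK; lra).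
  (* at s = s0 + i e the kernel MB is (sg + O(e)) / (i e), uniformly in n *)
  assert (HMB : forall e n, 0 < e -> Cmod ((0, e) * MB j (INR n) (s0 + (0, e)) - sg)%C <= B1 * e).
  { intros e n He. unfold MB.
    assert (C1 := core_bound _ _ _ _ (INR n) (s0 + (0, e))%C (kB_kernel_bound j) (pos_INR n) ltac:(rewrite Es; unfold Re; simpl fst; lra)).
    assert (C2 := hatB_pole j e He). rewrite <- Es in C2. fold sg in C2.
    replace (_ - _)%C with ((0, e) * core kB (PB j) (INR n) (s0 + (0, e)) + ((0, e) * hatB j (s0 + (0, e)) - sg))%C by ring.
    eapply Rle_trans; [apply Cmod_triangle|]. rewrite Cmod_mult, Cmod_imag, Rabs_pos_eq by lra.
    unfold B1. nra. }
  assert (HMK : forall e n, 0 < e -> Cmod (MK a (INR n) (s0 + (0, e))%C) <= BK).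
  { intros e n He. unfold MK, BK. eapply Rle_trans; [apply Cmod_triangle|]. apply Rplus_le_compat.
    - apply (core_bound _ _ _ _ (INR n) _ HqK (pos_INR n)). rewrite Es; unfold Re; simpl fst; lra.
    - apply hatK_left; trivial. }
  assert (HMK2 : forall e n, 0 < e -> Cmod (MK a (INR n) (s0 + (0, e)) - MK a (INR n) s0)%C <= (136 * A + PI) * e).
  { intros e n He. unfold MK.
    replace (_ - _)%C with ((core (kK a) PK (INR n) (s0 + (0, e)) - core (kK a) PK (INR n) s0) + (hatK (s0 + (0, e)) - hatK s0))%C by ring.
    eapply Rle_trans; [apply Cmod_triangle|].
    assert (C1 := core_lipschitz _ _ _ _ (INR n) s0 e HqK (pos_INR n) ltac:(unfold s0, Re, RtoC; simpl fst; lra)).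
    rewrite (Rabs_pos_eq e) in C1 by lra. assert (C2 := proj2 (hatK_left j e He)). fold s0 in C2. lra. }
  (* For a fixed e the error eta is arbitrary, and [n0] depends on both: n is chosen after e. *)
  assert (HX : forall e, 0 < e <= 1 -> forall eta, 0 < eta -> exists n0, forall n, (n0 <= n)%nat ->
    Cmod (Sf (s0 + (0, e))%C * ((0, e) * MB j (INR n) (s0 + (0, e))) - (0, e) * MK a (INR n) (s0 + (0, e)))%C <= e * eta).
  { intros e He eta Heta. destruct (strip_limit a F1 F2 j e Ha HF1 HF2 He eta Heta) as [n0 Hn0].
    exists n0. intros n Hn. specialize (Hn0 n Hn). rewrite <- Es in Hn0.
    replace (_ - _)%C with ((0, e) * (Sf (s0 + (0, e))%C * MB j (INR n) (s0 + (0, e)) - MK a (INR n) (s0 + (0, e))))%C by ring.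
    rewrite Cmod_mult, Cmod_imag, Rabs_pos_eq by lra. apply Rmult_le_compat_l. lra. exact Hn0. }
  assert (Hd : forall e, 0 < e -> Cmod (s0 + (0, e) - s0)%C = e).
  { intros e He. rewrite Cadd_sub_cancel. rewrite Cmod_imag, Rabs_pos_eq; lra. }
  assert (HS0 : Sf s0 = 0%C).
  { apply Cmod_eq_0, Rle_antisym; [|apply Cmod_ge_0]. apply le_epsilon. intros eps Heps. rewrite Rplus_0_l.
    destruct (HD 1 Rlt_0_1) as [del [Hdel HD1]].
    (* |S(s0)| <= |S(w)| + e + e |D|, and |S(w)| <= 2 e (1 + BK) because |p| >= 1/2 and MK is
       bounded. The sum is e Q. *)
    set (Q := 3 + Cmod D + 2 * BK). assert (HDp := Cmod_ge_0 D). assert (HQ : 0 < Q) by (unfold Q; lra).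
    set (e := Rmin (Rmin 1 (del / 2)) (Rmin (/ (2 * B1)) (eps / Q))).
    assert (He : 0 < e). { repeat apply Rmin_glb_lt; try lra. apply Rinv_0_lt_compat; lra. apply Rdiv_lt_0_compat; lra. }
    assert (He1 : e <= 1) by (eapply Rle_trans; apply Rmin_l).
    assert (He2 : e <= del / 2) by (eapply Rle_trans; [apply Rmin_l | apply Rmin_r]).
    assert (He3 : e <= / (2 * B1)) by (eapply Rle_trans; [apply Rmin_r | apply Rmin_l]).
    assert (He4 : e <= eps / Q) by (eapply Rle_trans; [apply Rmin_r | apply Rmin_r]).
    specialize (HD1 (s0 + (0, e))%C). rewrite Hd in HD1 by trivial. specialize (HD1 ltac:(lra)).
    destruct (HX e ltac:(lra) 1 Rlt_0_1) as [n Hn]. specialize (Hn n (le_n n)).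
    specialize (HMB e n He). specialize (HMK e n He).
    set (w := (s0 + (0, e))%C) in *. set (p := ((0, e) * MB j (INR n) w)%C) in *.
    assert (Hp : 1 / 2 <= Cmod p).
    { assert (B1 * e <= 1 / 2).
      { apply Rle_trans with (B1 * / (2 * B1)). apply Rmult_le_compat_l; lra. right; field; lra. }
      assert (T := Cmod_triangle p (- (p - sg))). replace (p + - (p - sg))%C with sg in T by ring.
      rewrite Cmod_opp in T. lra. }
    assert (HSw : Cmod (Sf w) <= 2 * (e * (1 + BK))).
    { assert (T := Cmod_triangle (Sf w * p - (0, e) * MK a (INR n) w) ((0, e) * MK a (INR n) w)).
      replace (Sf w * p - (0, e) * MK a (INR n) w + (0, e) * MK a (INR n) w)%C with (Sf w * p)%C in T by ring.
      rewrite (Cmod_mult (Sf w)), (Cmod_mult (0, e)), Cmod_imag, Rabs_pos_eq in T by lra.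
      assert (G := Cmod_ge_0 (Sf w)). nra. }
    apply Rle_trans with (e * Q).
    - replace (Sf s0) with (Sf w + - ((Sf w - Sf s0 - (w - s0) * D) + (w - s0) * D))%C by ring.
      eapply Rle_trans; [apply Cmod_triangle|]. rewrite Cmod_opp.
      assert (T := Cmod_triangle (Sf w - Sf s0 - (w - s0) * D) ((w - s0) * D)).
      rewrite (Cmod_mult (w - s0)), (Hd e He : Cmod (w - s0) = e) in T. unfold Q. lra.
    - apply Rmult_le_compat_r with (r := Q) in He4; [|lra]. replace (eps / Q * Q) with eps in He4 by (field; lra). exact He4. }
  intros eps Heps.
  assert (HDp := Cmod_ge_0 D).
  (* Three errors of eps / 4 each: eta from the strip limit, eta (1 + B1) from the Taylor remainder
     of S, and Q e from the pole and from moving MK back to s0. *)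
  set (eta := Rmin (eps / 4) (eps / (4 * (1 + B1)))).
  assert (Heta : 0 < eta). { apply Rmin_glb_lt; apply Rdiv_lt_0_compat; lra. }
  assert (Heta1 : eta <= eps / 4) by apply Rmin_l.
  assert (Heta2 : eta * (1 + B1) <= eps / 4).
  { apply Rle_trans with (eps / (4 * (1 + B1)) * (1 + B1)). apply Rmult_le_compat_r. lra. apply Rmin_r. right; field; lra. }
  destruct (HD eta Heta) as [del [Hdel HD1]].
  set (Q := Cmod D * B1 + (136 * A + PI)). assert (HQ : 0 < Q).
  { unfold Q. assert (0 <= Cmod D * B1) by (apply Rmult_le_pos; lra). lra. }
  set (e := Rmin (Rmin 1 (del / 2)) (eps / (4 * Q))).
  assert (He : 0 < e). { repeat apply Rmin_glb_lt; try lra. apply Rdiv_lt_0_compat; lra. }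
  assert (He1 : e <= 1) by (eapply Rle_trans; apply Rmin_l).
  assert (He2 : e <= del / 2) by (eapply Rle_trans; [apply Rmin_l | apply Rmin_r]).
  assert (He3 : Q * e <= eps / 4).
  { apply Rle_trans with (Q * (eps / (4 * Q))). apply Rmult_le_compat_l. lra. apply Rmin_r. right; field; lra. }
  specialize (HD1 (s0 + (0, e))%C). rewrite Hd in HD1 by trivial. specialize (HD1 ltac:(lra)).
  destruct (HX e ltac:(lra) eta Heta) as [n0 Hn0]. exists n0. intros n Hn. specialize (Hn0 n Hn).
  specialize (HMB e n He). specialize (HMK2 e n He).
  rewrite Cadd_sub_cancel in HD1.
  set (w := (s0 + (0, e))%C) in *. set (p := ((0, e) * MB j (INR n) w)%C) in *.
  set (rho := (Sf w - Sf s0 - (0, e) * D)%C) in *.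
  assert (Hne := imag_neq_0 e He).
  assert (HK : Cmod (MK a (INR n) w - sg * D)%C <= eta + eta * (1 + B1) + Cmod D * (B1 * e)).
  { apply (Rmult_le_reg_l e); trivial.
    replace (e * Cmod (MK a (INR n) w - sg * D)) with (Cmod ((0, e) * (MK a (INR n) w - sg * D)))
      by (rewrite Cmod_mult, Cmod_imag, Rabs_pos_eq; lra).
    (* Since S(s0) = 0, S(w) is i e D + rho. Its product with p, which is close to sg, is compared
       with i e MK. *)
    replace ((0, e) * (MK a (INR n) w - sg * D))%C
      with (- (Sf w * p - (0, e) * MK a (INR n) w) + (rho * (p - sg + sg) + (0, e) * D * (p - sg)))%C
      by (unfold rho; rewrite HS0; ring).
    eapply Rle_trans; [apply Cmod_triangle|]. rewrite Cmod_opp.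
    assert (T1 := Cmod_triangle (rho * (p - sg + sg)) ((0, e) * D * (p - sg))).
    rewrite !Cmod_mult, Cmod_imag, Rabs_pos_eq in T1 by lra.
    assert (T2 := Cmod_triangle (p - sg) sg).
    assert (G1 := Cmod_ge_0 rho). assert (G2 := Cmod_ge_0 (p - sg)). assert (G3 := Cmod_ge_0 (p - sg + sg)).
    assert (T3 : Cmod rho * Cmod (p - sg + sg) <= eta * e * (1 + B1)).
    { apply Rmult_le_compat; trivial. assert (B1 * e <= B1) by nra. lra. }
    assert (T4 : e * Cmod D * Cmod (p - sg) <= e * Cmod D * (B1 * e)).
    { apply Rmult_le_compat_l; trivial. apply Rmult_le_pos; lra. }
    lra. }
  replace (MK a (INR n) s0 - sg * D)%C with (- (MK a (INR n) w - MK a (INR n) s0) + (MK a (INR n) w - sg * D))%C by ring.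
  eapply Rle_trans; [apply Cmod_triangle|]. rewrite Cmod_opp.
  unfold Q in He3. lra.
Qed.

Theorem mainTheorem2 :
  forall (m : nat) (x : R) (F1 F2 : C -> C) (d1 d2 : C),
    (1 <= m)%nat ->
    0 < x < 2 * PI ->
    is_hurwitz_zeta (1 - x / (2 * PI)) F1 ->
    is_hurwitz_zeta (x / (2 * PI)) F2 ->
    is_derive (K := C_AbsRing) F1 (RtoC (2 - 2 * INR m)) d1 ->
    is_derive (K := C_AbsRing) F2 (RtoC (2 - 2 * INR m)) d2 ->
    is_series
      (fun n : nat => RtoC (cos (INR (S n) * x) / INR (S n) ^ (2 * m - 1)))
      (Cmult (RtoC ((-1) ^ (m - 1) * (2 * PI) ^ (2 * m - 2) / INR (Factorial.fact (2 * m - 2))))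
             (Cplus d1 d2)).
Proof.
  intros m x F1 F2 d1 d2 Hm Hx HF1 HF2 Hd1 Hd2.
  (* With m = j + 1 the point 2 - 2m is -2j and the exponent 2m - 1 is 2j + 1. *)
  destruct m as [|j]; [lia|]. clear Hm. assert (HP := PI_RGT_0).
  set (a := x / (2 * PI)) in *.
  assert (Ex : x = 2 * PI * a) by (unfold a; field; lra).
  assert (Ha : 0 < a < 1).
  { unfold a. split. apply Rdiv_lt_0_compat; lra. apply (Rmult_lt_reg_r (2 * PI)). lra.
    replace (x / (2 * PI) * (2 * PI)) with x by (field; lra). lra. }
  replace (S j - 1)%nat with j by lia. replace (2 * S j - 2)%nat with (2 * j)%nat by lia.
  replace (2 * S j - 1)%nat with (S (2 * j)) by lia.
  assert (E0 : 2 - 2 * INR (S j) = - (2 * INR j)) by (rewrite S_INR; ring).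
  rewrite E0 in Hd1, Hd2.
  assert (HD : is_Cderive (fun s => F1 s + F2 s)%C (RtoC (- (2 * INR j))) (d1 + d2)%C).
  { apply (is_derive_plus (K := C_AbsRing) (V := C_NormedModule)); assumption. }
  set (D := (d1 + d2)%C) in *.
  assert (HL := deriv_limit a F1 F2 j D Ha HF1 HF2 HD).
  assert (Hf := INR_fact_lt_0 (2 * j)). set (f := INR (Factorial.fact (2 * j))) in *.
  assert (Hpp : 0 < (2 * PI) ^ (2 * j)) by (apply pow_lt; lra).
  (* The inverse of the prefactor of the theorem, up to the sign (-1)^j. *)
  set (c0 := f / (2 * PI) ^ (2 * j)).
  assert (Hc0 : 0 < c0) by (apply Rdiv_lt_0_compat; lra).
  set (t := fun n => cos (INR (S n) * x) / INR (S n) ^ S (2 * j)).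
  assert (Hn : forall l, 0 < INR (S l)) by (intros l; apply lt_0_INR; lia).
  assert (Esum : forall N, 2 * PI * sum_n (fun l => cos (INR (S l) * (2 * PI * a)) * (f / (2 * PI * INR (S l)) ^ S (2 * j))) N
    = c0 * sum_n t N).
  { assert (G : forall l, 2 * PI * (cos (INR (S l) * (2 * PI * a)) * (f / (2 * PI * INR (S l)) ^ S (2 * j))) = c0 * t l).
    { intros l. unfold t, c0. rewrite <- Ex, Rpow_mult_distr. change ((2 * PI) ^ S (2 * j)) with (2 * PI * (2 * PI) ^ (2 * j)).
      specialize (Hn l). assert (0 < INR (S l) ^ S (2 * j)) by (apply pow_lt; trivial). field. repeat split; lra. }
    induction N as [|N IH]. rewrite !sum_O. apply G. rewrite !sum_SnR, !Rmult_plus_distr_l, IH, G. reflexivity. }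
  set (d := 1 - cos (2 * PI * a)).
  assert (Hd : 0 < d) by (apply one_sub_cos_pos; trivial).
  set (sg := RtoC ((-1) ^ j)) in *.
  set (c1 := 2 * PI * (4 / d * f)).
  assert (Hc1 : 0 < c1). { unfold c1. apply Rmult_lt_0_compat; [lra|]. apply Rmult_lt_0_compat; trivial. apply Rdiv_lt_0_compat; lra. }
  assert (HN : forall N, Cmod (RtoC (c0 * sum_n t N)%R - sg * D)%C <= c1 * / INR (S (S N))).
  { intros N. apply le_epsilon. intros eps Heps.
    destruct (MK_limit a j N (eps / 2) Ha ltac:(lra)) as [T0 [HT0 H1]].
    destruct (HL (eps / 2) ltac:(lra)) as [n0 H2].
    destruct (INR_unbounded T0) as [n1 Hn1].
    assert (Hn1' : T0 <= INR (n0 + n1)). { rewrite plus_INR. generalize (pos_INR n0). lra. }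
    specialize (H1 (INR (n0 + n1)) Hn1'). specialize (H2 (n0 + n1)%nat ltac:(lia)).
    fold f in H1. rewrite Esum in H1. fold d in H1.
    set (M := MK a (INR (n0 + n1)) (RtoC (- (2 * INR j)))) in *.
    replace (_ - _)%C with (- (M - RtoC (c0 * sum_n t N)%R) + (M - sg * D))%C by ring.
    eapply Rle_trans; [apply Cmod_triangle|]. rewrite Cmod_opp.
    enough (2 * PI * (4 / d * (f / (2 * PI * INR (S (S N))) ^ S (2 * j))) <= c1 * / INR (S (S N))) by lra.
    replace (c1 * / INR (S (S N))) with (2 * PI * (4 / d * (f * / INR (S (S N))))) by (unfold c1; ring).
    apply Rmult_le_compat_l; [lra|]. apply Rmult_le_compat_l. { left; apply Rdiv_lt_0_compat; lra. }
    apply Rmult_le_compat_l. lra. specialize (Hn (S N)).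
    apply Rinv_le_contravar; trivial.
    assert (P2 : 1 <= 2 * PI) by (generalize PI2_3_2; lra).
    assert (P1 : 1 <= INR (S (S N))). { change 1 with (INR 1). apply le_INR; lia. }
    set (v := INR (S (S N))) in *.
    (* The power 2j + 1 is weakened to 1, its value at j = 0; the rate 1 / N suffices for
       convergence. *)
    apply Rle_trans with (2 * PI * v). nra.
    rewrite <- (pow_1 (2 * PI * v)) at 1.
    apply Rle_pow; [nra | lia]. }
  apply is_series_C. intros eps Heps.
  destruct (INR_unbounded (c1 / c0 / eps)) as [N0 HN0]. exists N0. intros n Hn0.
  assert (Esn : Csum (fun n => RtoC (t n)) n = RtoC (sum_n t n)).
  { clear. induction n as [|n IH]; [rewrite !sum_O; reflexivity|].
    rewrite CsumS, sum_SnR, IH, RtoC_plus. reflexivity. }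
  fold t.
  change (Cmod (Csum (fun n => RtoC (t n)) n - RtoC ((-1) ^ j * (2 * PI) ^ (2 * j) / f) * D)%C <= eps).
  rewrite Esn.
  assert (Ec : RtoC ((-1) ^ j * (2 * PI) ^ (2 * j) / f) = (RtoC (/ c0) * sg)%C).
  { unfold sg. rewrite <- RtoC_mult. f_equal. unfold c0. field. split; lra. }
  rewrite Ec.
  replace (RtoC (sum_n t n) - RtoC (/ c0) * sg * D)%C with (RtoC (/ c0) * (RtoC (c0 * sum_n t n)%R - sg * D))%C.
  2: { rewrite RtoC_mult.
       assert (Hone : (RtoC (/ c0) * RtoC c0)%C = 1%C) by (rewrite <- RtoC_mult, Rinv_l by lra; reflexivity).
       replace (RtoC (sum_n t n)) with (RtoC (/ c0) * RtoC c0 * RtoC (sum_n t n))%C at 2 by (rewrite Hone; ring). ring. }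
  rewrite Cmod_mult, Cmod_R, Rabs_inv, (Rabs_pos_eq c0) by lra.
  specialize (HN n). specialize (Hn (S n)).
  apply Rle_trans with (/ c0 * (c1 * / INR (S (S n)))).
  { apply Rmult_le_compat_l; trivial. left; apply Rinv_0_lt_compat; trivial. }
  apply (Rmult_le_reg_r (INR (S (S n)))); trivial.
  replace (/ c0 * (c1 * / INR (S (S n))) * INR (S (S n))) with (eps * (c1 / c0 / eps)) by (field; lra).
  apply Rmult_le_compat_l. lra. apply le_INR in Hn0. rewrite !S_INR. lra.
Qed.
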